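(* Let $n\ge 3$ and let $L\ge 0$, $M\ge 0$. There exists a constant $N=N(n,L,M)$, depending only on $n$, $L$ and $M$, with the following property. Suppose that 1. $u\in C^2(\mathbb{B}^n,\mathbb{R}^n)\cap C(\overline{\mathbb{B}^n},\mathbb{R}^n)$ is of the form $u=P_h[\phi]-G_h[\psi]$ in $\mathbb{B}^n$, with $\phi:\mathbb{S}^{n-1}\to\mathbb{R}^n$ and $\psi\in C(\mathbb{B}^n,\mathbb{R}^n)$; 2. $|\phi(\xi)-\phi(\eta)|\le L|\xi-\eta|$ for all $\xi,\eta\in\mathbb{S}^{n-1}$; 3. $|\psi(x)|\le M(1-|x|^2)$ for all $x\in\mathbb{B}^n$. Then for all $x,y\in\mathbb{B}^n$, $$|u(x)-u(y)|\le N|x-y|.$$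
   Context: $\mathbb{B}^n$ is the open unit ball of $\mathbb{R}^n$ and $\mathbb{S}^{n-1}$ its boundary. $\sigma$ is the surface measure on $\mathbb{S}^{n-1}$ normalized by $\sigma(\mathbb{S}^{n-1})=1$; $\nu$ is $n$-dimensional Lebesgue measure normalized by $\nu(\mathbb{B}^n)=1$; and $d\tau(x)=(1-|x|^2)^{-n}\,d\nu(x)$. Poisson integral: $P_h(x,\xi)=\left(\frac{1-|x|^2}{|\xi-x|^2}\right)^{n-1}$ for $(x,\xi)\in\mathbb{B}^n\times\mathbb{S}^{n-1}$, and $P_h[\phi](x)=\int_{\mathbb{S}^{n-1}}P_h(x,\xi)\phi(\xi)\,d\sigma(\xi)$. Green integral: for $x,y\in\mathbb{B}^n$ let $[x,y]\ge 0$ be given by $[x,y]^2=|x-y|^2+(1-|x|^2)(1-|y|^2)$, and let $|\varphi_x(y)|=\frac{|x-y|}{[x,y]}$. The Green function is $G_h(x,y)=\frac1n\int_{|\varphi_x(y)|}^1\frac{(1-s^2)^{n-2}}{s^{n-1}}\,ds$ for $x\ne y$. For $\psi\in C(\mathbb{B}^n,\mathbb{R}^n)$ with $\int_{\mathbb{B}^n}(1-|x|^2)^{n-1}|\psi(x)|\,d\tau(x)<\infty$, $G_h[\psi](x)=\int_{\mathbb{B}^n}G_h(x,y)\psi(y)\,d\tau(y)$. *)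

(* Defs.v *)
From HB Require Import structures.
From mathcomp Require Import all_boot all_order all_algebra.
From mathcomp Require Import all_classical all_reals all_analysis.
From mathcomp Require Import measurable_realfun.

Set Implicit Arguments.
Unset Strict Implicit.
Unset Printing Implicit Defensive.

Import Order.TTheory GRing.Theory Num.Theory.
Import numFieldNormedType.Exports.

Local Open Scope classical_set_scope.
Local Open Scope ring_scope.

Section measurable_rV.
Context {d} {T : measurableType d}.
Variable n : nat.

Definition rV_coord (i : 'I_n) (x : 'rV[T]_n) : T := x ord0 i.

Let rV_set0 : g_sigma_preimage rV_coord set0.
Proof. exact: sigma_algebra0. Qed.

Let rV_setC A : g_sigma_preimage rV_coord A -> g_sigma_preimage rV_coord (~` A).
Proof. exact: sigma_algebraC. Qed.

Let rV_bigcup (F : (set 'rV[T]_n)^nat) :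
  (forall i, g_sigma_preimage rV_coord (F i)) ->
  g_sigma_preimage rV_coord (\bigcup_i (F i)).
Proof. exact: sigma_algebra_bigcup. Qed.

HB.instance Definition _ := @isMeasurable.Build (measure_tuple_display d)
  'rV[T]_n (g_sigma_preimage rV_coord) rV_set0 rV_setC rV_bigcup.

End measurable_rV.

Lemma measurable_rV_coord d (T : measurableType d) n (i : 'I_n) :
  measurable_fun [set: 'rV[T]_n] (fun x : 'rV[T]_n => x ord0 i).
Proof.
move=> _ Y mY; rewrite setTI; apply: sub_sigma_algebra => /=.
rewrite -bigcup_seq/=; exists i => /=; first by rewrite mem_index_enum.
by exists Y => //; rewrite setTI.
Qed.

Lemma measurable_fun_rVP d1 d2 (T1 : measurableType d1) (T2 : measurableType d2)
    n (f : T1 -> 'rV[T2]_n) :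
  measurable_fun [set: T1] f <->
  forall i, measurable_fun [set: T1] (fun x => f x ord0 i).
Proof.
split=> [mf i|mf].
  exact: (measurableT_comp (measurable_rV_coord i) mf).
move=> _ A mA.
suff: g_sigma_preimage (@rV_coord _ T2 n) `<=`
    [set B | measurable ([set: T1] `&` f @^-1` B)] by apply.
apply: smallest_sub.
  split=> /=.
  - by rewrite preimage_set0 setI0.
  - by move=> B; rewrite !setTI setTD preimage_setC; exact: measurableC.
  - move=> F mF; rewrite preimage_bigcup setI_bigcupr.
    by apply: bigcupT_measurable => k; exact: mF.
move=> B; rewrite -bigcup_seq => -[i _ [C mC <-]] /=.
by rewrite setTI; exact: mf.
Qed.

(* [pushforward m f] is a measure only for measurable [f]; keeping the proof as
   an argument lets the measure structure be inferred. *)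
Definition image_measure d1 d2 (T1 : measurableType d1) (T2 : measurableType d2)
    (R : realFieldType) (m : {measure set T1 -> \bar R}) (f : T1 -> T2)
    (mf : measurable_fun [set: T1] f) : set T2 -> \bar R :=
  pushforward m f.

Section image_measure.
Context d1 d2 (T1 : measurableType d1) (T2 : measurableType d2)
  (R : realFieldType).
Variables (m : {measure set T1 -> \bar R}) (f : T1 -> T2).
Hypothesis mf : measurable_fun [set: T1] f.

Let image_measure0 : image_measure m mf set0 = 0%E.
Proof. exact: measure0. Qed.

Let image_measure_ge0 A : (0 <= image_measure m mf A)%E.
Proof. exact: measure_ge0. Qed.

Let image_measure_sigma_additive : semi_sigma_additive (image_measure m mf).
Proof. exact: measure_semi_sigma_additive. Qed.

HB.instance Definition _ := isMeasure.Build _ _ _ (image_measure m mf)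
  image_measure0 image_measure_ge0 image_measure_sigma_additive.

End image_measure.

Section lebesgue_rV.
Context {R : realType}.

Definition rV_cons n (p : R * 'rV[R]_n) : 'rV[R]_n.+1 :=
  row_mx (p.1)%:M p.2 : 'rV_(1 + n).

Definition rV_uncons n (x : 'rV[R]_n.+1) : R * 'rV[R]_n :=
  (x ord0 ord0, \row_j x ord0 (lift ord0 j)).

Lemma rV_cons0 n (p : R * 'rV[R]_n) : rV_cons p ord0 ord0 = p.1.
Proof.
rewrite /rV_cons (_ : ord0 = lshift n (ord0 : 'I_1)); last exact: val_inj.
by rewrite [LHS]row_mxEl mxE eqxx.
Qed.

Lemma rV_consS n (p : R * 'rV[R]_n) j :
  rV_cons p ord0 (lift ord0 j) = p.2 ord0 j.
Proof.
rewrite /rV_cons (_ : lift ord0 j = rshift 1 j); last exact: val_inj.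
by rewrite [LHS]row_mxEr.
Qed.

Lemma rV_consK n : cancel (@rV_cons n) (@rV_uncons n).
Proof.
move=> [a v]; rewrite /rV_uncons rV_cons0; congr pair.
by apply/rowP => j; rewrite mxE rV_consS.
Qed.

Lemma measurable_rV_cons n : measurable_fun setT (@rV_cons n).
Proof.
apply/measurable_fun_rVP => i.
have [->|[j ->]] : i = ord0 \/ exists j, i = lift ord0 j.
  by case: (unliftP ord0 i) => [j ->|->]; [right; exists j|left].
  rewrite (_ : (fun _ => _) = fst); first exact: measurable_fst.
  by apply/funext => p; rewrite rV_cons0.
rewrite (_ : (fun _ => _) = (fun v : 'rV[R]_n => v ord0 j) \o snd).
  by apply: measurableT_comp => //; exact: measurable_rV_coord.
by apply/funext => p; rewrite rV_consS.
Qed.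

Lemma measurable_rV_uncons n : measurable_fun setT (@rV_uncons n).
Proof.
apply/measurable_fun_pairP; split => /=.
  exact: measurable_rV_coord.
apply/measurable_fun_rVP => i.
rewrite [X in measurable_fun _ X](_ : _ = fun x : 'rV[R]_n.+1 =>
  x ord0 (lift ord0 i)); last by apply/funext => x; rewrite /= mxE.
exact: measurable_rV_coord.
Qed.

Section step.
Variables (n : nat) (mu : {sigma_finite_measure set 'rV[R]_n -> \bar R}).

Definition lebesgue_cons : set 'rV[R]_n.+1 -> \bar R :=
  image_measure (@lebesgue_measure R \x mu)%E (@measurable_rV_cons n).

HB.instance Definition _ := Measure.on lebesgue_cons.

Let lebesgue_cons_sigma_finite : sigma_finite setT lebesgue_cons.
Proof.
have /sigma_finiteP[F [TF ndF Foo]] := sigma_finiteT (@lebesgue_measure R).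
have /sigma_finiteP[G [TG ndG Goo]] := sigma_finiteT mu.
exists (fun k => @rV_uncons n @^-1` (F k `*` G k)).
  rewrite -preimage_bigcup [X in _ @^-1` X](_ : _ = setT) ?preimage_setT//.
  rewrite -setXTT TF TG predeqE => -[x y]; split.
    by move=> [k _ []/= ? ?]; split; exists k.
  move=> [/= [k _ Fkx] [l _ Gly]]; exists (maxn k l) => //; split.
  - by move: x Fkx; exact/subsetPset/ndF/leq_maxl.
  - by move: y Gly; exact/subsetPset/ndG/leq_maxr.
move=> k; have [mFk Fkoo] := Foo k; have [mGk Gkoo] := Goo k; split.
  rewrite -[X in measurable X]setTI; apply: measurable_rV_uncons => //.
  exact: measurableX.
rewrite /lebesgue_cons /image_measure /pushforward -comp_preimage.
rewrite (_ : _ \o _ = id); last by apply/funext => p /=; rewrite rV_consK.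
rewrite preimage_id.
have := product_measure1E (@lebesgue_measure R) mu mFk mGk.
move=> /(eq_ind_r (fun z => (z < +oo)%E)); apply.
by rewrite lte_mul_pinfty// ge0_fin_numE.
Qed.

HB.instance Definition _ := Measure_isSigmaFinite.Build _ _ _ lebesgue_cons
  lebesgue_cons_sigma_finite.

End step.

Fixpoint lebesgue_rV n : {sigma_finite_measure set 'rV[R]_n -> \bar R} :=
  match n with
  | 0 => \d_(0 : 'rV[R]_0)
  | m.+1 => lebesgue_cons (lebesgue_rV m)
  end.

End lebesgue_rV.

Lemma lebesgue_rVS (R : realType) n (A : set R) (B : set 'rV[R]_n) :
  measurable A -> measurable B ->
  lebesgue_rV n.+1 [set x | A (rV_uncons x).1 /\ B (rV_uncons x).2] =
  (lebesgue_measure A * lebesgue_rV n B)%E.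
Proof.
move=> mA mB; rewrite /= /lebesgue_cons /image_measure /pushforward.
rewrite (_ : _ @^-1` _ = A `*` B).
  exact: (product_measure1E (@lebesgue_measure R) (lebesgue_rV n)).
apply/funext => p; apply/propext.
change (A (rV_uncons (rV_cons p)).1 /\ B (rV_uncons (rV_cons p)).2 <->
  A p.1 /\ B p.2).
by rewrite rV_consK.
Qed.

Lemma measurable_box (R : realType) n (A : 'I_n -> set R) :
  (forall i, measurable (A i)) ->
  measurable [set x : 'rV[R]_n | forall i, A i (x ord0 i)].
Proof.
move=> mA; rewrite (_ : mkset _ = \big[setI/setT]_(i < n)
    ((fun x : 'rV[R]_n => x ord0 i) @^-1` A i)).
  apply: bigsetI_measurable => i _; rewrite -[X in measurable X]setTI.
  exact: measurable_rV_coord.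
by rewrite -bigcap_seq; apply/seteqP; split=> x /= + i => /(_ i)//; apply;
  rewrite /= mem_index_enum.
Qed.

Lemma lebesgue_rV_box (R : realType) n (A : 'I_n -> set R) :
  (forall i, measurable (A i)) ->
  lebesgue_rV n [set x : 'rV[R]_n | forall i, A i (x ord0 i)] =
  (\prod_(i < n) lebesgue_measure (A i))%E.
Proof.
elim: n A => [|n IH] A mA.
  by rewrite big_ord0 /= diracE mem_set// => -[].
rewrite big_ord_recl -IH// -(@lebesgue_rVS _ n)//; last first.
  by apply: (@measurable_box _ n (fun i => A (lift ord0 i))).
apply: (congr1 (fun B : set 'rV[R]_n.+1 => lebesgue_rV n.+1 B)).
apply/seteqP; split=> x /=.
  by move=> Ax; split=> // i; rewrite mxE.
move=> [A0 AS] i; case: (unliftP ord0 i) => [j ->|->] //.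
by have := AS j; rewrite mxE.
Qed.

Section euclidean.
Context {R : realType} {n : nat}.
Implicit Types x y : 'rV[R]_n.

(* The library norm [`|x|] on ['rV[R]_n] is the sup norm. *)
Definition enorm x : R := Num.sqrt (\sum_(i < n) x ord0 i ^+ 2).

Definition eball : set 'rV[R]_n := [set x | enorm x < 1].

Definition esphere : set 'rV[R]_n := [set x | enorm x = 1].

Lemma measurable_enorm : measurable_fun setT enorm.
Proof.
apply: (@measurableT_comp _ _ _ _ _ _ (@Num.sqrt R)).
  by apply: continuous_measurable_fun; exact: sqrt_continuous.
apply: measurable_sum => i; apply: measurable_funX.
exact: measurable_rV_coord.
Qed.

Lemma measurable_eball : measurable eball.
Proof.
rewrite (_ : eball = setT `&` enorm @^-1` `]-oo, 1[%classic).
  exact: measurable_enorm.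
by rewrite setTI; apply/seteqP; split=> x /=; rewrite in_itv.
Qed.

Lemma measurable_esphere : measurable esphere.
Proof.
rewrite (_ : esphere = setT `&` enorm @^-1` [set 1]).
  exact: measurable_enorm.
by rewrite setTI.
Qed.

Definition radial_proj x : 'rV[R]_n := (enorm x)^-1 *: x.

Lemma measurable_radial_proj : measurable_fun setT radial_proj.
Proof.
apply/measurable_fun_rVP => i.
rewrite [X in measurable_fun _ X](_ : _ = (fun x => (enorm x)^-1 * x ord0 i));
  last by apply/funext => x; rewrite mxE.
apply: measurable_funM; last exact: measurable_rV_coord.
apply: (@measurableT_comp _ _ _ _ _ _ (@GRing.inv R)); last first.
  exact: measurable_enorm.
rewrite -(setUv [set (0 : R)]); apply/measurable_funU => //.
  exact: measurableC.
split; first exact: measurable_fun_set1.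
apply: subspace_continuous_measurable_fun; first exact: measurableC.
apply: continuous_in_subspaceT => x; rewrite inE => /eqP x0.
exact: inv_continuous.
Qed.

Let ball_factor_ge0 : 0 <= (fine (lebesgue_rV n eball))^-1.
Proof. by rewrite invr_ge0 fine_ge0. Qed.

Definition ball_measure : set 'rV[R]_n -> \bar R :=
  mscale (NngNum ball_factor_ge0) (lebesgue_rV n).

HB.instance Definition _ := Measure.on ball_measure.

(* [sphere_measure A] is the normalized volume of the cone
   [{x in B^n | x / |x| in A}] over [A]; on subsets of the sphere this is the
   surface measure of polar coordinates, of total mass 1. *)
Definition sphere_measure : set 'rV[R]_n -> \bar R :=
  image_measure (mrestr ball_measure measurable_eball) measurable_radial_proj.

HB.instance Definition _ := Measure.on sphere_measure.

End euclidean.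

Section normalization.
Context {R : realType}.

Lemma enorm0 n : enorm (0 : 'rV[R]_n) = 0.
Proof.
by rewrite /enorm big1 ?sqrtr0// => i _; rewrite mxE expr0n.
Qed.

Lemma enorm_ge0 n (x : 'rV[R]_n) : 0 <= enorm x.
Proof. exact: sqrtr_ge0. Qed.

Lemma enormZ n (a : R) (x : 'rV[R]_n) : enorm (a *: x) = `|a| * enorm x.
Proof.
rewrite /enorm -sqrtr_sqr -sqrtrM ?sqr_ge0// mulr_sumr; congr Num.sqrt.
by apply: eq_bigr => i _; rewrite mxE exprMn.
Qed.

Lemma enorm_coord n (x : 'rV[R]_n) i : `|x ord0 i| <= enorm x.
Proof.
rewrite -sqrtr_sqr ler_wsqrtr// (bigD1 i)//= lerDl.
by apply: sumr_ge0 => j _; exact: sqr_ge0.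
Qed.

Lemma enorm_eq0 n (x : 'rV[R]_n) : (enorm x == 0) = (x == 0).
Proof.
apply/eqP/eqP => [x0|->]; last exact: enorm0.
apply/rowP => i; rewrite mxE; apply/eqP; rewrite -normr_le0 -x0.
exact: enorm_coord.
Qed.

Lemma lebesgue_eball_lty n : (lebesgue_rV n (@eball R n) < +oo)%E.
Proof.
pose I : set R := `[-1, 1]%classic.
have mI : measurable I by exact: measurable_itv.
apply: (@le_lt_trans _ _
  (lebesgue_rV n [set x : 'rV[R]_n | forall i, I (x ord0 i)])).
  apply: le_measure; rewrite ?inE; first exact: measurable_eball.
    by apply: (@measurable_box R n (fun=> I)).
  move=> x /= x1 i; rewrite /I /= in_itv /= -ler_norml.
  exact: le_trans (enorm_coord x i) (ltW x1).
rewrite (@lebesgue_rV_box _ n (fun=> I))//.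
suff : (\prod_(i < n) lebesgue_measure I)%E \is a fin_num.
  by move=> ?; rewrite ltey_eq; apply/orP; left.
apply: (big_ind (fun z : \bar R => z \is a fin_num)) => // [x y|i _].
  exact: fin_numM.
by rewrite /I lebesgue_measure_itv/=; case: ifP.
Qed.

Lemma lebesgue_eball_gt0 n : (0 < lebesgue_rV n (@eball R n))%E.
Proof.
pose e : R := n.+1%:R^-1; have e0 : 0 < e by rewrite invr_gt0.
pose I : set R := `]-e, e[%classic.
have mI : measurable I by exact: measurable_itv.
apply: (@lt_le_trans _ _
  (lebesgue_rV n [set x : 'rV[R]_n | forall i, I (x ord0 i)])).
  rewrite (@lebesgue_rV_box _ n (fun=> I))//.
  apply: (big_ind (fun z : \bar R => (0 < z)%E)) => // [x y|i _].
    exact: mule_gt0.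
  rewrite /I lebesgue_measure_itv/= lte_fin gtrN// -EFinD lte_fin.
  by rewrite opprK addr_gt0.
apply: le_measure; rewrite ?inE; last 1 first.
- move=> x /= xe; rewrite /eball /= -sqrtr1 ltr_sqrt//.
  apply: (@le_lt_trans _ _ (\sum_(i < n) e ^+ 2)).
    apply: ler_sum => i _; rewrite -real_normK ?num_real//.
    rewrite lerXn2r ?nnegrE//; first exact: ltW.
    by have := xe i; rewrite /I /= in_itv /= -ltr_norml => /ltW.
  rewrite sumr_const card_ord -mulr_natl expr2 mulrA.
  rewrite /e -[ltRHS](@mulfV _ n.+1%:R)// ltr_pM2r ?invr_gt0//.
  rewrite ltr_pdivrMr// -natrM ltr_nat.
  by rewrite (leq_trans (ltnSn n))// leq_pmulr.
- by apply: (@measurable_box R n (fun=> I)).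
- exact: measurable_eball.
Qed.

Lemma ball_measure_eball n : ball_measure (@eball R n) = 1%E.
Proof.
have l0 := lebesgue_eball_gt0 n; have loo := lebesgue_eball_lty n.
rewrite /ball_measure /mscale /=.
have lfin : lebesgue_rV n (@eball R n) \is a fin_num by rewrite gt0_fin_numE.
rewrite -[X in (_ * X)%E](fineK lfin) -EFinM mulVf//.
by rewrite gt_eqF// fine_gt0// l0.
Qed.

Lemma set1_rV n : [set 0 : 'rV[R]_n] =
  [set x : 'rV[R]_n | forall i, [set (0 : R)] (x ord0 i)].
Proof.
apply/seteqP; split=> [x /= -> i|x /= x0]; first by rewrite mxE.
by apply/rowP => i; rewrite x0 mxE.
Qed.

Lemma ball_measure0 n : (0 < n)%N -> ball_measure [set 0 : 'rV[R]_n] = 0%E.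
Proof.
case: n => // n _.
suff E : lebesgue_rV n.+1 [set 0 : 'rV[R]_n.+1] = 0%E.
  exact: (etrans (congr1 (fun z => _ * z)%E E) (mule0 _)).
rewrite set1_rV (@lebesgue_rV_box _ n.+1 (fun=> [set (0 : R)]))//.
by rewrite big_ord_recl lebesgue_measure_set1 mul0e.
Qed.

Lemma sphere_measure_esphere n : (0 < n)%N ->
  sphere_measure (@esphere R n) = 1%E.
Proof.
move=> n0.
have m0 : measurable [set 0 : 'rV[R]_n].
  by rewrite set1_rV; apply: (@measurable_box R n (fun=> [set (0 : R)])).
transitivity (ball_measure ((@eball R n) `\` [set 0])).
  apply: (congr1 (@ball_measure R n)).
  apply/seteqP; split=> x /=; rewrite /esphere /radial_proj /=.
    move=> [p1 x1]; split=> // x0; move: p1.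
    by rewrite x0 scaler0 enorm0 => /eqP; rewrite eq_sym oner_eq0.
  move=> [x1 /eqP x0]; split=> //.
  rewrite enormZ ger0_norm ?invr_ge0 ?enorm_ge0// mulVf//.
  by rewrite enorm_eq0.
have mD : measurable ((@eball R n) `\` [set 0]).
  by apply: measurableD => //; exact: measurable_eball.
rewrite -(ball_measure_eball n); apply/eqP; rewrite eq_le; apply/andP; split.
  apply: le_measure; last exact: subDsetl.
  - by rewrite inE.
  - by rewrite inE; exact: measurable_eball.
rewrite -[leRHS]adde0 -(ball_measure0 n0).
apply: le_trans (measureU2 _ mD m0); apply: le_measure.
- by rewrite inE; exact: measurable_eball.
- by rewrite inE; exact: measurableU.
- by move=> x x1; have [->|/eqP x0] := eqVneq x 0; [right|left].
Qed.

End normalization.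

Section hyperbolic_potentials.
Context {R : realType} {n : nat}.
Implicit Types (x y xi : 'rV[R]_n) (phi psi : 'rV[R]_n -> 'rV[R]_n).

Definition poisson_kernel x xi : R :=
  ((1 - enorm x ^+ 2) / enorm (xi - x) ^+ 2) ^+ (n - 1).

(* Only the values of [phi] on the sphere matter. *)
Definition poisson_integral phi x : 'rV[R]_n :=
  \row_i \int[@sphere_measure R n]_(xi in esphere)
    (poisson_kernel x xi * phi xi ord0 i).

Definition bracket x y : R :=
  Num.sqrt (enorm (x - y) ^+ 2 + (1 - enorm x ^+ 2) * (1 - enorm y ^+ 2)).

Definition mobius_abs x y : R := enorm (x - y) / bracket x y.

(* For [x = y] the integral diverges and this function returns the junk value
   0, but [{x}] is a null set in [green_integral]. *)
Definition green_kernel x y : R :=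
  n%:R^-1 * \int[@lebesgue_measure R]_(s in `[mobius_abs x y, 1])
    ((1 - s ^+ 2) ^+ (n - 2) / s ^+ (n - 1)).

(* The density of [tau] with respect to [ball_measure], on the unit ball. *)
Definition tau_density x : R := (1 - enorm x ^+ 2) ^- n.

Definition green_integrable psi : Prop :=
  (\int[@ball_measure R n]_(x in eball)
     ((1 - enorm x ^+ 2) ^+ (n - 1) * enorm (psi x) * tau_density x)%:E
   < +oo)%E.

Definition green_integral psi x : 'rV[R]_n :=
  \row_i \int[@ball_measure R n]_(y in eball)
    (green_kernel x y * psi y ord0 i * tau_density y).

End hyperbolic_potentials.

(* [f] is of class C^k on the open set [A]: all partial derivatives up to order
   [k] exist and are continuous on [A]. *)
Fixpoint Ck_on (R : realType) (n m k : nat) (A : set 'rV[R]_n)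
    (f : 'rV[R]_n -> 'rV[R]_m) : Prop :=
  {within A, continuous f} /\
  match k with
  | 0 => True
  | k'.+1 => forall i : 'I_n,
      (forall x, A x -> derivable f x (delta_mx 0 i)) /\
      Ck_on k' A ('D_(delta_mx 0 i) f)
  end.

(* Main.v *)
Require Import Defs.
From HB Require Import structures.
From mathcomp Require Import all_boot all_order all_algebra.
From mathcomp Require Import all_classical all_reals all_analysis.
From mathcomp Require Import measurable_realfun.
From mathcomp Require Import ring lra zify.

(** The ball is convex, so it is enough to compare [u] at [x] and at points [z] with
[|x - z|] small compared with [d = 1 - |x|]: such a bound propagates along segments
([local_to_global_lipschitz]). For these pairs each of the two potentials is estimated
separately, with constants depending only on [n], [L] and [M].

Green potential. The kernel is a function of the pseudo-hyperbolic distance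
[rho = mobius_abs x y], and [rho] changes by at most a multiple of
[|x - z| (1 - rho^2) / (1 - |x|^2)] ([mobius_abs_dist_le]). Together with
[|psi| <= M (1 - |y|^2)] this bounds the change of the integrand by [|x - z|] times a
function of order [d^-1 |x - y|^(1 - n)] when [|x - y| <= d] and
[d^(n - 2) |x - y|^(2 - 2 n)] otherwise. Since balls of radius [s] have volume of order
[s^n], its integral is bounded independently of [x] ([integral_green_majorant_le]);
the far part converges because [n >= 3].

Poisson integral. The kernel changes by at most a multiple of
[|x - z| d^(n - 2) |xi - x|^(2 - 2 n)], whose integral is of order [|x - z| / d]. The loss
is recovered by cancellation: the mean of the kernel over the sphere does not depend on
[x] ([poisson_kernel_mean]), so the boundary values can be normalized to vanish at the
boundary point nearest to [x]. The Lipschitz condition then gives one more factor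
[|xi - x|], and spherical caps of radius [s] have measure of order [s^(n - 1)]
([sphere_cap_le]), which leaves a bounded integral ([poisson_integral_dist_le]).

Constancy of the mean. For [x = r e] with [e] a unit vector, the derivative of the kernel
in [r] is [- 2 / (1 - r^2)] times the spherical divergence of the kernel times the gradient
of [xi |-> e . xi]. Such a divergence has integral zero over the sphere
([integral_sphere_zonal_div]). As the surface measure is the volume of cones, this is
deduced from the divergence theorem in the ball for the fields
[(1 - |y|^(2 m + 2)) q(t) (|y| e - t y)], where [t = e . y / |y|]: they vanish on the unit
sphere, so each partial derivative integrates to zero along every chord parallel to an
axis, and [m] tends to infinity. *)

Import Order.TTheory GRing.Theory Num.Theory.
Import numFieldNormedType.Exports.

Local Open Scope classical_set_scope.
Local Open Scope ring_scope.

Set Implicit Arguments.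
Unset Strict Implicit.

(** * Euclidean geometry of row vectors *)

Section euclidean_space.
Context {R : realType} {n : nat}.
Implicit Types (x y z : 'rV[R]_n) (r : R).

Definition edot x y : R := \sum_(i < n) x ord0 i * y ord0 i.

Lemma edotC x y : edot x y = edot y x.
Proof. by apply: eq_bigr => i _; rewrite mulrC. Qed.

Lemma edotBl x y z : edot (x - y) z = edot x z - edot y z.
Proof.
by rewrite /edot -sumrB; apply: eq_bigr => i _; rewrite !mxE mulrBl.
Qed.

Lemma edotBr x y z : edot z (x - y) = edot z x - edot z y.
Proof. by rewrite edotC edotBl !(edotC z). Qed.

Lemma edotZl r x y : edot (r *: x) y = r * edot x y.
Proof. by rewrite /edot mulr_sumr; apply: eq_bigr => i _; rewrite mxE mulrA. Qed.

Lemma edotZr r x y : edot x (r *: y) = r * edot x y.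
Proof. by rewrite edotC edotZl edotC. Qed.

Lemma enorm_sqr x : enorm x ^+ 2 = edot x x.
Proof.
rewrite sqr_sqrtr; last by apply: sumr_ge0 => i _; exact: sqr_ge0.
by apply: eq_bigr => i _; rewrite expr2.
Qed.

Lemma enormN x : enorm (- x) = enorm x.
Proof. by rewrite -scaleN1r enormZ normrN1 mul1r. Qed.

Lemma enorm_distC x y : enorm (x - y) = enorm (y - x).
Proof. by rewrite -opprB enormN. Qed.

Lemma enormB_sqr x y :
  enorm (x - y) ^+ 2 = enorm x ^+ 2 - 2 * edot x y + enorm y ^+ 2.
Proof.
by rewrite !enorm_sqr edotBl !edotBr (edotC y x); ring.
Qed.

Lemma enorm_gt0 x : (0 < enorm x) = (x != 0).
Proof. by rewrite lt_neqAle enorm_ge0 eq_sym enorm_eq0 andbT. Qed.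

Lemma edot_le x y : edot x y <= enorm x * enorm y.
Proof.
have [->|x0] := eqVneq x 0.
  by rewrite enorm0 mul0r /edot big1 // => i _; rewrite mxE mul0r.
have [->|y0] := eqVneq y 0.
  by rewrite enorm0 mulr0 /edot big1 // => i _; rewrite mxE mulr0.
have := sqr_ge0 (enorm (enorm y *: x - enorm x *: y)).
rewrite enormB_sqr !enormZ edotZl edotZr !ger0_norm ?enorm_ge0//.
move: x0 y0; rewrite -!enorm_gt0 => x0 y0.
have xy := mulr_gt0 x0 y0.
move=> H; rewrite -(ler_pM2l xy).
move: H; move: (enorm x) (enorm y) (edot x y) => a b c; lra.
Qed.

Lemma edot_norm_le x y : `|edot x y| <= enorm x * enorm y.
Proof.
rewrite ler_norml edot_le andbT lerNl -mulN1r -edotZl.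
by apply: le_trans (edot_le _ _) _; rewrite scaleN1r enormN.
Qed.

Lemma enormD_le x y : enorm (x + y) <= enorm x + enorm y.
Proof.
rewrite -(ler_pXn2r (_ : 0 < 2)%N) ?nnegrE ?addr_ge0 ?enorm_ge0 //.
rewrite -{1}[y]opprK enormB_sqr enormN.
have := edot_norm_le x (- y); rewrite enormN ler_norml => /andP[+ _].
move: (enorm x) (enorm y) (edot x _) => a b c; lra.
Qed.

Lemma enorm_dist_triangle z x y :
  enorm (x - y) <= enorm (x - z) + enorm (z - y).
Proof. by rewrite -{1}(subrK z x) -addrA enormD_le. Qed.

Lemma enormB_ge x y : enorm x - enorm y <= enorm (x - y).
Proof. by rewrite lerBlDr -{1}(subrK y x) enormD_le. Qed.

Lemma enorm_dist_norm x y : `|enorm x - enorm y| <= enorm (x - y).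
Proof.
by rewrite ler_norml enormB_ge andbT lerNl opprB enorm_distC enormB_ge.
Qed.

Lemma enorm_le_sum x : enorm x <= \sum_(i < n) `|x ord0 i|.
Proof.
have s0 : 0 <= \sum_(i < n) `|x ord0 i| by apply: sumr_ge0.
rewrite -(ler_pXn2r (_ : 0 < 2)%N) ?nnegrE ?enorm_ge0 // enorm_sqr.
rewrite expr2 mulr_suml; apply: ler_sum => i _.
rewrite -expr2 -real_normK ?num_real// expr2 ler_wpM2l//.
by rewrite (bigD1 i)//= lerDl; apply: sumr_ge0.
Qed.

Lemma enorm_continuous : continuous (@enorm R n).
Proof.
move=> x; apply: (@continuous_comp _ _ _ (fun x : 'rV[R]_n =>
  \sum_(i < n) x ord0 i ^+ 2) Num.sqrt); last exact: sqrt_continuous.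
move: x; apply: continuous_big => [|i _ x]; first exact: add_continuous.
apply: (@continuous_comp _ _ _ (fun x : 'rV[R]_n => x ord0 i)
  (fun t : R => t ^+ 2)); first exact: coord_continuous.
exact: exprn_continuous.
Qed.

End euclidean_space.

(** * Measurability on the space of row vectors *)

Lemma measurable_invr (R : realType) : measurable_fun setT (@GRing.inv R).
Proof.
rewrite -(setUv [set (0 : R)]); apply/measurable_funU => //.
  exact: measurableC.
split; first exact: measurable_fun_set1.
apply: subspace_continuous_measurable_fun; first exact: measurableC.
apply: continuous_in_subspaceT => x; rewrite inE => /eqP x0.
exact: inv_continuous.
Qed.

Lemma measurable_funVr d (T : measurableType d) (R : realType) (D : set T)
    (f : T -> R) :
  measurable_fun D f -> measurable_fun D (fun x => (f x)^-1).
Proof. by move=> mf; apply: measurableT_comp mf; exact: measurable_invr. Qed.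

Section borel_rV.
Context {R : realType} {n : nat}.

Let box (p : 'rV[rat]_n * nat) : set 'rV[R]_n :=
  [set y | forall i, `](ratr (p.1 ord0 i) - p.2.+1%:R^-1),
                       (ratr (p.1 ord0 i) + p.2.+1%:R^-1)[%classic (y ord0 i)].

(** The sigma-algebra on row vectors is generated by the coordinates, so an open
set has to be written as a countable union of boxes with rational centres and
radii [1 / k.+1]. *)
Lemma open_measurable_rV (U : set 'rV[R]_n) : open U -> measurable U.
Proof.
move=> oU.
have -> : U = \bigcup_m (if unpickle m is Some p then
    (if `[< box p `<=` U >] then box p else set0) else set0).
  apply/seteqP; split=> [x Ux|x [m _]]; last first.
    by case: unpickle => // p; case: asboolP => // /[apply].
  have /nbhs_ballP[e /= e0 eU] : nbhs x U by exact: open_nbhs_nbhs.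
  have e20 : 0 < e / 2 by rewrite divr_gt0.
  have [k ke] : exists k, k.+1%:R^-1 < e / 2.
    have [k _ /(_ k (leqnn k))] := near_infty_natSinv_lt (PosNum e20).
    by exists k.
  move: ke => /= ke.
  have k0 : 0 < k.+1%:R^-1 :> R by rewrite invr_gt0.
  have /choice[q qP] : forall i : 'I_n, exists q : rat,
      ratr q \in `](x ord0 i - k.+1%:R^-1), (x ord0 i + k.+1%:R^-1)[.
    move=> i.
    have : x ord0 i - k.+1%:R^-1 < x ord0 i + k.+1%:R^-1 by rewrite ltrD2l gtrN.
    by move=> /rat_in_itvoo[q ?]; exists q.
  exists (pickle (\row_i q i, k)) => //; rewrite pickleK.
  have -> : `[< box (\row_i q i, k) `<=` U >] = true.
    apply/asboolP => y by_; apply: eU; split=> // i j.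
    rewrite (ord1 i); have := by_ j; have := qP j; rewrite !mxE /= !in_itv/=.
    move=> /andP[q1 q2] /andP[y1 y2]; rewrite /ball/= ltr_norml.
    move: (ratr _) k.+1%:R^-1 q1 q2 y1 y2 ke => *.
    by apply/andP; split; lra.
  move=> i; have := qP i; rewrite !mxE /= !in_itv/= => /andP[q1 q2].
  move: (ratr _) k.+1%:R^-1 q1 q2 => *.
  by apply/andP; split; lra.
apply: bigcupT_measurable => m; case: unpickle => // p; case: ifP => // _.
apply: (@measurable_box R n (fun i => `](ratr (p.1 ord0 i) - p.2.+1%:R^-1),
  (ratr (p.1 ord0 i) + p.2.+1%:R^-1)[%classic)) => i; exact: measurable_itv.
Qed.

Lemma within_continuous_measurable_rV (D : set 'rV[R]_n) (f : 'rV[R]_n -> R) :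
  measurable D -> {within D, continuous f} -> measurable_fun D f.
Proof.
move=> mD /continuousP cf; apply: (measurability _ (measurable_realfun.RGenOpens.measurableE R)).
move=> _ [_ [a [b ->] <-]].
have : open (f @^-1` `]a, b[%classic : set (subspace D)).
  exact/cf/interval_open.
move=> /open_subspaceP[V oV VD].
by rewrite setIC -VD; apply: measurableI => //;
  exact: open_measurable_rV.
Qed.

End borel_rV.

(** * From local to global Lipschitz bounds *)

(** A pointwise Lipschitz bound propagates along [[0, 1]]: the supremum of the [s]
with [f s - f 0 <= K * s] belongs to this set and cannot be smaller than 1. *)
Lemma local_to_global_lipschitz (R : realType) (f : R -> R) (K : R) :
  (forall s, 0 <= s <= 1 -> exists2 e, 0 < e & forall t, 0 <= t <= 1 ->
     `|t - s| <= e -> `|f t - f s| <= K * `|t - s|) ->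
  f 1 - f 0 <= K.
Proof.
move=> loc.
pose A : set R := [set s | 0 <= s <= 1 /\ f s - f 0 <= K * s].
have A0 : A 0 by split; rewrite ?lexx ?ler01// subrr mulr0.
have ubA : ubound A 1 by move=> s [/andP[]].
have supA : has_sup A by split; [exists 0|exists 1].
set s := sup A.
have s0 : 0 <= s by exact: sup_upper_bound supA _ A0.
have s1 : s <= 1 by apply: ge_sup => //; exists 0.
have s01 : 0 <= s <= 1 by rewrite s0.
have [e e0 He] := loc s s01.
have As : A s.
  have [t At te] := sup_adherent e0 supA.
  have ts : t <= s by exact: sup_upper_bound supA _ At.
  have [t01 ft] := At.
  have tse : `|t - s| <= e.
    by rewrite distrC ger0_norm ?subr_ge0//; move: te; rewrite -/s; lra.
  have := He t t01 tse; rewrite ler_norml => /andP[+ _].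
  rewrite (distrC t s) (ger0_norm (_ : 0 <= s - t)) ?subr_ge0// => H.
  by split => //; lra.
have [s1'|s1'] := ltrP s 1; last first.
  have E : s = 1 by apply/eqP; rewrite eq_le s1.
  by move: As; rewrite E => -[_]; rewrite mulr1.
(* if [s < 1], the bound still holds slightly to the right of [s] *)
pose t := Num.min 1 (s + e).
have st : s < t by rewrite lt_min s1' ltrDl e0.
have st0 : 0 <= t - s by rewrite subr_ge0 ltW.
have t01 : 0 <= t <= 1 by rewrite ge_min lexx (le_trans s0 (ltW st)).
have tse : `|t - s| <= e.
  by rewrite (ger0_norm st0) lerBlDl ge_min lexx orbT.
have := He t t01 tse; rewrite ler_norml => /andP[_].
rewrite (ger0_norm st0) => H.
have At : A t by split => //; have [_] := As; lra.
by have := sup_upper_bound supA At; rewrite leNgt -/s st.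
Qed.

(** * Integral estimates by domination and dyadic decomposition *)

Section Rintegral_bounds.
Context d (T : measurableType d) (R : realType) (mu : {measure set T -> \bar R}).

Lemma integrable_dominated (D : set T) (f g : T -> R) (c : R) :
  measurable D -> measurable_fun D f -> (forall x, D x -> `|f x| <= g x) ->
  measurable_fun D g -> (\int[mu]_(x in D) (g x)%:E <= c%:E)%E ->
  mu.-integrable D (EFin \o f).
Proof.
move=> mD mf fg mg gc; apply/integrableP; split; first exact/measurable_EFinP.
apply: (@le_lt_trans _ _ c%:E); last by rewrite ltry.
apply: le_trans gc; apply: ge0_le_integral => //.
- by apply: measurableT_comp => //; exact/measurable_EFinP.
- exact/measurable_EFinP.
Qed.

Lemma Rintegral_norm_le (D : set T) (f g : T -> R) (c : R) :
  measurable D -> measurable_fun D f -> (forall x, D x -> `|f x| <= g x) ->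
  measurable_fun D g -> (\int[mu]_(x in D) (g x)%:E <= c%:E)%E ->
  `|\int[mu]_(x in D) f x| <= c.
Proof.
move=> mD mf fg mg gc.
have fi := integrable_dominated mD mf fg mg gc.
rewrite -lee_fin; apply: le_trans gc.
rewrite EFin_normr_Rintegral//.
apply: le_trans (le_abse_integral mu mD _) _; first exact/measurable_EFinP.
apply: ge0_le_integral => //.
- by apply: measurableT_comp => //; exact/measurable_EFinP.
- exact/measurable_EFinP.
Qed.

End Rintegral_bounds.

Section dyadic.
Local Open Scope ereal_scope.
Context d (T : measurableType d) (R : realType) (mu : {measure set T -> \bar R}).
Implicit Types (D : set T) (a b : nat).

(** Bounding [f] by [c k] on [E k] replaces it by a series of weighted indicators;
the weights are such that the [k]-th piece costs a geometric share of [C]. *)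
Lemma integral_le_weighted_cover D (f : T -> R) (E : (set T)^nat)
    (c : R^nat) (C : R) : measurable D -> measurable_fun D f ->
  (forall x, D x -> 0 <= f x)%R -> (forall k, measurable (E k)) ->
  (forall k, 0 <= c k)%R ->
  (forall x, D x -> exists2 k, E k x & (f x <= c k)%R) ->
  (forall k, (c k)%:E * mu (D `&` E k) <= (C / (2 ^ k.+1)%:R)%:E) ->
  \int[mu]_(x in D) (f x)%:E <= C%:E.
Proof.
move=> mD mf f0 mE c0 fE cE.
have g0 k x : 0 <= (c k * \1_(E k) x)%:E.
  by rewrite lee_fin mulr_ge0.
have mg k : measurable_fun D (fun x => (c k * \1_(E k) x)%:E).
  by apply/measurable_EFinP; apply: measurable_funM => //; exact: measurable_indic.
apply: (@le_trans _ _
    (\int[mu]_(x in D) (\sum_(k <oo) (c k * \1_(E k) x)%:E))).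
  apply: ge0_le_integral => //.
  - exact/measurable_EFinP.
  - apply: (eq_measurable_fun
      (fun x => \sum_(k <oo | k \in xpredT) (c k * \1_(E k) x)%:E)) => //.
    exact: ge0_emeasurable_sum.
  - move=> x Dx; have [k Ek fk] := fE _ Dx.
    apply: le_trans (nneseries_lim_ge k.+1 _) => //.
    rewrite big_mkord big_ord_recr/=.
    apply: (@le_trans _ _ (c k * \1_(E k) x)%:E).
      by rewrite lee_fin indicE mem_set// mulr1.
    by rewrite leeDr//; apply: sume_ge0.
rewrite integral_nneseries//.
have C0 : 0 <= (C / 2 ^+ 0)%:E.
  have := cE 0%N; rewrite lee_fin expr0 divr1 => /(le_trans _) H.
  have /H : 0 <= (c 0%N)%:E * mu (D `&` E 0%N) by rewrite mule_ge0// lee_fin.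
  by rewrite lee_fin pmulr_lge0 ?invr_gt0 ?ltr0n.
have <- : \sum_(k <oo) (C / (2 ^ k.+1)%:R)%:E = C%:E.
  have := @cvg_geometric_eseries_half R C 0; rewrite expr0 divr1.
  under eq_fun do rewrite /eseries/=.
  move=> /cvg_lim <- //; congr (limn _); apply/funext => m.
  by apply: eq_bigr => k _; rewrite addn1.
apply: lee_nneseries => [k _ _|k _]; first by apply: integral_ge0.
under eq_integral do rewrite EFinM.
rewrite ge0_integralZl ?lee_fin//; last first.
  by apply/measurable_EFinP; exact: measurable_indic.
by rewrite integral_indic// setIC.
Qed.

Lemma dyadic_floor (t : R) : (1 <= t)%R ->
  exists k, (2 ^+ k <= t <= 2 ^+ k.+1)%R.
Proof.
move=> t1.
have [m tm] : exists m, (t < 2 ^+ m)%R.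
  exists (Num.truncn t).+1; apply: lt_le_trans (truncnS_gt _) _.
  by rewrite -natrX ler_nat ltnW// ltn_expl.
elim: m tm => [|m IH] tm; first by move: tm; rewrite expr0 ltNge t1.
have [/IH//|mt] := ltP t (2 ^+ m)%R.
by exists m; rewrite mt ltW.
Qed.

Lemma measurable_sublevel D (rho : T -> R) s : measurable D ->
  measurable_fun D rho -> measurable (D `&` [set x | (rho x <= s)%R]).
Proof.
move=> mD mrho; rewrite (_ : [set x | _] = rho @^-1` `]-oo, s]%classic).
  exact: mrho.
by apply/seteqP; split=> x /=; rewrite in_itv.
Qed.

(** If sublevel sets of [rho] have measure of order [s ^+ a], the shell where
[rho] is about [2 ^+ k * delta] contributes at most a multiple of
[(2 ^+ k * delta) ^+ a / (2 ^+ k * delta) ^+ b], which is geometric in [k]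
because [a < b]. *)
Lemma integral_far_decay D (rho : T -> R) a b (A delta : R) :
  measurable D -> measurable_fun D rho -> (0 < delta)%R -> (0 <= A)%R ->
  (a < b)%N -> (forall x, D x -> delta <= rho x)%R ->
  (forall s, (delta <= s)%R ->
     mu (D `&` [set x | (rho x <= s)%R]) <= (A * s ^+ a)%:E) ->
  \int[mu]_(x in D) (rho x ^- b)%:E <=
    (A * 2 ^+ a.+1 / delta ^+ (b - a))%:E.
Proof.
move=> mD mrho d0 A0 ab rhod muA.
have rho0 x : D x -> (0 < rho x)%R by move=> /rhod; exact: lt_le_trans.
have d2 k : (0 < delta * 2 ^+ k)%R by rewrite mulr_gt0// exprn_gt0.
apply: (@integral_le_weighted_cover _ _
    (fun k => D `&` [set x | rho x <= delta * 2 ^+ k.+1]%R)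
    (fun k => (delta * 2 ^+ k) ^- b)%R) => //.
- exact/measurable_funVr/measurable_funX.
- by move=> x Dx; rewrite invr_ge0 exprn_ge0// ltW// rho0.
- by move=> k; exact: measurable_sublevel.
- by move=> k; rewrite invr_ge0 exprn_ge0// ltW.
- move=> x Dx.
  have [k /andP[k1 k2]] : exists k, (2 ^+ k <= rho x / delta <= 2 ^+ k.+1)%R.
    by apply: dyadic_floor; rewrite ler_pdivlMr// mul1r rhod.
  rewrite ler_pdivlMr// in k1; rewrite ler_pdivrMr// in k2.
  exists k; first by split => //=; rewrite mulrC.
  rewrite lef_pV2 ?posrE ?exprn_gt0 ?rho0//.
  by apply: lerXn2r; rewrite ?nnegrE ?[(delta * _)%R]mulrC// ltW// ?rho0// mulrC.
- move=> k; rewrite setIA setIid.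
  have dk : (delta <= delta * 2 ^+ k.+1)%R.
    by rewrite ler_peMr ?(ltW d0)// exprn_ege1// ler1n.
  apply: (@le_trans _ _ (((delta * 2 ^+ k) ^- b)%:E *
    (A * (delta * 2 ^+ k.+1) ^+ a)%:E)).
    by rewrite lee_wpmul2l ?muA// lee_fin invr_ge0 exprn_ge0// ltW.
  rewrite -EFinM lee_fin.
  rewrite [leLHS](_ : _ = A * 2 ^+ a / (delta * 2 ^+ k) ^+ (b - a))%R; last first.
    rewrite -{1}(subnK (ltnW ab)) exprD exprSr mulrA [((_ * 2) ^+ a)%R]exprMn.
    by field; rewrite !expf_neq0// gt_eqF.
  rewrite natrX exprSr (exprSr _ k) exprMn.
  rewrite [leRHS](_ : _ = A * 2 ^+ a / (delta ^+ (b - a) * 2 ^+ k))%R; last first.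
    by field; rewrite !expf_neq0// gt_eqF.
  rewrite ler_wpM2l ?mulr_ge0 ?exprn_ge0//.
  rewrite lef_pV2 ?posrE ?mulr_gt0 ?exprn_gt0//.
  rewrite ler_pM2l ?exprn_gt0// -exprM ler_weXn2l ?ler1n//.
  by rewrite leq_pmulr// subn_gt0.
Qed.

(** The companion of [integral_far_decay] near a singularity: the shells are now
[rho] about [delta / 2 ^+ k], and integrability requires [b < a]. *)
Lemma integral_near_decay D (rho : T -> R) a b (A delta : R) :
  measurable D -> measurable_fun D rho -> (0 < delta)%R -> (0 <= A)%R ->
  (b < a)%N -> (forall x, D x -> 0 < rho x <= delta)%R ->
  (forall s, (0 < s)%R ->
     mu (D `&` [set x | (rho x <= s)%R]) <= (A * s ^+ a)%:E) ->
  \int[mu]_(x in D) (rho x ^- b)%:E <=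
    (A * 2 ^+ b.+1 * delta ^+ (a - b))%:E.
Proof.
move=> mD mrho d0 A0 ba rhod muA.
have rho0 x : D x -> (0 < rho x)%R by move=> /rhod/andP[].
have d2 k : (0 < delta / 2 ^+ k)%R by rewrite divr_gt0// exprn_gt0.
apply: (@integral_le_weighted_cover _ _
    (fun k => D `&` [set x | rho x <= delta / 2 ^+ k]%R)
    (fun k => (delta / 2 ^+ k.+1) ^- b)%R) => //.
- exact/measurable_funVr/measurable_funX.
- by move=> x Dx; rewrite invr_ge0 exprn_ge0// ltW// rho0.
- by move=> k; exact: measurable_sublevel.
- by move=> k; rewrite invr_ge0 exprn_ge0// ltW.
- move=> x Dx; have r0 := rho0 _ Dx; have /andP[_ rd] := rhod _ Dx.
  have [k /andP[k1 k2]] : exists k, (2 ^+ k <= delta / rho x <= 2 ^+ k.+1)%R.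
    by apply: dyadic_floor; rewrite ler_pdivlMr// mul1r.
  rewrite ler_pdivlMr// in k1; rewrite ler_pdivrMr// in k2.
  exists k; first by split => //=; rewrite ler_pdivlMr ?exprn_gt0// mulrC.
  rewrite lef_pV2 ?posrE ?exprn_gt0//.
  apply: lerXn2r; rewrite ?nnegrE ?(ltW r0) ?(ltW (d2 _))//.
  by rewrite ler_pdivrMr ?exprn_gt0// mulrC.
- move=> k; rewrite setIA setIid.
  apply: (@le_trans _ _ (((delta / 2 ^+ k.+1) ^- b)%:E *
    (A * (delta / 2 ^+ k) ^+ a)%:E)).
    by rewrite lee_wpmul2l ?muA// lee_fin invr_ge0 exprn_ge0// ltW.
  rewrite -EFinM lee_fin.
  rewrite [leLHS](_ : _ = A * 2 ^+ b * (delta / 2 ^+ k) ^+ (a - b))%R; last first.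
    have -> : (delta / 2 ^+ k.+1 = (delta / 2 ^+ k) / 2)%R.
      by rewrite exprSr invfM mulrA.
    rewrite -{1}(subnK (ltnW ba)) exprD (exprMn b _ 2^-1%R) exprVn.
    by field; rewrite !expf_neq0// gt_eqF.
  rewrite natrX exprSr (exprSr _ k) exprMn.
  rewrite [leRHS](_ : _ = A * 2 ^+ b * (delta ^+ (a - b) / 2 ^+ k))%R; last first.
    by field; rewrite !expf_neq0.
  rewrite ler_wpM2l ?mulr_ge0 ?exprn_ge0//.
  rewrite ler_pM2l ?exprn_gt0// exprVn lef_pV2 ?posrE ?exprn_gt0//.
  by rewrite -exprM ler_weXn2l ?ler1n// leq_pmulr// subn_gt0.
Qed.

End dyadic.

(** * Volumes of balls and spherical caps *)

Section volumes.
Context {R : realType} {n : nat}.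
Implicit Types (x y : 'rV[R]_n) (s : R).

Lemma continuous_measurable_rV (D : set 'rV[R]_n) (f : 'rV[R]_n -> R) :
  measurable D -> continuous f -> measurable_fun D f.
Proof.
move=> mD cf; apply: within_continuous_measurable_rV => //.
exact: continuous_subspaceT.
Qed.

Lemma continuous_enorm_dist x : continuous (fun y => enorm (y - x)).
Proof.
move=> y; apply: (@continuous_comp _ _ _ (fun y => y - x) (@enorm R n)).
  exact: (cvgB cvg_id (cvg_cst x)).
exact: enorm_continuous.
Qed.

Lemma measurable_enorm_dist (D : set 'rV[R]_n) x :
  measurable D -> measurable_fun D (fun y => enorm (y - x)).
Proof.
by move=> mD; apply: continuous_measurable_rV => //; exact: continuous_enorm_dist.
Qed.

Lemma measurable_cball x s : measurable [set y | enorm (y - x) <= s].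
Proof.
rewrite -[X in measurable X]setTI; apply: measurable_sublevel => //.
exact: measurable_enorm_dist.
Qed.

Lemma lebesgue_cball_le x s : 0 <= s ->
  (lebesgue_rV n [set y | (enorm (y - x) <= s)%R] <= ((2 * s) ^+ n)%:E)%E.
Proof.
move=> s0; pose I (i : 'I_n) := `[x ord0 i - s, x ord0 i + s]%classic.
have mI i : measurable (I i) by exact: measurable_itv.
apply: (@le_trans _ _ (lebesgue_rV n [set y | forall i, I i (y ord0 i)])).
  apply: le_measure; rewrite ?inE; first exact: measurable_cball.
    exact: measurable_box.
  move=> y /= ys i; rewrite /I /= in_itv /=.
  have := le_trans (enorm_coord (y - x) i) ys.
  by rewrite !mxE ler_norml => /andP[? ?]; apply/andP; split; lra.
rewrite lebesgue_rV_box//.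
rewrite (eq_bigr (fun=> (2 * s)%:E)); last first.
  move=> i _; rewrite /I lebesgue_measure_itv/= lte_fin.
  case: ltP => h; first by rewrite -EFinB; congr EFin; ring.
  by congr EFin; move: h s0; set z := x ord0 i; lra.
by rewrite prodEFin prodr_const card_ord.
Qed.

Definition ball_scale : R := (fine (lebesgue_rV n (@eball R n)))^-1.

Lemma ball_scale_ge0 : 0 <= ball_scale.
Proof. by rewrite invr_ge0 fine_ge0. Qed.

Lemma ball_measure_cball_le x s : 0 <= s ->
  (ball_measure [set y | (enorm (y - x) <= s)%R] <=
   (ball_scale * 2 ^+ n * s ^+ n)%:E)%E.
Proof.
move=> s0; rewrite -mulrA -exprMn EFinM.
by apply: lee_wpmul2l; [rewrite lee_fin ball_scale_ge0|exact: lebesgue_cball_le].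
Qed.

Lemma measurable_set1_rV x : measurable [set x].
Proof.
rewrite (_ : [set x] = [set y | forall i, [set x ord0 i] (y ord0 i)]).
  exact: (@measurable_box R n (fun i => [set x ord0 i])).
by apply/seteqP; split=> [y -> //|y /= yx]; apply/rowP => i; exact: yx.
Qed.

Lemma ball_measure_set1 x : (0 < n)%N -> ball_measure [set x] = 0%E.
Proof.
move=> n0; apply/eqP; rewrite eq_le measure_ge0 andbT.
apply/lee_addgt0Pr => e e0; rewrite add0e.
pose c := ball_scale * 2 ^+ n + 1.
have c0 : 0 < c by rewrite ltr_pwDr// mulr_ge0 ?ball_scale_ge0 ?exprn_ge0.
pose s := Num.min 1 (e / c).
have s0 : 0 < s by rewrite lt_min ltr01 divr_gt0.
apply: (@le_trans _ _ (ball_measure [set y | enorm (y - x) <= s])).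
  apply: le_measure; rewrite ?inE; first exact: measurable_set1_rV.
    exact: measurable_cball.
  by move=> y ->/=; rewrite subrr enorm0 ltW.
apply: le_trans (ball_measure_cball_le x (ltW s0)) _.
rewrite lee_fin; apply: (@le_trans _ _ (c * s)).
  apply: ler_pM; rewrite ?mulr_ge0 ?ball_scale_ge0 ?exprn_ge0// ?(ltW s0)//.
    by rewrite lerDl.
  by rewrite ler_iXnr// ?(ltW s0)// ge_min lexx.
by rewrite mulrC -ler_pdivlMr// ge_min lexx orbT.
Qed.

Lemma sphere_measureE (A : set 'rV[R]_n) :
  sphere_measure A = ball_measure (radial_proj @^-1` A `&` eball).
Proof. by []. Qed.

(** The measure of a cap is the volume of the cone over it. Let [s < 1]. When
[xi = y / |y|] is within [s] of [x], the point [y] lies within [s] of the segment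
from 0 to [x], which is covered by about [1 / s] balls of radius [3 * s]; their total volume
is of order [s ^+ (n - 1)]. *)
Lemma sphere_cap_le : (0 < n)%N -> exists2 C : R, 0 <= C & forall x s, 0 < s ->
  (sphere_measure (esphere `&` [set xi | (enorm (xi - x) <= s)%R]) <=
   (C * s ^+ (n - 1))%:E)%E.
Proof.
move=> n0; pose C := 1 + 2 * (ball_scale * 2 ^+ n * 3 ^+ n).
have K0 : 0 <= ball_scale * 2 ^+ n * 3 ^+ n.
  by rewrite !mulr_ge0 ?ball_scale_ge0 ?exprn_ge0.
have C0 : 0 <= C by rewrite addr_ge0// mulr_ge0.
exists C => [//|x s s0].
have mS : measurable (esphere `&` [set xi | enorm (xi - x) <= s]).
  by apply: measurableI; [exact: measurable_esphere|exact: measurable_cball].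
have [s1|s1] := lerP 1 s.
  apply: (@le_trans _ _ 1%E).
    rewrite -(@sphere_measure_esphere R n n0); apply: le_measure; rewrite ?inE//.
    exact: measurable_esphere.
  rewrite lee_fin -[leLHS]mulr1 ler_pM// ?exprn_ege1//.
  by rewrite /C lerDl mulr_ge0.
rewrite sphere_measureE.
set A := (X in ball_measure X).
have mA : measurable A.
  apply: measurableI; last exact: measurable_eball.
  by rewrite -[X in measurable X]setTI; exact: measurable_radial_proj.
pose m := (Num.truncn s^-1).+1.
pose B k := [set y : 'rV[R]_n | enorm (y - (k%:R * s) *: x) <= 3 * s].
have mB k : measurable (B k) by exact: measurable_cball.
have AB : A `<=` \big[setU/set0]_(k < m) B k.
  move=> y [/= [p1 px] y1]; rewrite /eball/= in y1.
  have y0 : 0 < enorm y.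
    rewrite lt_neqAle enorm_ge0 andbT; apply/eqP => y0; move: p1.
    by rewrite /radial_proj/esphere/= -y0 invr0 scale0r enorm0 => /eqP;
      rewrite eq_sym oner_eq0.
  (* [y] is close to [|y| x], which is close to the [k]-th centre [k s x] *)
  pose k := Num.truncn (enorm y / s).
  have ys0 : 0 <= enorm y / s by rewrite divr_ge0 ?enorm_ge0// ltW.
  have /andP[k1 k2] := truncn_itv ys0.
  rewrite -/k ler_pdivlMr// in k1; rewrite -/k ltr_pdivrMr// in k2.
  have km : (k < m)%N.
    rewrite ltnS; apply: le_truncn; rewrite -[leRHS]mul1r ler_pM2r ?invr_gt0//.
    exact: ltW.
  rewrite -bigcup_mkord; exists k => //=; rewrite /B/=.
  have x2 : enorm x <= 2.
    have := enormB_ge x (radial_proj y); rewrite enorm_distC.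
    by move: p1 px; rewrite /esphere/= => ->; lra.
  apply: le_trans (enorm_dist_triangle (enorm y *: x) _ _) _.
  have -> : y - enorm y *: x = enorm y *: (radial_proj y - x).
    by rewrite scalerBr scalerA divff ?gt_eqF// scale1r.
  rewrite -scalerBl !enormZ !ger0_norm ?enorm_ge0 ?subr_ge0//.
  have : enorm y * enorm (radial_proj y - x) <= 1 * s.
    by apply: ler_pM; rewrite ?enorm_ge0// ltW.
  have : (enorm y - k%:R * s) * enorm x <= s * 2.
    apply: ler_pM; rewrite ?enorm_ge0 ?subr_ge0//.
    by move: k2; rewrite -natr1; lra.
  by lra.
have BA : (ball_measure A <= \sum_(k < m) ball_measure (B k))%E.
  exact: (@content_subadditive _ _ _ (@ball_measure R n)).
apply: le_trans BA _.
apply: (@le_trans _ _ (\sum_(k < m) (ball_scale * 2 ^+ n * (3 * s) ^+ n)%:E)%E).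
  apply: lee_sum => k _; apply: ball_measure_cball_le.
  by rewrite mulr_ge0// ltW.
rewrite sumEFin lee_fin sumr_const card_ord -[leLHS]mulr_natl [((3 * s) ^+ n)]exprMn.
have ms : m%:R * s <= 2.
  rewrite /m -natr1 mulrDl mul1r.
  have : (Num.truncn s^-1)%:R * s <= 1.
    rewrite -ler_pdivlMr// mul1r; rewrite truncn_le invr_ge0; exact: ltW.
  by move: s1; lra.
have sE : s ^+ n = s * s ^+ n.-1 by rewrite -exprS prednK.
rewrite sE subn1.
have sn : 0 <= s ^+ n.-1 by rewrite exprn_ge0// ltW.
rewrite [leLHS](_ : _ = (m%:R * s) * (ball_scale * 2 ^+ n * 3 ^+ n * s ^+ n.-1)); last first.
  by ring.
apply: (@le_trans _ _ (2 * (ball_scale * 2 ^+ n * 3 ^+ n * s ^+ n.-1))).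
  by rewrite ler_wpM2r// mulr_ge0.
by rewrite mulrA ler_wpM2r// /C lerDr.
Qed.

End volumes.

(** * The radial profile of the Green kernel *)

Section green_profile.
Context {R : realType}.
Variable n : nat.
Local Notation mu := (@lebesgue_measure R).
Implicit Types r s a b : R.

Definition green_density s := (1 - s ^+ 2) ^+ (n - 2) / s ^+ (n - 1).

Definition green_profile r := \int[mu]_(s in `[r, 1]) green_density s.

Lemma green_density_ge0 s : 0 < s <= 1 -> 0 <= green_density s.
Proof.
move=> /andP[s0 s1]; rewrite divr_ge0 ?exprn_ge0 ?(ltW s0)//.
by rewrite subr_ge0 expr_le1// ltW.
Qed.

Lemma green_density_le a b : 0 < a -> a <= b -> b <= 1 ->
  green_density b <= green_density a.
Proof.
move=> a0 ab b1; have b0 := lt_le_trans a0 ab.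
apply: ler_pM.
- by rewrite exprn_ge0// subr_ge0 expr_le1// ltW.
- by rewrite invr_ge0 exprn_ge0// ltW.
- apply: lerXn2r; rewrite ?nnegrE ?subr_ge0 ?expr_le1// ?(le_trans ab)//.
  + exact: ltW.
  + exact: ltW.
  + by rewrite lerD2l lerN2 lerXn2r// nnegrE ltW.
- by rewrite lef_pV2 ?posrE ?exprn_gt0// lerXn2r// nnegrE ltW.
Qed.

Lemma integrable_green_density a b : 0 < a ->
  mu.-integrable `[a, b] (EFin \o green_density).
Proof.
move=> a0; apply: continuous_compact_integrable; first exact: segment_compact.
apply: continuous_in_subspaceT => s; rewrite inE/= in_itv/= => /andP[as_ _].
apply: cvgM.
  apply: (@continuous_comp _ _ _ (fun s => 1 - s ^+ 2) (fun t : R => t ^+ (n - 2))).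
    by apply: cvgB; [exact: cvg_cst|exact: exprn_continuous].
  exact: exprn_continuous.
apply: cvgV; last exact: exprn_continuous.
by rewrite expf_neq0// gt_eqF// (lt_le_trans a0).
Qed.

Lemma green_profile_ge0 a : 0 < a -> 0 <= green_profile a.
Proof.
move=> a0; apply: Rintegral_ge0 => s /=; rewrite in_itv/= => /andP[as_ s1].
by rewrite green_density_ge0// s1 (lt_le_trans a0).
Qed.

Lemma integral_green_density_le a b : 0 < a -> a <= b -> b <= 1 ->
  0 <= \int[mu]_(s in `[a, b]) green_density s <= (b - a) * green_density a.
Proof.
move=> a0 ab b1; apply/andP; split.
  apply: Rintegral_ge0 => s /=; rewrite in_itv/= => /andP[as_ sb].
  by rewrite green_density_ge0// (le_trans sb)// (lt_le_trans a0).
apply: (@le_trans _ _ (\int[mu]_(s in `[a, b]) green_density a)).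
  apply: le_Rintegral => //; first exact: integrable_green_density.
    apply: continuous_compact_integrable; first exact: segment_compact.
    by apply: continuous_subspaceT => s; exact: cvg_cst.
  move=> s /=; rewrite in_itv/= => /andP[as_ sb].
  by rewrite green_density_le// (le_trans sb).
rewrite Rintegral_cst//= lebesgue_measure_itv/= lte_fin mulrC.
by case: ltP => // ba; rewrite mul0r mulr_ge0 ?green_density_ge0 ?subr_ge0//
  a0 (le_trans ab).
Qed.

Lemma green_profile_le a : 0 < a -> a <= 1 ->
  green_profile a <= (1 - a) * green_density a.
Proof.
by move=> a0 a1; have /andP[] := integral_green_density_le a0 a1 (lexx 1).
Qed.

Lemma green_profileB a b : 0 < a -> a <= b -> b <= 1 ->
  0 <= green_profile a - green_profile b <= (b - a) * green_density a.
Proof.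
move=> a0 ab b1.
have ai : mu.-integrable `[a, 1] (EFin \o green_density).
  exact: integrable_green_density.
have E : green_profile a - green_profile b =
    \int[mu]_(s in `[a, b]) green_density s.
  have := @Rintegral_itvB R green_density (BLeft a) (BRight 1) b ai.
  rewrite !bnd_simp => /(_ ab b1) H.
  rewrite /green_profile -(@Rintegral_itv_obnd_cbnd _ b (BRight 1)); last first.
    apply: integrableS ai => //.
    by apply: subset_itvr; rewrite bnd_simp.
  by rewrite -H opprB addrC subrK.
by rewrite E; exact: integral_green_density_le.
Qed.

Lemma green_profile_dist_le a b : 0 < a <= 1 -> 0 < b <= 1 ->
  `|green_profile a - green_profile b| <=
  `|a - b| * (green_density a + green_density b).
Proof.
wlog ab : a b / a <= b => [H a1 b1|/andP[a0 a1] /andP[b0 b1]].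
  have /orP[ab|ba] := le_total a b; first exact: H.
  rewrite (distrC (green_profile a)) (distrC a) (addrC (green_density a)).
  exact: H.
have /andP[h0 h1] := green_profileB a0 ab b1.
rewrite ger0_norm// (distrC a) (ger0_norm (_ : 0 <= b - a)) ?subr_ge0//.
apply: le_trans h1 _; rewrite ler_wpM2l ?subr_ge0// lerDl.
by rewrite green_density_ge0// b0.
Qed.

Lemma measurable_green_profile d (T : measurableType d) (D : set T)
    (rho : T -> R) : measurable D -> measurable_fun D rho ->
  (forall x, D x -> 0 < rho x <= 1) ->
  measurable_fun D (fun x => green_profile (rho x)).
Proof.
move=> mD mrho rho01.
pose theta r : R := if r <= 0 then 0 else
  if r <= 1 then (1 + green_profile r)^-1 else 1.
have th : {homo theta : a b / a <= b}.
  move=> a b ab; rewrite /theta.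
  have [a0|a0] := lerP a 0.
    case: (leP b 0) => [//|b0]; case: (leP b 1) => [b1|//].
    by rewrite invr_ge0 addr_ge0// green_profile_ge0.
  have b0 := lt_le_trans a0 ab.
  rewrite (leNgt b) b0/=.
  have [b1|b1] := lerP b 1.
    rewrite (le_trans ab b1) lef_pV2 ?posrE ?ltr_pwDl ?green_profile_ge0//.
    by rewrite lerD2l -subr_ge0; have /andP[] := green_profileB a0 ab b1.
  case: (leP a 1) => [a1|//]; rewrite invf_le1 ?ltr_pwDl ?green_profile_ge0//.
  by rewrite lerDl green_profile_ge0.
apply: (eq_measurable_fun (fun x => (theta (rho x))^-1 - 1)).
  move=> x; rewrite inE => /rho01 /andP[r0 r1].
  by rewrite /theta leNgt r0 r1 /= invrK addrC addKr.
apply: measurable_funB => //; apply: measurable_funVr.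
by apply: measurableT_comp mrho; exact: nondecreasing_measurable.
Qed.

End green_profile.

(** * Pseudo-hyperbolic distance under displacement of a point *)

Section bracket.
Context {R : realType} {n : nat}.
Implicit Types (x y z : 'rV[R]_n).

Lemma eball_sqr_lt x : eball x -> enorm x ^+ 2 < 1.
Proof. by move=> x1; rewrite expr_lt1// enorm_ge0. Qed.

Lemma bracket_sqr x y : eball x -> eball y ->
  bracket x y ^+ 2 = enorm (x - y) ^+ 2 +
    (1 - enorm x ^+ 2) * (1 - enorm y ^+ 2).
Proof.
move=> /eball_sqr_lt x1 /eball_sqr_lt y1.
by rewrite sqr_sqrtr// addr_ge0 ?sqr_ge0// mulr_ge0// subr_ge0 ltW.
Qed.

Lemma bracket_ge0 x y : 0 <= bracket x y.
Proof. exact: sqrtr_ge0. Qed.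

Lemma bracket_ge_dist x y : eball x -> eball y -> enorm (x - y) <= bracket x y.
Proof.
move=> xB yB; have := eball_sqr_lt xB; have := eball_sqr_lt yB => y1 x1.
rewrite -(ler_pXn2r (_ : 0 < 2)%N) ?nnegrE ?enorm_ge0 ?bracket_ge0//.
by rewrite bracket_sqr// lerDl mulr_ge0// subr_ge0 ltW.
Qed.

Lemma bracket_ge_bdist x y : eball x -> eball y -> 1 - enorm x <= bracket x y.
Proof.
move=> xB yB; rewrite -(ler_pXn2r (_ : 0 < 2)%N) ?nnegrE ?bracket_ge0 ?subr_ge0 ?(ltW xB)//.
rewrite bracket_sqr// enormB_sqr.
have := edot_le x y; have := enorm_ge0 x; have := enorm_ge0 y.
move: xB yB; rewrite /eball/=.
move: (enorm x) (enorm y) (edot x y) => a b c a1 b1 b0 a0 cab.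
have : (1 - a) ^+ 2 <= (1 - a * b) ^+ 2.
  by rewrite lerXn2r ?nnegrE//; nra.
by nra.
Qed.

Lemma bracket_gt0 x y : eball x -> eball y -> 0 < bracket x y.
Proof.
move=> xB yB; apply: lt_le_trans (bracket_ge_bdist xB yB).
by rewrite subr_gt0.
Qed.

(** For [y != 0] the bracket is the Euclidean norm of [|y| x - y / |y|], an affine
function of [x] with slope [|y| <= 1]. *)
Lemma bracket_lipschitz x z y : eball x -> eball z -> eball y ->
  bracket x y <= bracket z y + enorm (x - z).
Proof.
move=> xB zB yB.
have [->|y0] := eqVneq y 0.
  have E (w : 'rV[R]_n) : eball w -> bracket w 0 = 1.
    move=> wB; apply/eqP; rewrite -(@eqrXn2 _ 2) ?bracket_ge0//.
    rewrite expr1n bracket_sqr//; last by rewrite /eball/= enorm0.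
    by rewrite subr0 enorm0 expr0n/= subr0 mulr1 addrC subrK.
  by rewrite !E// lerDl enorm_ge0.
have E (w : 'rV[R]_n) : eball w ->
    bracket w y = enorm (enorm y *: w - (enorm y)^-1 *: y).
  move=> wB; apply/eqP; rewrite -(@eqrXn2 _ 2) ?bracket_ge0 ?enorm_ge0//.
  rewrite bracket_sqr// !enormB_sqr !enormZ ger0_norm ?enorm_ge0//.
  rewrite ger0_norm ?invr_ge0 ?enorm_ge0// edotZl edotZr.
  by apply/eqP; field; rewrite enorm_eq0.
rewrite !E//.
have -> : enorm y *: x - (enorm y)^-1 *: y =
    (enorm y *: z - (enorm y)^-1 *: y) + enorm y *: (x - z).
  by apply/rowP => i; rewrite !mxE; ring.
apply: le_trans (enormD_le _ _) _; rewrite lerD2l enormZ ger0_norm ?enorm_ge0//.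
by rewrite ler_piMl ?enorm_ge0// ltW.
Qed.

Lemma mobius_abs_gt0 x y : eball x -> eball y -> x != y -> 0 < mobius_abs x y.
Proof.
move=> xB yB xy; rewrite divr_gt0 ?bracket_gt0//.
by rewrite enorm_gt0 subr_eq0.
Qed.

Lemma mobius_absE x y : eball x -> eball y ->
  1 - mobius_abs x y ^+ 2 =
  (1 - enorm x ^+ 2) * (1 - enorm y ^+ 2) / bracket x y ^+ 2.
Proof.
move=> xB yB; have B0 := bracket_gt0 xB yB; have := bracket_sqr xB yB.
rewrite /mobius_abs; move: (bracket x y) B0 => B B0 E.
rewrite expr_div_n; apply: (@mulIf _ (B ^+ 2)); first by rewrite gt_eqF ?exprn_gt0.
by rewrite mulfVK ?gt_eqF ?exprn_gt0// mulrBl mul1r mulfVK ?gt_eqF ?exprn_gt0//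
  E addrAC subrr add0r.
Qed.

Lemma mobius_abs_le1 x y : eball x -> eball y -> mobius_abs x y <= 1.
Proof.
by move=> xB yB; rewrite ler_pdivrMr ?bracket_gt0// mul1r bracket_ge_dist.
Qed.

(** With [rho = a / B], where [1 - rho^2 = e f / B^2], multiplying [rho - rho'] by
[rho + rho'] makes the numerator a polynomial,
[f ((a^2 - a'^2) e' + a'^2 (e' - e))], in which every term is small with [h]; the
factor [rho + rho'] is then cancelled using [a = rho B] and [a' = rho' B']. *)
Lemma quotient_dist_le (a a' B B' e e' f h : R) :
  0 < a -> 0 < a' -> 0 < B -> 0 < B' -> 0 < e' -> 0 < f ->
  B ^+ 2 = a ^+ 2 + e * f -> B' ^+ 2 = a' ^+ 2 + e' * f ->
  B <= 2 * B' -> a' <= B' -> e' <= 2 * B' ->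
  `|a - a'| <= h -> `|e - e'| <= 2 * h ->
  `|a / B - a' / B'| <= 6 * h * f / B ^+ 2.
Proof.
move=> a0 a'0 B0 B'0 e'0 f0 EB EB' BB aB eB ah eh.
have h0 : 0 <= h by exact: le_trans ah.
have r0 : 0 < a / B + a' / B' by rewrite addr_gt0 ?divr_gt0.
rewrite -(ler_pM2r r0) -{1}(gtr0_norm r0) -normrM.
rewrite [X in `|X|](_ : _ = f * ((a - a') * (a + a') * e' + a' ^+ 2 * (e' - e)) /
  (B ^+ 2 * B' ^+ 2)); last first.
  have -> : (a / B - a' / B') * (a / B + a' / B') =
    (a ^+ 2 * B' ^+ 2 - a' ^+ 2 * B ^+ 2) / (B ^+ 2 * B' ^+ 2).
    by field; rewrite !gt_eqF.
  by rewrite EB EB'; congr (_ / _); ring.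
rewrite normrM normrM (gtr0_norm f0) normfV.
rewrite (gtr0_norm (_ : 0 < B ^+ 2 * B' ^+ 2)); last by rewrite mulr_gt0 ?exprn_gt0.
rewrite ler_pdivrMr; last by rewrite mulr_gt0 ?exprn_gt0.
rewrite [leRHS](_ : _ = f * (6 * h * (a / B + a' / B') * B' ^+ 2)); last first.
  by field; rewrite !gt_eqF.
rewrite ler_pM2l//; apply: le_trans (ler_normD _ _) _.
rewrite (normrM _ e') (normrM _ (a + a')) (normrM (a' ^+ 2)).
rewrite (gtr0_norm e'0) (ger0_norm (sqr_ge0 a')).
rewrite (ger0_norm (_ : 0 <= a + a')); last by rewrite addr_ge0 ?ltW.
rewrite (distrC e').
apply: (@le_trans _ _ (h * (a + a') * e' + a' ^+ 2 * (2 * h))).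
  apply: lerD; last by rewrite ler_wpM2l// sqr_ge0.
  by rewrite -!mulrA ler_wpM2r// mulr_ge0 ?ltW// addr_gt0.
have -> : h * (a + a') * e' + a' ^+ 2 * (2 * h) =
  h * ((a + a') * e' + 2 * a' ^+ 2) by ring.
have -> : 6 * h * (a / B + a' / B') * B' ^+ 2 =
  h * (6 * (a / B + a' / B') * B' ^+ 2) by ring.
rewrite ler_wpM2l//.
have Ea : a = a / B * B by rewrite mulfVK// gt_eqF.
have Ea' : a' = a' / B' * B' by rewrite mulfVK// gt_eqF.
have u0 : 0 < a / B by rewrite divr_gt0.
have v0 : 0 < a' / B' by rewrite divr_gt0.
apply: (@le_trans _ _ ((a / B + a' / B') * (2 * B') * (2 * B') +
   2 * (a' / B' * B' * B'))).
  apply: lerD.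
    apply: ler_pM => //; rewrite ?addr_ge0 ?(ltW a0) ?(ltW a'0) ?(ltW e'0)//.
    rewrite mulrDl {1}Ea {1}Ea' lerD// ler_wpM2l ?(ltW u0) ?(ltW v0)//.
    by rewrite ler_peMl ?(ltW B'0)// ler1n.
  by rewrite ler_pM2l// -Ea' expr2 ler_pM2l.
move: (a / B) (a' / B') u0 v0 => u v u0 v0.
by have := mulr_gt0 u0 (exprn_gt0 2 B'0); nra.
Qed.

(** Since [1 - rho^2 = (1 - |x|^2) (1 - |y|^2) / [x, y]^2], the right-hand side is
[6 |x - z| (1 - rho^2) / (1 - |x|^2)]: the pseudo-hyperbolic distance to [y] varies
slowly when it is close to 1, which is what compensates the growth of the density
of [tau] at the boundary. *)
Lemma mobius_abs_dist_le x z y : eball x -> eball z -> eball y ->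
  x != y -> z != y -> enorm (x - z) <= 1 - enorm z ->
  `|mobius_abs x y - mobius_abs z y| <=
    6 * enorm (x - z) * (1 - enorm y ^+ 2) / bracket x y ^+ 2.
Proof.
move=> xB zB yB xy zy hz.
have x2 := eball_sqr_lt xB; have z2 := eball_sqr_lt zB; have y2 := eball_sqr_lt yB.
have Bz := bracket_ge_bdist zB yB.
apply: (@quotient_dist_le _ _ _ _ (1 - enorm x ^+ 2) (1 - enorm z ^+ 2));
  rewrite ?enorm_gt0 ?subr_eq0 ?bracket_gt0 ?subr_gt0 ?bracket_sqr//.
- by have := bracket_lipschitz xB zB yB; lra.
- exact: bracket_ge_dist.
- move: zB Bz; rewrite /eball/=; have := enorm_ge0 z.
  by move: (enorm z) (bracket z y) => a b *; nra.
- by apply: le_trans (enorm_dist_norm _ _) _; rewrite opprB addrA subrK.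
- have := enorm_dist_norm x z; have := enorm_ge0 x; have := enorm_ge0 z.
  move: xB zB; rewrite /eball/= !ler_norml.
  move: (enorm x) (enorm z) (enorm (x - z)) => a b h a1 b1 b0 a0 /andP[h1 h2].
  by apply/andP; split; nra.
Qed.

End bracket.

(** * Displacement of the pole of the Green kernel *)

Section green_majorant.
Context {R : realType} {n : nat}.
Hypothesis n_ge3 : (3 <= n)%N.
Implicit Types (x y z : 'rV[R]_n).

(** Up to a constant, the modulus of the gradient in [x] of the Green kernel at [y],
multiplied by [(1 - |y|^2)^(1 - n)]; this is the weight that remains after
[|psi| <= M (1 - |y|^2)] has been used against the density of [tau]. *)
Definition green_majorant x y : R :=
  (1 - enorm x ^+ 2) ^+ (n - 2) / (bracket x y * enorm (x - y)) ^+ (n - 1).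

Lemma one_sub_sqr_gt0 x : eball x -> 0 < 1 - enorm x ^+ 2.
Proof. by move=> xB; rewrite subr_gt0 eball_sqr_lt. Qed.

Lemma green_majorant_ge0 x y : eball x -> eball y -> 0 <= green_majorant x y.
Proof.
move=> xB yB; rewrite divr_ge0 ?exprn_ge0 ?(ltW (one_sub_sqr_gt0 xB))//.
by rewrite mulr_ge0 ?bracket_ge0 ?enorm_ge0.
Qed.

Lemma green_density_majorantE x y : eball x -> eball y -> x != y ->
  (1 - enorm y ^+ 2) / bracket x y ^+ 2 * green_density n (mobius_abs x y) =
  (1 - enorm y ^+ 2) ^+ (n - 1) * green_majorant x y.
Proof.
move=> xB yB xy; rewrite /green_density mobius_absE// /green_majorant/mobius_abs.
have := bracket_gt0 xB yB; have : 0 < enorm (x - y) by rewrite enorm_gt0 subr_eq0.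
move: (bracket x y) (enorm (x - y)) (1 - enorm x ^+ 2) (1 - enorm y ^+ 2).
move=> B a e f a0 B0; move: n_ge3; case: n => [|[|[|m]]]// _.
rewrite !subSS !subn0.
rewrite !expr_div_n !expr2 !exprMn !(exprS _ m.+1).
move: (exprn_gt0 m.+1 a0) (exprn_gt0 m.+1 B0).
move: (a ^+ m.+1) (B ^+ m.+1) (e ^+ m.+1) (f ^+ m.+1) => am Bm em fm am0 Bm0.
by field; rewrite !gt_eqF.
Qed.

Lemma green_kernelE x y :
  green_kernel x y = n%:R^-1 * green_profile n (mobius_abs x y).
Proof. by []. Qed.

Lemma mobius_abs01 x y : eball x -> eball y -> x != y ->
  0 < mobius_abs x y <= 1.
Proof. by move=> xB yB xy; rewrite mobius_abs_gt0// mobius_abs_le1. Qed.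

(** The profile at [rho] is at most [(1 - rho)] times the density at [rho], and
[1 - rho <= 1 - rho^2] is a multiple of [(1 - |y|^2) / [x, y]^2]. *)
Lemma green_kernel_le x y : eball x -> eball y -> x != y ->
  `|green_kernel x y| <= (1 - enorm y ^+ 2) ^+ (n - 1) * green_majorant x y.
Proof.
move=> xB yB xy; have /andP[r0 r1] := mobius_abs01 xB yB xy.
have g0 := @green_density_ge0 R n _ (mobius_abs01 xB yB xy).
rewrite green_kernelE ger0_norm ?mulr_ge0 ?invr_ge0 ?green_profile_ge0//.
apply: (@le_trans _ _ (1 * green_profile n (mobius_abs x y))).
  rewrite ler_wpM2r ?green_profile_ge0// invf_le1 ?ltr0n ?ler1n.
    exact: leq_trans n_ge3.
  exact: leq_trans n_ge3.
rewrite mul1r; apply: le_trans (green_profile_le _ r0 r1) _.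
rewrite -green_density_majorantE// ler_wpM2r//.
apply: (@le_trans _ _ (1 - mobius_abs x y ^+ 2)); first by nra.
rewrite mobius_absE// -mulrA ler_piMl//.
  by rewrite divr_ge0 ?sqr_ge0 ?ltW ?one_sub_sqr_gt0.
by rewrite lerBlDr lerDl sqr_ge0.
Qed.

(** The density is evaluated at both pseudo-hyperbolic distances, and each value is paired
with the displacement bound centred at the same pole. *)
Lemma green_kernel_dist_le x z y : eball x -> eball z -> eball y ->
  x != y -> z != y ->
  enorm (x - z) <= 1 - enorm x -> enorm (x - z) <= 1 - enorm z ->
  `|green_kernel x y - green_kernel z y| <=
    6 * enorm (x - z) * (1 - enorm y ^+ 2) ^+ (n - 1) *
      (green_majorant x y + green_majorant z y).
Proof.
move=> xB zB yB xy zy hx hz.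
have r1 := mobius_abs01 xB yB xy; have s1 := mobius_abs01 zB yB zy.
have g0 := @green_density_ge0 R n _ r1.
have k0 := @green_density_ge0 R n _ s1.
rewrite !green_kernelE -mulrBr normrM ger0_norm ?invr_ge0//.
apply: (@le_trans _ _ (1 * `|green_profile n (mobius_abs x y) -
   green_profile n (mobius_abs z y)|)).
  rewrite ler_wpM2r// invf_le1 ?ltr0n ?ler1n; exact: leq_trans n_ge3.
rewrite mul1r.
apply: le_trans (@green_profile_dist_le R n _ _ r1 s1) _.
have -> : 6 * enorm (x - z) * (1 - enorm y ^+ 2) ^+ (n - 1) *
      (green_majorant x y + green_majorant z y) =
    6 * enorm (x - z) * (1 - enorm y ^+ 2) / bracket x y ^+ 2 *
      green_density n (mobius_abs x y) +
    6 * enorm (z - x) * (1 - enorm y ^+ 2) / bracket z y ^+ 2 *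
      green_density n (mobius_abs z y).
  have E1 := green_density_majorantE xB yB xy.
  have E2 := green_density_majorantE zB yB zy.
  by rewrite mulrDr -!(mulrA (6 * _)) -E1 -E2 (enorm_distC z) !mulrA.
rewrite mulrDr; apply: lerD; rewrite ler_wpM2r//.
  exact: mobius_abs_dist_le.
by rewrite distrC; apply: mobius_abs_dist_le; rewrite // enorm_distC.
Qed.

Lemma measurable_enorm_distl (D : set 'rV[R]_n) x :
  measurable D -> measurable_fun D (fun y => enorm (x - y)).
Proof.
move=> mD; apply: (eq_measurable_fun (fun y => enorm (y - x))).
  by move=> y _; rewrite enorm_distC.
exact: measurable_enorm_dist.
Qed.

Lemma measurable_one_sub_sqr (D : set 'rV[R]_n) :
  measurable D -> measurable_fun D (fun y => 1 - enorm y ^+ 2).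
Proof.
move=> mD; apply: measurable_funB => //; apply: measurable_funX.
by apply: measurable_funS measurable_enorm.
Qed.

Lemma measurable_bracket (D : set 'rV[R]_n) x :
  measurable D -> measurable_fun D (bracket x).
Proof.
move=> mD; apply: (@measurableT_comp _ _ _ _ _ _ (@Num.sqrt R)).
  by apply: continuous_measurable_fun; exact: sqrt_continuous.
apply: measurable_funD; first by apply: measurable_funX; exact: measurable_enorm_distl.
by apply: measurable_funM => //; exact: measurable_one_sub_sqr.
Qed.

Lemma measurable_mobius_abs (D : set 'rV[R]_n) x :
  measurable D -> measurable_fun D (mobius_abs x).
Proof.
move=> mD; apply: measurable_funM; first exact: measurable_enorm_distl.
by apply: measurable_funVr; exact: measurable_bracket.
Qed.

Lemma measurable_green_majorant (D : set 'rV[R]_n) x :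
  measurable D -> measurable_fun D (green_majorant x).
Proof.
move=> mD; apply: measurable_funM => //.
apply/measurable_funVr/measurable_funX/measurable_funM.
  exact: measurable_bracket.
exact: measurable_enorm_distl.
Qed.

Lemma measurable_green_kernel (D : set 'rV[R]_n) x :
  measurable D -> D `<=` eball `\ x -> eball x ->
  measurable_fun D (green_kernel x).
Proof.
move=> mD DB xB; apply: measurable_funM => //.
apply: measurable_green_profile => //; first exact: measurable_mobius_abs.
by move=> y /DB[yB /eqP yx]; apply: mobius_abs01; rewrite // eq_sym.
Qed.

(** With [d = 1 - |x|], the bracket dominates both [d] and [|x - y|]. For
[|x - y| <= d] the majorant is at most a multiple of [d^-1 |x - y|^(1 - n)], and for
[|x - y| > d] at most a multiple of [d^(n - 2) |x - y|^(2 - 2 n)]; both integrate to a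
constant independent of [d], the second one because [2 n - 2 > n]. *)
Lemma integral_green_majorant_le : exists2 C : R, 0 <= C & forall x, eball x ->
  (\int[@ball_measure R n]_(y in eball `\ x) (green_majorant x y)%:E <= C%:E)%E.
Proof.
pose A : R := @ball_scale R n * 2 ^+ n.
have A0 : 0 <= A by rewrite mulr_ge0 ?ball_scale_ge0 ?exprn_ge0.
pose C := 2 ^+ (n - 2) * (A * 2 ^+ n) + 2 ^+ (n - 2) * (A * 2 ^+ n.+1).
exists C; first by apply: addr_ge0; apply: mulr_ge0; rewrite ?exprn_ge0// mulr_ge0 ?exprn_ge0.
move=> x xB; pose d := 1 - enorm x.
have d0 : 0 < d by rewrite subr_gt0.
have ed : 1 - enorm x ^+ 2 <= 2 * d.
  by rewrite /d; move: xB (enorm_ge0 x); rewrite /eball/=; nra.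
have e0 := one_sub_sqr_gt0 xB.
have mB := @measurable_eball R n; have mx := measurable_set1_rV x.
pose rho y := enorm (y - x).
pose D1 := (eball `\ x) `&` [set y | rho y <= d].
pose D2 := eball `&` [set y | d < rho y].
have mD : measurable (eball `\ x) by exact: measurableD.
have mD1 : measurable D1.
  by apply: measurable_sublevel => //; exact: measurable_enorm_dist.
have mD2 : measurable D2.
  rewrite (_ : D2 = eball `\` [set y | rho y <= d]).
    by apply: measurableD => //; exact: measurable_cball.
  apply/seteqP; split=> y /= [yB]; first by move=> yd; split=> //; apply/negP; rewrite -ltNge.
  by move=> /negP; rewrite -ltNge => yd; split.
have DE : eball `\ x = D1 `|` D2.
  apply/seteqP; split=> y.
    move=> [yB yx]; have [yd|yd] := leP (rho y) d; first by left.
    by right.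
  move=> [[//]|[yB /= yd]]; split=> // yx; move: yd.
  by rewrite /rho yx subrr enorm0 ltNge ltW.
have Ball (D : set _) s : D `<=` eball -> measurable D -> 0 <= s ->
   (@ball_measure R n (D `&` [set y | (rho y <= s)%R]) <= (A * s ^+ n)%:E)%E.
  move=> DB mD' s0; apply: le_trans (ball_measure_cball_le x s0).
  apply: le_measure; rewrite ?inE; last exact: subIsetr.
    by apply: measurable_sublevel => //; exact: measurable_enorm_dist.
  exact: measurable_cball.
have K0 y : eball y -> (0 <= (green_majorant x y)%:E)%E.
  by move=> yB; rewrite lee_fin green_majorant_ge0.
rewrite DE ge0_integral_setU//; last 3 first.
- by apply/measurable_EFinP; apply: measurable_green_majorant; rewrite -DE.
- by move=> y; rewrite -DE => -[/K0].
- apply/disj_setPS => y [[_ /= y1] [_ /=]]; first by rewrite ltNge y1.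
rewrite EFinD; apply: leeD.
- have F : (\int[@ball_measure R n]_(y in D1) ((rho y ^- (n - 1))%:E) <=
      (A * 2 ^+ (n - 1).+1 * d ^+ (n - (n - 1)))%:E)%E.
    apply: integral_near_decay => //.
    + exact: measurable_enorm_dist.
    + by rewrite subn1 ltn_predL (leq_trans _ n_ge3).
    + move=> y [[_ /eqP yx] yd]; rewrite yd andbT /rho.
      by rewrite enorm_gt0 subr_eq0.
    + by move=> s s0; apply: Ball => //; [move=> y [[]]|exact: ltW].
  apply: (@le_trans _ _ (\int[@ball_measure R n]_(y in D1)
     ((2 ^+ (n - 2) / d)%:E * (rho y ^- (n - 1))%:E)))%E.
    apply: ge0_le_integral => //.
    + by move=> y [[/K0]].
    + by apply/measurable_EFinP; exact: measurable_green_majorant.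
    + apply/measurable_EFinP/measurable_funM => //.
      by apply: measurable_funVr; apply: measurable_funX; exact: measurable_enorm_dist.
    + move=> y [[yB /eqP yx] yd]; rewrite -EFinM lee_fin.
      have r0 : 0 < rho y by rewrite enorm_gt0 subr_eq0.
      have B0 := bracket_gt0 xB yB.
      rewrite /green_majorant enorm_distC exprMn.
      have -> : 2 ^+ (n - 2) / d * rho y ^- (n - 1) =
         (2 * d) ^+ (n - 2) / (d ^+ (n - 1) * rho y ^+ (n - 1)).
        have -> : (n - 1 = (n - 2).+1)%N by move: n_ge3; case: n => [|[|[|]]].
        rewrite exprMn (exprS d).
        by field; rewrite !expf_neq0 ?gt_eqF.
      apply: ler_pM.
      * by rewrite exprn_ge0// ltW.
      * by rewrite invr_ge0 mulr_ge0 ?exprn_ge0 ?bracket_ge0 ?enorm_ge0.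
      * by rewrite lerXn2r// nnegrE ?mulr_ge0 ?ltW.
      * rewrite lef_pV2 ?posrE ?mulr_gt0 ?exprn_gt0//.
        rewrite ler_wpM2r ?exprn_ge0 ?enorm_ge0//.
        by apply: lerXn2r; rewrite ?nnegrE ?(ltW d0) ?bracket_ge0// bracket_ge_bdist.
  rewrite ge0_integralZl//; last 3 first.
  + apply/measurable_EFinP.
    by apply: measurable_funVr; apply: measurable_funX; exact: measurable_enorm_dist.
  + by move=> y _; rewrite lee_fin invr_ge0 exprn_ge0// enorm_ge0.
  + by rewrite lee_fin divr_ge0 ?exprn_ge0 ?ltW.
  apply: le_trans (lee_wpmul2l _ F) _.
    by rewrite lee_fin divr_ge0 ?exprn_ge0 ?ltW.
  rewrite -EFinM lee_fin.
  have -> : (n - (n - 1) = 1)%N by move: n_ge3; case: n => // k; rewrite subn1 subSnn.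
  have -> : (n - 1).+1 = n by move: n_ge3; case: n => // k; rewrite subn1.
  by rewrite expr1 le_eqVlt; apply/orP; left; apply/eqP; field; rewrite gt_eqF.
- have F : (\int[@ball_measure R n]_(y in D2) ((rho y ^- (2 * (n - 1)))%:E) <=
      (A * 2 ^+ n.+1 / d ^+ (2 * (n - 1) - n))%:E)%E.
    apply: integral_far_decay => //.
    + exact: measurable_enorm_dist.
    + by move: n_ge3; lia.
    + by move=> y [_ /ltW].
    + by move=> s s0; apply: Ball => //; [move=> y []|exact: le_trans (ltW d0) s0].
  apply: (@le_trans _ _ (\int[@ball_measure R n]_(y in D2)
     (((2 * d) ^+ (n - 2))%:E * (rho y ^- (2 * (n - 1)))%:E)))%E.
    apply: ge0_le_integral => //.
    + by move=> y [/K0].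
    + by apply/measurable_EFinP; exact: measurable_green_majorant.
    + apply/measurable_EFinP/measurable_funM => //.
      by apply: measurable_funVr; apply: measurable_funX; exact: measurable_enorm_dist.
    + move=> y [yB yd]; rewrite -EFinM lee_fin.
      have r0 : 0 < rho y by exact: lt_trans yd.
      have B0 := bracket_gt0 xB yB.
      rewrite /green_majorant exprM -/(rho y) enorm_distC.
      apply: ler_pM.
      * by rewrite exprn_ge0// ltW.
      * by rewrite invr_ge0 exprn_ge0 ?mulr_ge0 ?bracket_ge0 ?enorm_ge0.
      * by rewrite lerXn2r// nnegrE ?mulr_ge0 ?ltW.
      * rewrite lef_pV2 ?posrE ?exprn_gt0 ?mulr_gt0//.
        apply: lerXn2r; rewrite ?nnegrE ?exprn_ge0 ?mulr_ge0 ?bracket_ge0 ?enorm_ge0//.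
        by rewrite expr2 ler_wpM2r ?enorm_ge0// /rho enorm_distC bracket_ge_dist.
  rewrite ge0_integralZl//; last 3 first.
  + apply/measurable_EFinP.
    by apply: measurable_funVr; apply: measurable_funX; exact: measurable_enorm_dist.
  + by move=> y _; rewrite lee_fin invr_ge0 exprn_ge0// enorm_ge0.
  + by rewrite lee_fin exprn_ge0 ?mulr_ge0 ?ltW.
  apply: le_trans (lee_wpmul2l _ F) _.
    by rewrite lee_fin exprn_ge0 ?mulr_ge0 ?ltW.
  rewrite -EFinM lee_fin.
  have -> : (2 * (n - 1) - n = n - 2)%N.
    by move: n_ge3; lia.
  rewrite exprMn le_eqVlt; apply/orP; left; apply/eqP.
  by field; rewrite expf_neq0 ?gt_eqF.
Qed.

End green_majorant.

(** * Displacement of the Green potential *)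

Section green_potential.
Context {R : realType} {n : nat}.
Hypothesis n_ge3 : (3 <= n)%N.
Implicit Types (x y z : 'rV[R]_n).
Local Notation nu := (@ball_measure R n).

Variables (M : R) (psi : 'rV[R]_n -> 'rV[R]_n) (i : 'I_n).
Hypothesis M_ge0 : 0 <= M.
Hypothesis cpsi : {within eball, continuous psi}.
Hypothesis psi_le : forall x, eball x -> enorm (psi x) <= M * (1 - enorm x ^+ 2).

Let F x y := green_kernel x y * psi y ord0 i * tau_density y.

Let psi_tau_le y (a k : R) : eball y ->
  `|a| <= (1 - enorm y ^+ 2) ^+ (n - 1) * k ->
  `|a * psi y ord0 i * tau_density y| <= M * k.
Proof.
move=> yB ak; have f0 := one_sub_sqr_gt0 yB.
rewrite !normrM /tau_density (gtr0_norm (_ : 0 < _ ^- n)) ?invr_gt0 ?exprn_gt0//.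
rewrite ler_pdivrMr ?exprn_gt0//.
have -> : M * k * (1 - enorm y ^+ 2) ^+ n =
    ((1 - enorm y ^+ 2) ^+ (n - 1) * k) * (M * (1 - enorm y ^+ 2)).
  have -> : (1 - enorm y ^+ 2) ^+ n =
      (1 - enorm y ^+ 2) ^+ (n - 1) * (1 - enorm y ^+ 2).
    by rewrite -exprSr; congr (_ ^+ _); move: n_ge3; lia.
  by ring.
by apply: ler_pM => //; apply: le_trans (enorm_coord _ _) (psi_le yB).
Qed.

Let measurable_psi (D : set 'rV[R]_n) : measurable D -> D `<=` eball ->
  measurable_fun D (fun y => psi y ord0 i).
Proof.
move=> mD DB; apply: (measurable_funS (@measurable_eball R n) DB).
apply: within_continuous_measurable_rV; first exact: measurable_eball.
move=> y; apply: (@continuous_comp (subspace eball) _ _ psi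
  (fun v : 'rV[R]_n => v ord0 i)); [exact: cpsi|exact: coord_continuous].
Qed.

Let measurable_tau (D : set 'rV[R]_n) : measurable D ->
  measurable_fun D (@tau_density R n).
Proof.
move=> mD; apply: measurable_funVr; apply: measurable_funX.
exact: measurable_one_sub_sqr.
Qed.

Let measurable_F (D : set 'rV[R]_n) x : measurable D -> D `<=` eball `\ x ->
  eball x -> measurable_fun D (F x).
Proof.
move=> mD DB xB; apply: measurable_funM; last exact: measurable_tau.
apply: measurable_funM; first exact: measurable_green_kernel.
by apply: measurable_psi => // y /DB[].
Qed.

Let F_le x y : eball x -> (eball `\ x) y -> `|F x y| <= M * green_majorant x y.
Proof.
move=> xB [yB /eqP yx]; apply: psi_tau_le => //; apply: green_kernel_le => //.
by rewrite eq_sym.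
Qed.

Let mDx x : measurable ((@eball R n) `\ x).
Proof.
by apply: measurableD; [exact: measurable_eball|exact: measurable_set1_rV].
Qed.

Let integral_scaled_majorant (D : set 'rV[R]_n) x C c : 0 <= c -> eball x ->
  measurable D -> D `<=` eball `\ x ->
  (\int[nu]_(y in eball `\ x) (green_majorant x y)%:E <= C%:E)%E ->
  (\int[nu]_(y in D) (c * green_majorant x y)%:E <= (c * C)%:E)%E.
Proof.
move=> c0 xB mD DB KC.
have K0 y : (eball `\ x) y -> (0 <= (green_majorant x y)%:E)%E.
  by move=> [yB _]; rewrite lee_fin green_majorant_ge0.
under eq_integral do rewrite EFinM.
rewrite ge0_integralZl ?lee_fin//; last 2 first.
- by apply/measurable_EFinP; exact: measurable_green_majorant.
- by move=> y /DB/K0.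
rewrite EFinM lee_wpmul2l ?lee_fin//; apply: le_trans KC.
apply: ge0_subset_integral => //.
by apply/measurable_EFinP; exact: measurable_green_majorant.
Qed.

Let green_integrandE x C (D : set 'rV[R]_n) : eball x ->
  (\int[nu]_(y in eball `\ x) (green_majorant x y)%:E <= C%:E)%E ->
  measurable D -> nu D = 0%E ->
  green_integral psi x ord0 i = \int[nu]_(y in eball `\` D) F x y.
Proof.
move=> xB KC mD D0; rewrite mxE; congr fine.
have mFB : measurable_fun eball (F x).
  have mx := measurable_set1_rV x.
  apply: (@measurable_funS _ _ _ _ ((eball `\ x) `|` [set x])).
  - exact: measurableU.
  - move=> y yB; have [->|/eqP yx] := eqVneq y x; first by right.
    by left.
  - apply/measurable_funU => //; split; first exact: measurable_F.
    exact: measurable_fun_set1.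
apply: negligible_integral => //; first exact: measurable_eball.
apply/integrableP; split; first exact/measurable_EFinP.
rewrite (@ge0_negligible_integral _ _ _ nu eball [set x])//; last first.
- by apply: ball_measure_set1; apply: leq_trans n_ge3.
- by apply: measurableT_comp => //; exact/measurable_EFinP.
- exact: measurable_eball.
- exact: measurable_set1_rV.
apply: (@le_lt_trans _ _ (M * C)%:E); last by rewrite ltry.
apply: le_trans (integral_scaled_majorant M_ge0 xB (mDx x) _ KC) => //.
apply: ge0_le_integral => //.
- by apply: measurableT_comp => //; apply/measurable_EFinP; exact: measurable_F.
- apply/measurable_EFinP; apply: measurable_funM => //.
  exact: measurable_green_majorant.
- by move=> y /(F_le xB); rewrite /= lee_fin.
Qed.

(** At [y = x] or [y = z] one of the kernels has a junk value, so the comparison of the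
kernels is integrated over the ball deprived of these two points. *)
Lemma green_integral_dist_le (C : R) x z : eball x -> eball z ->
  (forall x, eball x ->
     (\int[nu]_(y in eball `\ x) (green_majorant x y)%:E <= C%:E)%E) ->
  enorm (x - z) <= 1 - enorm x -> enorm (x - z) <= 1 - enorm z ->
  `|green_integral psi x ord0 i - green_integral psi z ord0 i| <=
    12 * C * M * enorm (x - z).
Proof.
move=> xB zB KC hx hz; pose N : set 'rV[R]_n := [set x] `|` [set z].
have n0 : (0 < n)%N by exact: leq_trans n_ge3.
have mN : measurable N by apply: measurableU; exact: measurable_set1_rV.
have N0 : nu N = 0%E.
  have Nw w : nu [set w] = 0%E by exact: ball_measure_set1.
  apply/eqP; rewrite eq_le measure_ge0 andbT.
  apply: le_trans (measureU2 _ (measurable_set1_rV x) (measurable_set1_rV z)) _.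
  by rewrite [X in (X + _)%E]Nw [X in (_ + X)%E]Nw adde0.
have Ex := @green_integrandE x C N xB (KC _ xB) mN N0.
have Ez := @green_integrandE z C N zB (KC _ zB) mN N0.
rewrite [X in `|X - _|]Ex [X in `|_ - X|]Ez.
have mD : measurable (eball `\` N) by apply: measurableD => //; exact: measurable_eball.
have Dx : eball `\` N `<=` eball `\ x.
  by move=> y [yB yN]; split=> // yx; apply: yN; left.
have Dz : eball `\` N `<=` eball `\ z.
  by move=> y [yB yN]; split=> // yx; apply: yN; right.
have mK w : measurable_fun (eball `\` N) (fun y => M * green_majorant w y).
  by apply: measurable_funM => //; exact: measurable_green_majorant.
have Fi w : eball w -> eball `\` N `<=` eball `\ w ->
    nu.-integrable (eball `\` N) (EFin \o F w).
  move=> wB Dw; apply: (integrable_dominated mD _ _ (mK w)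
    (integral_scaled_majorant M_ge0 wB mD Dw (KC _ wB))).
  - exact: measurable_F.
  - by move=> y /Dw; exact: F_le.
rewrite -RintegralB//; [|exact: Fi|exact: Fi].
pose h := enorm (x - z).
have h0 : 0 <= 6 * h * M by rewrite !mulr_ge0 ?enorm_ge0.
apply: (@Rintegral_norm_le _ _ _ _ _ _ (fun y =>
   6 * h * M * green_majorant x y + 6 * h * M * green_majorant z y)) => //.
- by apply: measurable_funB; exact: measurable_F.
- move=> y Dy; have [yB /eqP yx] := Dx _ Dy; have [_ /eqP yz] := Dz _ Dy.
  have E (a b : R) : 6 * h * M * a + 6 * h * M * b = M * (6 * h * (a + b)) by ring.
  rewrite [leRHS]E /F -[X in `|X|]mulrBl -[X in `|X * _|]mulrBl.
  apply: psi_tau_le => //.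
  have xy : x != y by rewrite eq_sym.
  have zy : z != y by rewrite eq_sym.
  apply: le_trans (green_kernel_dist_le n_ge3 xB zB yB xy zy hx hz) _.
  have E' (a b c : R) : 6 * a * b * c = b * (6 * a * c) by ring.
  by rewrite [leLHS]E'.
- by apply: measurable_funD; apply: measurable_funM => //;
    exact: measurable_green_majorant.
under eq_integral do rewrite EFinD.
have K0 w y : eball w -> (eball `\` N) y -> (0 <= (6 * h * M * green_majorant w y)%:E)%E.
  by move=> wB [yB _]; rewrite lee_fin mulr_ge0// green_majorant_ge0.
rewrite ge0_integralD//; last 4 first.
- by move=> y; exact: K0.
- apply/measurable_EFinP; apply: measurable_funM => //.
  exact: measurable_green_majorant.
- by move=> y; exact: K0.
- apply/measurable_EFinP; apply: measurable_funM => //.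
  exact: measurable_green_majorant.
have -> : 12 * C * M * enorm (x - z) = 6 * h * M * C + 6 * h * M * C.
  by rewrite /h; ring.
rewrite EFinD; apply: leeD.
  exact: (integral_scaled_majorant h0 xB mD Dx (KC _ xB)).
exact: (integral_scaled_majorant h0 zB mD Dz (KC _ zB)).
Qed.

End green_potential.

(** * Integration along coordinate lines *)

Section coordinate_lines.
Context {R : realType}.
Local Notation mu := (@lebesgue_measure R).

Definition rV_upd n (y : 'rV[R]_n) (i : 'I_n) (z : R) : 'rV[R]_n :=
  \row_j (if j == i then z else y ord0 j).

Definition supported_in_cube n (f : 'rV[R]_n -> R) : Prop :=
  forall y, f y != 0 -> forall i, `|y ord0 i| <= 1.

Lemma integrable_bounded_cube n (f : 'rV[R]_n -> R) (C : R) :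
  measurable_fun setT f -> (forall y, `|f y| <= C) -> supported_in_cube f ->
  (lebesgue_rV n).-integrable setT (EFin \o f).
Proof.
move=> mf fC fs.
pose I (i : 'I_n) : set R := `[-1, 1]%classic.
have mI i : measurable (I i) by exact: measurable_itv.
pose Q := [set y : 'rV[R]_n | forall i, I i (y ord0 i)].
have mQ : measurable Q by exact: (measurable_box mI).
have mc : measurable_fun setT (fun y => C * \1_Q y).
  by apply: measurable_funM => //; exact: measurable_indic.
have C0 : 0 <= C by apply: le_trans (fC 0).
apply: (@integrable_dominated _ _ _ _ _ _ (fun y => C * \1_Q y)
  (C * 2 ^+ n)) => //.
- move=> y _; rewrite indicE.
  have [->|/fs H] := eqVneq (f y) 0; first by rewrite normr0 mulr_ge0.
  by rewrite mem_set ?mulr1// => i; rewrite /I/= in_itv/= -ler_norml H.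
- under eq_integral do rewrite EFinM.
  rewrite ge0_integralZl ?lee_fin//; last first.
    by apply/measurable_EFinP; exact: measurable_indic.
  rewrite integral_indic// setIT EFinM lee_wpmul2l ?lee_fin//.
  rewrite [leLHS](lebesgue_rV_box mI).
  rewrite (eq_bigr (fun=> (2 : R)%:E)); last first.
    move=> i _; rewrite /I lebesgue_measure_itv/= lte_fin gtrN//.
    by rewrite -EFinB; congr EFin; ring.
  by rewrite prodEFin prodr_const card_ord.
Qed.

(** [lebesgue_rV n.+1] is by definition the image of the product measure under
[rV_cons]. *)
Lemma integral_lebesgue_rVS n (f : 'rV[R]_n.+1 -> R) (C : R) :
  measurable_fun setT f -> (forall y, `|f y| <= C) -> supported_in_cube f ->
  (mu \x lebesgue_rV n)%E.-integrable setT (EFin \o (f \o @rV_cons R n)) /\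
  (\int[lebesgue_rV n.+1]_y (f y)%:E =
   \int[(mu \x lebesgue_rV n)%E]_p (f (rV_cons p))%:E)%E.
Proof.
move=> mf fC fs; have fi := integrable_bounded_cube mf fC fs.
have mfc : measurable_fun setT (f \o @rV_cons R n).
  by apply: measurableT_comp => //; exact: measurable_rV_cons.
have ci : (mu \x lebesgue_rV n)%E.-integrable setT (EFin \o (f \o @rV_cons R n)).
  apply/integrableP; split; first exact/measurable_EFinP.
  move/integrableP: fi => [_]; apply: le_lt_trans.
  rewrite -[leRHS]/(\int[pushforward (mu \x lebesgue_rV n)%E (@rV_cons R n)]_y
    `|(f y)%:E|)%E.
  rewrite ge0_integral_pushforward//; first exact: measurable_rV_cons.
  by apply: measurableT_comp => //; exact/measurable_EFinP.
split=> //.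
rewrite -[LHS]/(\int[pushforward (mu \x lebesgue_rV n)%E (@rV_cons R n)]_y
    (f y)%:E)%E.
rewrite integral_pushforward//; first exact: measurable_rV_cons.
exact/measurable_EFinP.
Qed.

Lemma rV_upd_cons0 n (z' z : R) (v : 'rV[R]_n) :
  rV_upd (rV_cons (z', v)) ord0 z = rV_cons (z, v).
Proof.
apply/rowP => j; rewrite mxE.
have [->|j0] := eqVneq j ord0; first by rewrite rV_cons0.
by case: (unliftP ord0 j) j0 => [k ->|->]; rewrite ?eqxx// !rV_consS.
Qed.

Lemma rV_upd_consS n (z' z : R) (v : 'rV[R]_n) i :
  rV_upd (rV_cons (z', v)) (lift ord0 i) z = rV_cons (z', rV_upd v i z).
Proof.
apply/rowP => j; rewrite mxE.
case: (unliftP ord0 j) => [k ->|->]; last by rewrite !rV_cons0.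
by rewrite (inj_eq lift_inj) !rV_consS mxE.
Qed.

(** Fubini: [lebesgue_rV n.+1] splits off the first coordinate, so the coordinate [i]
is either the one integrated first or is handled by induction in the fibres. Bounded
functions supported in a cube form a class stable under taking such fibres. *)
Lemma integral_rV_lines_eq0 n (f : 'rV[R]_n -> R) (i : 'I_n) (C : R) :
  measurable_fun setT f -> (forall y, `|f y| <= C) -> supported_in_cube f ->
  (forall y, \int[mu]_z (f (rV_upd y i z))%:E = 0)%E ->
  (\int[lebesgue_rV n]_y (f y)%:E = 0)%E.
Proof.
elim: n f i => [f []//|n IH f i mf fC fs f0].
have [ci ->] := integral_lebesgue_rVS mf fC fs.
case: (unliftP ord0 i) f0 => [j ->|->] f0.
  rewrite -(@integral12_prod_meas1 _ _ _ _ _ _ _ _ ci).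
  rewrite /fubini_F; apply: integral0_eq => z _ /=.
  apply: (IH (fun v => f (rV_cons (z, v))) j).
  - apply: (measurableT_comp mf).
    apply: (measurableT_comp (@measurable_rV_cons R n)).
    by apply: measurable_fun_pair; [exact: measurable_cst|exact: measurable_id].
  - by move=> v; exact: fC.
  - by move=> v /fs H k; have := H (lift ord0 k); rewrite rV_consS.
  - by move=> v; have := f0 (rV_cons (z, v)); under eq_integral do rewrite rV_upd_consS.
rewrite -(@integral21_prod_meas1 _ _ _ _ _ _ _ _ ci).
rewrite /fubini_G; apply: integral0_eq => v _ /=.
by have := f0 (rV_cons (0, v)); under eq_integral do rewrite rV_upd_cons0.
Qed.

End coordinate_lines.

(** * Zonal tangential fields in the ball *)

Lemma is_derive1_exprn (R : realType) (f : R -> R) (k : nat) (x df : R) :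
  is_derive x 1 f df ->
  is_derive x 1 (fun z => f z ^+ k) (k%:R * f x ^+ k.-1 * df).
Proof.
move=> dfx; rewrite (_ : (fun _ => _) = f ^+ k); first exact: is_deriveX.
by rewrite exprfctE.
Qed.

Lemma is_derive1_continuous (R : realType) (f : R -> R) (x df : R) :
  is_derive x 1 f df -> {for x, continuous f}.
Proof.
move=> fx; apply: differentiable_continuous; apply/derivable1_diffP.
exact: ex_derive.
Qed.

Section zonal_field_on_line.
Context {R : realType}.
Local Notation mu := (@lebesgue_measure R).
Variables (q q' : R -> R) (m : nat).
Hypothesis dq : forall t : R, `|t| <= 1 -> is_derive t 1 q (q' t).
Hypothesis cq' : forall t : R, `|t| <= 1 -> {for t, continuous q'}.

(** One coordinate of the field [(1 - |y|^(2 m + 2)) q(t) (|y| e - t y)], with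
[t = e . y / |y|], as a function of [rho = |y|], of [t], and of the coordinates [e] and
[x] of the vectors [e] and [y]. The field is tangent to the spheres centred at 0,
extends by 0 at the origin, and vanishes on the unit sphere. *)
Definition zonal_comp (rho t e x : R) : R :=
  (1 - (rho ^+ 2) ^+ m.+1) * q t * (rho * e - t * x).

(** The derivative of [zonal_comp] in the direction of that coordinate, written with
[rho^-1] only through [x / rho] and [(rho e - t x) / rho], which stay bounded. *)
Definition zonal_deriv (rho t e x : R) : R :=
  - (2 * m.+1%:R * (rho ^+ 2) ^+ m * x) * q t * (rho * e - t * x) +
  (1 - (rho ^+ 2) ^+ m.+1) *
    (q' t * ((rho * e - t * x) / rho) ^+ 2 +
     q t * (e * (x / rho) - t - (x / rho) * ((rho * e - t * x) / rho))).

(* on a line parallel to a coordinate axis, [|y|^2 = z^2 + c2] and [e . y = a z + b] *)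
Variables (c2 a b : R).
Hypothesis c2_gt0 : 0 < c2.
Let rho (z : R) := Num.sqrt (z ^+ 2 + c2).
Let s (z : R) := a * z + b.
Let t (z : R) := s z / rho z.
Hypothesis t_le1 : forall z, `|t z| <= 1.

Let r2_gt0 z : 0 < z ^+ 2 + c2.
Proof. by rewrite ltr_wpDl// sqr_ge0. Qed.

Let rho_gt0 z : 0 < rho z.
Proof. by rewrite sqrtr_gt0. Qed.

Let drho (z : R) : is_derive z 1 rho (z / rho z).
Proof.
have d2 : is_derive z 1 (fun z : R => z ^+ 2 + c2) (2 * z).
  by apply: is_derive_eq; rewrite /GRing.scale/=; ring.
have ds := is_derive1_sqrt (r2_gt0 z).
have dd : is_derive z 1 rho ((2 * rho z)^-1 * (2 * z)).
  exact: (@is_derive1_comp _ Num.sqrt (fun z : R => z ^+ 2 + c2) z _ _ ds d2).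
apply: (is_derive_eq dd).
rewrite /GRing.scale/=.
by field; rewrite gt_eqF.
Qed.

Let dt (z : R) : is_derive z 1 t ((rho z * a - t z * z) / rho z / rho z).
Proof.
have ds : is_derive z 1 s a.
  by apply: is_derive_eq; rewrite /GRing.scale/=; ring.
have dr := drho z.
have r0 : rho z != 0 by rewrite gt_eqF.
have dv : is_derive z 1 (fun z => (rho z)^-1) (- (rho z) ^- 2 * (z / rho z)).
  exact: is_deriveV.
have dd : is_derive z 1 t (s z *: (- (rho z) ^- 2 * (z / rho z)) + (rho z)^-1 *: a).
  exact: (is_deriveM ds dv).
apply: (is_derive_eq dd).
by rewrite /t /GRing.scale/=; field.
Qed.

Let phi (z : R) := zonal_comp (rho z) (t z) a z.
Let dphi (z : R) := zonal_deriv (rho z) (t z) a z.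

Let dphiE (z : R) : is_derive z 1 phi (dphi z).
Proof.
have r0 : rho z != 0 by rewrite gt_eqF.
have dr := drho z; have dtz := dt z; have dqz := dq (t_le1 z).
have d1 : is_derive z 1 (fun z => rho z * a - t z * z)
    (a * (z / rho z) - (t z + z * ((rho z * a - t z * z) / rho z / rho z))).
  apply: is_derive_eq.
  by rewrite /GRing.scale/=; ring.
have d2 : is_derive z 1 (q \o t) ((rho z * a - t z * z) / rho z / rho z * q' (t z)).
  by apply: (is_derive_eq (@is_derive1_comp _ q t z _ _ dqz dtz)); rewrite mulrC.
have d3 : is_derive z 1 (fun z => 1 - (rho z ^+ 2) ^+ m.+1)
   (- (2 * m.+1%:R * (rho z ^+ 2) ^+ m * z)).
  have e1 : is_derive z 1 (fun z => rho z ^+ 2)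
      (2%:R * rho z ^+ 1 * (z / rho z)) by exact: is_derive1_exprn.
  have e2 : is_derive z 1 (fun z => (rho z ^+ 2) ^+ m.+1)
      (m.+1%:R * (rho z ^+ 2) ^+ m * (2%:R * rho z ^+ 1 * (z / rho z))).
    exact: (is_derive1_exprn m.+1 e1).
  apply: (is_derive_eq (is_deriveB (is_derive_cst (1 : R) z 1) e2)).
  rewrite /GRing.scale/=.
  by move: ((rho z ^+ 2) ^+ m) => u; field.
apply: (is_derive_eq (is_deriveM (is_deriveM d3 d2) d1)).
rewrite /dphi /zonal_deriv /GRing.scale/=.
rewrite mulrfctE /=.
move: ((rho z ^+ 2) ^+ m.+1) ((rho z ^+ 2) ^+ m) (q (t z)) (q' (t z)) r0.
by move: (rho z) (t z) => r u g g' k k' r0; field.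
Qed.

Let dphi_continuous (z : R) : {for z, continuous dphi}.
Proof.
have cr : {for z, continuous rho} := is_derive1_continuous (drho z).
have ct : {for z, continuous t} := is_derive1_continuous (dt z).
have cqt : {for z, continuous (q \o t)}.
  by apply: continuous_comp => //; exact: is_derive1_continuous (dq (t_le1 z)).
have cqt' : {for z, continuous (q' \o t)}.
  by apply: continuous_comp => //; exact: cq'.
have crV : {for z, continuous (fun z => (rho z)^-1)}.
  by apply: cvgV => //; rewrite gt_eqF.
have cz : {for z, continuous (fun z : R => z)} by exact: cvg_id.
have cc (k : R) : {for z, continuous (fun=> k)} by exact: cvg_cst.
have cX (f : R -> R) k : {for z, continuous f} ->
    {for z, continuous (fun z => f z ^+ k)}.
  by move=> cf; apply: (@continuous_comp _ _ _ f (fun y => y ^+ k)) => //;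
    exact: exprn_continuous.
have cM (f g : R -> R) : {for z, continuous f} -> {for z, continuous g} ->
    {for z, continuous (fun z => f z * g z)} by move=> cf cg; exact: cvgM.
have cB (f g : R -> R) : {for z, continuous f} -> {for z, continuous g} ->
    {for z, continuous (fun z => f z - g z)} by move=> cf cg; exact: cvgB.
have cD (f g : R -> R) : {for z, continuous f} -> {for z, continuous g} ->
    {for z, continuous (fun z => f z + g z)} by move=> cf cg; exact: cvgD.
have cN (f : R -> R) : {for z, continuous f} ->
    {for z, continuous (fun z => - f z)} by move=> cf; exact: cvgN.
have cw : {for z, continuous (fun z : R => rho z * a - t z * z)}.
  exact: cB _ _ (cM _ _ cr (cc a)) (cM _ _ ct cz).
have cxr : {for z, continuous (fun z : R => z / rho z)} by exact: cM _ _ cz crV.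
have cwr : {for z, continuous (fun z : R => (rho z * a - t z * z) / rho z)}.
  exact: cM _ _ cw crV.
have cg k : {for z, continuous (fun z : R => (rho z ^+ 2) ^+ k)}.
  exact: (cX (fun z : R => rho z ^+ 2) k (cX rho 2%N cr)).
exact: (cD _ _
  (cM _ _ (cM _ _ (cN _ (cM _ _ (cM _ _ (cc (2 * m.+1%:R)) (cg m)) cz)) cqt) cw)
  (cM _ _ (cB _ _ (cc 1) (cg m.+1))
    (cD _ _ (cM _ _ cqt' (cX _ 2%N cwr))
      (cM _ _ cqt (cB _ _ (cB _ _ (cM _ _ (cc a) cxr) ct) (cM _ _ cxr cwr)))))).
Qed.

(** Fundamental theorem of calculus on the chord cut by the ball: the field vanishes
at both ends, and [c2 > 0] keeps the chord away from the origin. *)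
Lemma integral_zonal_deriv_line : c2 < 1 ->
  (\int[mu]_(z in [set z : R | (z ^+ 2 + c2 < 1)%R]) (dphi z)%:E = 0)%E.
Proof.
move=> c21; pose A := Num.sqrt (1 - c2).
have A0 : 0 < A by rewrite sqrtr_gt0 subr_gt0.
have A2 : A ^+ 2 = 1 - c2 by rewrite sqr_sqrtr// subr_ge0 ltW.
have -> : [set z : R | z ^+ 2 + c2 < 1] = `]-A, A[%classic.
  apply/seteqP; split=> z /=; rewrite in_itv/= -ltr_norml -ltrBrDr -A2;
    by rewrite -real_normK ?num_real// ltr_pXn2r ?nnegrE ?(ltW A0).
have mphi (D : set R) : measurable D -> measurable_fun D (EFin \o dphi).
  move=> mD; apply/measurable_EFinP.
  apply: (measurable_funS measurableT) => //.
  by apply: continuous_measurable_fun; exact: dphi_continuous.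
rewrite integral_itv_obnd_cbnd; last exact: mphi.
rewrite integral_itv_bndo_bndc; last exact: mphi.
have phi0 z : z ^+ 2 = A ^+ 2 -> phi z = 0.
  move=> zA; rewrite /phi /zonal_comp /rho sqr_sqrtr ?ltW//.
  by rewrite zA A2 subrK expr1n subrr !mul0r.
rewrite (@continuous_FTC2 _ dphi phi).
- by rewrite !phi0 ?sqrrN// sube0.
- by rewrite gtrN.
- by apply: continuous_subspaceT; exact: dphi_continuous.
- split.
  + by move=> z _; apply: ex_derive.
  + apply: cvg_at_right_filter; exact: is_derive1_continuous (dphiE _).
  + apply: cvg_at_left_filter; exact: is_derive1_continuous (dphiE _).
- by move=> z _; rewrite derive1E; apply: derive_val.
Qed.

End zonal_field_on_line.

Section zonal_divergence.
Context {R : realType} {n : nat}.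
Local Notation mu := (@lebesgue_measure R).
Local Notation lam := (@lebesgue_rV R n).
Variables (q q' : R -> R) (Q : R).
Hypothesis dq : forall t : R, `|t| <= 1 -> is_derive t 1 q (q' t).
Hypothesis cq' : forall t : R, `|t| <= 1 -> {for t, continuous q'}.
Hypothesis mq : measurable_fun setT q.
Hypothesis mq' : measurable_fun setT q'.
Hypothesis q_le : forall t, `|t| <= 1 -> `|q t| <= Q.
Hypothesis q'_le : forall t, `|t| <= 1 -> `|q' t| <= Q.

Variable e : 'rV[R]_n.
Hypothesis e1 : enorm e = 1.

Definition cosine (y : 'rV[R]_n) : R := edot e y / enorm y.

Lemma cosine_le1 y : `|cosine y| <= 1.
Proof.
have [->|y0] := eqVneq y 0.
  by rewrite /cosine enorm0 invr0 mulr0 normr0.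
rewrite /cosine normrM normfV (ger0_norm (enorm_ge0 _)).
rewrite ler_pdivrMr ?enorm_gt0// mul1r.
by have := edot_norm_le e y; rewrite e1 mul1r.
Qed.

Lemma measurable_edot : measurable_fun setT (edot e).
Proof.
apply: measurable_sum => i; apply: measurable_funM => //.
exact: measurable_rV_coord.
Qed.

Lemma measurable_cosine : measurable_fun setT cosine.
Proof.
apply: measurable_funM; first exact: measurable_edot.
by apply: measurable_funVr; exact: measurable_enorm.
Qed.

Let f m (i : 'I_n) (y : 'rV[R]_n) : R :=
  zonal_deriv q q' m (enorm y) (cosine y) (e ord0 i) (y ord0 i) * \1_eball y.

Let measurable_f m i : measurable_fun setT (f m i).
Proof.
have me := @measurable_enorm R n.
have mx : measurable_fun setT (fun y : 'rV[R]_n => y ord0 i).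
  exact: measurable_rV_coord.
have mc := measurable_cosine.
have mqc : measurable_fun setT (q \o cosine) by exact: measurableT_comp.
have mqc' : measurable_fun setT (q' \o cosine) by exact: measurableT_comp.
have mV := measurable_funVr me.
have mr k : measurable_fun setT (fun y : 'rV[R]_n => (enorm y ^+ 2) ^+ k).
  by apply: measurable_funX; apply: measurable_funX.
have mw : measurable_fun setT
    (fun y : 'rV[R]_n => enorm y * e ord0 i - cosine y * y ord0 i).
  by apply: measurable_funB; apply: measurable_funM.
apply: measurable_funM; last exact: (measurable_indic (@measurable_eball R n)).
apply: measurable_funD.
  apply: measurable_funM => //; apply: measurable_funM => //.
  apply: measurableT_comp => //.
  by apply: measurable_funM => //; apply: measurable_funM => //; exact: mr.
apply: measurable_funM; first by apply: measurable_funB => //; exact: mr.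
apply: measurable_funD.
  by apply: measurable_funM => //; apply: measurable_funX; exact: measurable_funM.
apply: measurable_funM => //; apply: measurable_funB.
  apply: measurable_funB => //; apply: measurable_funM => //.
  exact: measurable_funM.
by apply: measurable_funM; exact: measurable_funM.
Qed.

Let Q_ge0 : 0 <= Q.
Proof. by apply: le_trans (normr_ge0 _) (q_le (_ : `|0| <= 1)); rewrite normr0. Qed.

Lemma zonal_deriv_le m (rho t a x : R) : 0 <= rho <= 1 -> `|t| <= 1 ->
  `|a| <= 1 -> `|x| <= rho ->
  `|zonal_deriv q q' m rho t a x| <= Q * (4 * m.+1%:R + 8).
Proof.
move=> /andP[r0 r1] t1 a1 xr.
have x1 := le_trans xr r1.
have tx : `|t * x| <= rho.
  by rewrite normrM -[leRHS]mul1r; apply: ler_pM.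
have ra : `|rho * a| <= rho.
  by rewrite normrM (ger0_norm r0) ler_piMr.
have w2 : `|rho * a - t * x| <= 2 * rho.
  by apply: le_trans (ler_normB _ _) _; lra.
have div_le (u k : R) : `|u| <= k * rho -> 0 <= k -> `|u / rho| <= k.
  move=> uk k0; rewrite normrM normfV (ger0_norm r0).
  have [->|rn0] := eqVneq rho 0; first by rewrite invr0 mulr0.
  by rewrite ler_pdivrMr// lt_neqAle eq_sym rn0.
have xr1 : `|x / rho| <= 1 by apply: div_le; rewrite ?mul1r.
have wr2 : `|(rho * a - t * x) / rho| <= 2 by exact: div_le.
have pow_le1 k : 0 <= (rho ^+ 2) ^+ k <= 1.
  by rewrite exprn_ge0 ?sqr_ge0// exprn_ile1 ?sqr_ge0// exprn_ile1.
have g1 : `|1 - (rho ^+ 2) ^+ m.+1| <= 1.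
  by have /andP[p0 p1] := pow_le1 m.+1; rewrite ger0_norm ?subr_ge0// lerBlDr lerDl.
have q1 := q_le t1; have q2 := q'_le t1.
have T1 : `|- (2 * m.+1%:R * (rho ^+ 2) ^+ m * x) * q t * (rho * a - t * x)| <=
    (2 * m.+1%:R) * Q * 2.
  rewrite (normrM _ (rho * a - t * x)) (normrM _ (q t)) normrN.
  apply: ler_pM; rewrite ?mulr_ge0//; last by lra.
  apply: ler_pM; rewrite ?mulr_ge0//.
  rewrite normrM (normrM _ (_ ^+ m)) (ger0_norm (_ : 0 <= 2 * m.+1%:R)) ?mulr_ge0//.
  have /andP[p0 p1] := pow_le1 m; rewrite (ger0_norm p0) -mulrA ler_piMr ?mulr_ge0//.
  by rewrite -[leRHS]mulr1 ler_pM.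
have T2 : `|q' t * ((rho * a - t * x) / rho) ^+ 2| <= Q * 4.
  rewrite normrM normrX; apply: ler_pM => //; rewrite ?exprn_ge0//.
  have -> : (4 : R) = 2 ^+ 2 by ring.
  by rewrite lerXn2r// nnegrE.
have T3 : `|q t * (a * (x / rho) - t - x / rho * ((rho * a - t * x) / rho))| <= Q * 4.
  rewrite normrM; apply: ler_pM => //.
  have : `|a * (x / rho)| <= 1 by rewrite normrM -[leRHS]mulr1; apply: ler_pM.
  have : `|x / rho * ((rho * a - t * x) / rho)| <= 2.
    by rewrite normrM -[leRHS]mul1r; apply: ler_pM.
  move=> h1 h2; apply: le_trans (ler_normB _ _) _.
  by have := ler_normB (a * (x / rho)) t; lra.
rewrite /zonal_deriv; apply: le_trans (ler_normD _ _) _.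
have T4 : `|(1 - (rho ^+ 2) ^+ m.+1) *
    (q' t * ((rho * a - t * x) / rho) ^+ 2 +
     q t * (a * (x / rho) - t - x / rho * ((rho * a - t * x) / rho)))| <= 1 * (Q * 8).
  rewrite normrM; apply: ler_pM => //.
  by apply: le_trans (ler_normD _ _) _; lra.
by lra.
Qed.

Let f_le m i y : `|f m i y| <= Q * (4 * m.+1%:R + 8).
Proof.
rewrite /f indicE; case: (boolP (y \in eball)) => [|_]; last first.
  by rewrite mulr0 normr0 mulr_ge0// addr_ge0 ?mulr_ge0.
rewrite inE => yB; rewrite mulr1; apply: zonal_deriv_le.
- by rewrite enorm_ge0 ltW.
- exact: cosine_le1.
- by rewrite -e1 enorm_coord.
- exact: enorm_coord.
Qed.

Let f_supp m i : supported_in_cube (f m i).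
Proof.
move=> y; rewrite /f indicE; case: (boolP (y \in eball)) => [|_]; last first.
  by rewrite mulr0 eqxx.
by rewrite inE => yB _ j; apply: le_trans (enorm_coord _ _) (ltW yB).
Qed.

Let integral_f_eq0 m i : (\int[lam]_y (f m i y)%:E = 0)%E.
Proof.
apply: (integral_rV_lines_eq0 (i := i) (measurable_f m i) (f_le m i) (@f_supp m i)).
move=> y; pose c2 := \sum_(j < n | j != i) y ord0 j ^+ 2.
pose b := \sum_(j < n | j != i) e ord0 j * y ord0 j.
have c20 : 0 <= c2 by apply: sumr_ge0 => j _; exact: sqr_ge0.
have Er z : enorm (rV_upd y i z) = Num.sqrt (z ^+ 2 + c2).
  rewrite /enorm (bigD1 i)//= mxE eqxx; congr (Num.sqrt (_ + _)).
  by apply: eq_bigr => j /negbTE ji; rewrite mxE ji.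
have Es z : edot e (rV_upd y i z) = e ord0 i * z + b.
  rewrite /edot (bigD1 i)//= mxE eqxx; congr (_ + _).
  by apply: eq_bigr => j /negbTE ji; rewrite mxE ji.
have Ei z : rV_upd y i z ord0 i = z by rewrite mxE eqxx.
have EB z : eball (rV_upd y i z) <-> z ^+ 2 + c2 < 1.
  rewrite /eball/= Er -{1}(sqrtr1 R) ltr_sqrt//.
have Et z : cosine (rV_upd y i z) = (e ord0 i * z + b) / Num.sqrt (z ^+ 2 + c2).
  by rewrite /cosine Er Es.
(* through the origin, the field is identically zero along the axis *)
have [c0|c0] := eqVneq c2 0.
  apply: integral0_eq => z _; rewrite /f Ei Et Er c0 addr0 sqrtr_sqr.
  have -> : b = 0.
    apply: big1 => j ji; suff -> : y ord0 j = 0 by rewrite mulr0.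
    apply/eqP; rewrite -sqrf_eq0; apply/eqP.
    by apply: (psumr_eq0P _ c0) => // k _; exact: sqr_ge0.
  rewrite addr0 /zonal_deriv.
  have [->|z0] := eqVneq z 0; first by rewrite normr0 invr0 !(mulr0, mul0r, subr0, addr0, expr0n, oppr0)/= ?(mulr0, mul0r, subr0, addr0).
  have nz : `|z| != 0 by rewrite normr_eq0.
  have -> : `|z| * e ord0 i - e ord0 i * z / `|z| * z = 0.
    rewrite mulrAC -[_ * z * z]mulrA -expr2 -real_normK ?num_real//.
    by field.
  by rewrite (mulrA (e ord0 i)) subrr !(mulr0, mul0r, addr0, subr0, expr0n)/= ?(mulr0, mul0r, addr0, add0r, subr0).
have {c0} c2p : 0 < c2 by rewrite lt_neqAle eq_sym c0.
pose g z : \bar R := (zonal_deriv q q' m (Num.sqrt (z ^+ 2 + c2))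
   ((e ord0 i * z + b) / Num.sqrt (z ^+ 2 + c2)) (e ord0 i) z)%:E.
transitivity (\int[mu]_z (g \_ [set z : R | (z ^+ 2 + c2 < 1)%R]) z)%E.
  apply: eq_integral => z _; rewrite patchE /f Ei Et Er indicE.
  have [zB|zB] := boolP (z \in [set z : R | z ^+ 2 + c2 < 1]).
    have /EB yB : z ^+ 2 + c2 < 1 by rewrite inE in zB.
    by rewrite mem_set// mulr1.
  rewrite memNset ?mulr0// => /EB yB.
  by move/negP: zB; apply; rewrite inE.
rewrite -integral_mkcond.
have [c1|c1] := ltP c2 1.
  apply: integral_zonal_deriv_line => // z.
  by have := cosine_le1 (rV_upd y i z); rewrite Et.
rewrite (_ : [set _ | _] = set0) ?integral_set0//.
apply/seteqP; split=> // z /=; rewrite ltNge => /negP; apply.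
by apply: le_trans c1 _; rewrite lerDr sqr_ge0.
Qed.

(** The spherical divergence of [q(t) grad t] for the height [t = e . xi]: here
[|grad t|^2 = 1 - t^2] and the Laplacian of [t] is [- (n - 1) t]. *)
Definition zonal_div (t : R) : R := q' t * (1 - t ^+ 2) - (n - 1)%:R * (t * q t).

(** Tangency to the spheres kills the derivative of the radial weight, which is
therefore only a factor in the divergence. *)
Lemma sum_zonal_deriv m y : (0 < n)%N -> y != 0 ->
  \sum_i zonal_deriv q q' m (enorm y) (cosine y) (e ord0 i) (y ord0 i) =
  (1 - (enorm y ^+ 2) ^+ m.+1) * zonal_div (cosine y).
Proof.
move=> n0; rewrite -enorm_gt0 => y0.
have r0 : enorm y != 0 by rewrite gt_eqF.
have Es : edot e y = cosine y * enorm y by rewrite mulfVK.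
pose g := 1 - (enorm y ^+ 2) ^+ m.+1.
pose A := - (2 * m.+1%:R * (enorm y ^+ 2) ^+ m) * q (cosine y).
have E i : zonal_deriv q q' m (enorm y) (cosine y) (e ord0 i) (y ord0 i) =
  g * q' (cosine y) * (e ord0 i * e ord0 i) +
  (A * enorm y - 2 * g * q' (cosine y) * cosine y / enorm y) *
    (e ord0 i * y ord0 i) +
  (- A * cosine y + g * q' (cosine y) * (cosine y / enorm y) ^+ 2 +
    g * q (cosine y) * cosine y / enorm y ^+ 2) * (y ord0 i * y ord0 i) +
  - (g * q (cosine y) * cosine y).
  rewrite /zonal_deriv -/g /A.
  move: g ((enorm y ^+ 2) ^+ m) (q (cosine y)) (q' (cosine y)) (cosine y) => *.
  by field.
rewrite (eq_bigr _ (fun i _ => E i)) !big_split/= -!mulr_sumr.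
rewrite -/(edot e e) -/(edot e y) -/(edot y y) -!enorm_sqr e1 Es.
rewrite sumr_const card_ord -mulr_natr /zonal_div natrB//.
rewrite -/g; clear E; move: A g (q (cosine y)) (q' (cosine y)) (cosine y) => *.
by field.
Qed.

Lemma integral_zonal_div_weighted m : (0 < n)%N ->
  (\int[lam]_(y in eball `\ 0%R)
    ((1 - (enorm y ^+ 2) ^+ m.+1) * zonal_div (cosine y))%:E = 0)%E.
Proof.
move=> n0.
have fi i : lam.-integrable setT (EFin \o f m i).
  exact: (integrable_bounded_cube (measurable_f m i) (f_le m i) (@f_supp m i)).
have m0 : measurable [set (0 : 'rV[R]_n)] by exact: measurable_set1_rV.
have l0 : lam [set (0 : 'rV[R]_n)] = 0%E.
  rewrite set1_rV (@lebesgue_rV_box _ n (fun=> [set (0 : R)]))//.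
  case: (n) n0 => // k _; by rewrite big_ord_recl lebesgue_measure_set1 mul0e.
have S0 : (\int[lam]_y (\sum_(i < n) (f m i y)%:E) = 0)%E.
  by rewrite integral_sum//; apply: big1 => i _; exact: integral_f_eq0.
have si : lam.-integrable setT (fun y => \sum_(i < n) (f m i y)%:E)%E.
  by apply: integrable_sum => //= i _; exact: fi.
rewrite (negligible_integral m0 measurableT si l0) in S0.
rewrite -[RHS]S0 setTD setDE setIC integral_mkcondr.
apply: eq_integral => y; rewrite inE/= => /eqP y0.
rewrite patchE sumEFin; under eq_bigr do rewrite /f.
rewrite -mulr_suml sum_zonal_deriv// indicE.
by case: ifP => yB; rewrite ?mulr1// mulr0.
Qed.

End zonal_divergence.

(** * Divergence theorem for zonal fields on the sphere *)

Section sphere_integral.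
Context {R : realType} {n : nat}.
Local Notation lam := (@lebesgue_rV R n).
Local Notation nu := (@ball_measure R n).
Local Notation sigma := (@sphere_measure R n).

Let bproj (y : 'rV[R]_n) : 'rV[R]_n := \1_eball y *: radial_proj y.

Let measurable_bproj : measurable_fun setT bproj.
Proof.
apply/measurable_fun_rVP => i.
apply: (eq_measurable_fun (fun y : 'rV[R]_n =>
    \1_eball y * radial_proj y ord0 i)).
  by move=> y _; rewrite /bproj [in RHS]mxE.
apply: measurable_funM; first exact: (measurable_indic (@measurable_eball R n)).
by have /measurable_fun_rVP := @measurable_radial_proj R n; apply.
Qed.

Lemma enorm_radial_proj (y : 'rV[R]_n) : y != 0 -> enorm (radial_proj y) = 1.
Proof.
rewrite -enorm_eq0 => y0.
by rewrite enormZ ger0_norm ?invr_ge0 ?enorm_ge0// mulVf.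
Qed.

Let bproj_esphere : bproj @^-1` esphere = eball `\ 0.
Proof.
apply/seteqP; split=> y; rewrite /= /esphere /= /bproj indicE.
  have [yB|_] := boolP (y \in eball).
    rewrite scale1r => yS; split; first by rewrite inE in yB.
    move=> y0; move: yS; rewrite y0 /radial_proj enorm0 invr0 scale0r enorm0.
    by move=> /eqP; rewrite eq_sym oner_eq0.
  by rewrite scale0r enorm0 => /eqP; rewrite eq_sym oner_eq0.
by move=> [yB /eqP y0]; rewrite mem_set// scale1r enorm_radial_proj.
Qed.

(** Off the origin, [sphere_measure] is the image of the ball measure under the map
sending the exterior of the ball to 0; unlike [radial_proj] on the restricted measure,
this map lets the image-measure formula apply directly. *)
Lemma integral_sphere_measure (f : 'rV[R]_n -> R) :
  measurable_fun setT f ->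
  nu.-integrable (eball `\ 0%R) (fun y => (f (radial_proj y))%:E) ->
  (\int[sigma]_(xi in esphere) (f xi)%:E =
   \int[nu]_(y in eball `\ 0%R) (f (radial_proj y))%:E)%E.
Proof.
move=> mf fi.
have E y : (eball `\ 0%R) y -> bproj y = radial_proj y.
  by move=> [yB _]; rewrite /bproj indicE mem_set// scale1r.
have -> : (\int[sigma]_(xi in esphere) (f xi)%:E =
    \int[pushforward nu bproj]_(xi in esphere) (f xi)%:E)%E.
  apply: eq_measure_integral => A mA AS.
  rewrite -[LHS]/(nu (radial_proj @^-1` A `&` eball)) /pushforward.
  congr (@ball_measure R n _).
  apply/seteqP; split=> y /=.
    by move=> [yA yB]; rewrite /bproj indicE mem_set// scale1r.
  rewrite /bproj indicE; have [yB|_] := boolP (y \in eball).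
    by rewrite scale1r => yA; split=> //; rewrite inE in yB.
  rewrite scale0r => /AS; rewrite /esphere/= enorm0 => /eqP.
  by rewrite eq_sym oner_eq0.
rewrite integral_pushforward//; last 3 first.
- exact/measurable_EFinP.
- rewrite bproj_esphere; apply: eq_integrable fi => //.
    by apply: measurableD; [exact: measurable_eball|exact: measurable_set1_rV].
  by move=> y; rewrite inE => /E /= ->.
- exact: measurable_esphere.
rewrite bproj_esphere; apply: eq_integral => y; rewrite inE => /E.
by move=> /= ->.
Qed.

Lemma integral_ball_measure_eq0 (D : set 'rV[R]_n) (f : 'rV[R]_n -> \bar R) :
  measurable D -> lam.-integrable D f -> (\int[lam]_(y in D) f y = 0)%E ->
  (\int[nu]_(y in D) f y = 0)%E.
Proof.
move=> mD fi; have mf := measurable_int _ fi.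
rewrite integralE => f0.
rewrite integralE !ge0_integral_mscale//; last 2 first.
- exact: measurable_funeneg.
- exact: measurable_funepos.
have af := integrable_pos_fin_num mD fi.
have bf := integrable_neg_fin_num mD fi.
by rewrite -muleBr ?f0 ?mule0// fin_num_adde_defr.
Qed.

Section zonal.
Variables (q q' : R -> R) (Q : R).
Hypothesis dq : forall t : R, `|t| <= 1 -> is_derive t 1 q (q' t).
Hypothesis cq' : forall t : R, `|t| <= 1 -> {for t, continuous q'}.
Hypothesis mq : measurable_fun setT q.
Hypothesis mq' : measurable_fun setT q'.
Hypothesis q_le : forall t, `|t| <= 1 -> `|q t| <= Q.
Hypothesis q'_le : forall t, `|t| <= 1 -> `|q' t| <= Q.
Hypothesis n_gt0 : (0 < n)%N.

Variable e : 'rV[R]_n.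
Hypothesis e1 : enorm e = 1.

Local Notation T := (@zonal_div R n q q').

Lemma zonal_div_le t : `|t| <= 1 -> `|T t| <= Q * n%:R.
Proof.
move=> t1; rewrite /zonal_div; apply: le_trans (ler_normB _ _) _.
have Q0 : 0 <= Q by apply: le_trans (normr_ge0 _) (q_le t1).
have -> : Q * n%:R = Q * 1 + (n - 1)%:R * (1 * Q).
  by rewrite natrB//; ring.
apply: lerD; rewrite normrM.
  apply: ler_pM => //; first exact: q'_le.
  rewrite ger0_norm ?subr_ge0 ?lerBlDr ?lerDl ?sqr_ge0//.
  by rewrite -real_normK ?num_real// expr_le1.
rewrite (ger0_norm (_ : 0 <= (n - 1)%:R))// ler_wpM2l// normrM.
by apply: ler_pM => //; exact: q_le.
Qed.

Lemma measurable_zonal_div : measurable_fun setT T.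
Proof.
apply: measurable_funB; first apply: measurable_funM => //.
  by apply: measurable_funB => //; exact: measurable_funX.
by apply: measurable_funM => //; exact: measurable_funM.
Qed.

Let mD0 : measurable ((@eball R n) `\ 0).
Proof.
by apply: measurableD; [exact: measurable_eball|exact: measurable_set1_rV].
Qed.

Let mTc : measurable_fun setT (T \o cosine e).
Proof. by apply: measurableT_comp; [exact: measurable_zonal_div|exact: measurable_cosine]. Qed.

Let cst_integrable (m : {measure set 'rV[R]_n -> \bar R}) (c : R) :
  (m eball < +oo)%E -> m.-integrable (eball `\ 0%R) (cst c%:E).
Proof.
move=> moo; apply/integrableP; split; first exact: measurable_cst.
rewrite integral_cst//; apply: lte_mul_pinfty => //.
apply: le_lt_trans moo; apply: le_measure; rewrite ?inE//.
exact: measurable_eball.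
Qed.

Let T_integrable (m : {measure set 'rV[R]_n -> \bar R}) : (m eball < +oo)%E ->
  m.-integrable (eball `\ 0%R) (EFin \o (T \o cosine e)).
Proof.
move=> moo; apply: (le_integrable mD0 _ _ (cst_integrable (Q * n%:R) moo)).
  apply/measurable_EFinP; exact: measurable_funS mTc.
move=> y _ /=; rewrite lee_fin; apply: le_trans (ler_norm _).
by apply: zonal_div_le; exact: cosine_le1.
Qed.

Let integral_zonal_div_lebesgue :
  (\int[lam]_(y in eball `\ 0%R) (T (cosine e y))%:E = 0)%E.
Proof.
pose f_ m (y : 'rV[R]_n) := ((1 - (enorm y ^+ 2) ^+ m.+1) * T (cosine e y))%:E.
have loo := @lebesgue_eball_lty R n.
have [|||||_ _] := @dominated_convergence _ _ _ lam _ mD0 f_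
  (fun y => (T (cosine e y))%:E) (cst (Q * n%:R)%:E).
- move=> m; apply/measurable_EFinP; apply: (measurable_funS measurableT) => //.
  apply: measurable_funM => //; apply: measurable_funB => //.
  do 2 apply: measurable_funX; exact: measurable_enorm.
- by apply/measurable_EFinP; exact: measurable_funS mTc.
- apply/aeW => y [yB _]; apply: cvg_EFin; first exact: nearW.
  rewrite -[X in _ --> X]mul1r; apply: cvgM; last exact: cvg_cst.
  rewrite -[X in _ --> X]subr0; apply: cvgB; first exact: cvg_cst.
  rewrite (cvg_shiftS (fun m => (enorm y ^+ 2) ^+ m)).
  by apply: cvg_expr; rewrite ger0_norm ?sqr_ge0// eball_sqr_lt.
- exact: cst_integrable.
- apply/aeW => y m [yB _]; rewrite /f_ /= lee_fin normrM.
  have h0 : 0 <= (enorm y ^+ 2) ^+ m.+1 by rewrite exprn_ge0// sqr_ge0.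
  have h1 : (enorm y ^+ 2) ^+ m.+1 <= 1.
    by rewrite exprn_ile1 ?sqr_ge0// ltW// eball_sqr_lt.
  rewrite -[leRHS]mul1r; apply: ler_pM => //.
    by rewrite ger0_norm ?subr_ge0// lerBlDr lerDl.
  by apply: zonal_div_le; exact: cosine_le1.
move=> /cvg_lim <- //; apply: cvg_lim => //.
rewrite (_ : (fun _ => _) = cst 0%E); first exact: cvg_cst.
apply/funext => m /=.
exact: (integral_zonal_div_weighted dq cq' mq mq' q_le q'_le e1 m n_gt0).
Qed.

(** Divergence theorem on the sphere for zonal fields: the weights [1 - |y|^(2 m + 2)]
increase to 1 on the open ball, so the volume integral of the spherical divergence of
the homogeneous extension vanishes as well, and it is proportional to the surface
integral. *)
Lemma integral_sphere_zonal_div :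
  (\int[sigma]_(xi in esphere) (T (edot e xi))%:E = 0)%E.
Proof.
have E (y : 'rV[R]_n) : edot e (radial_proj y) = cosine e y.
  by rewrite edotZr mulrC.
have nuoo : (nu eball < +oo)%E by rewrite ball_measure_eball ltry.
rewrite (integral_sphere_measure (f := fun xi => T (edot e xi))).
- under eq_integral do rewrite E.
  apply: integral_ball_measure_eq0 => //.
  exact: T_integrable (@lebesgue_eball_lty R n).
- by apply: measurableT_comp; [exact: measurable_zonal_div|exact: measurable_edot].
- by under eq_fun do rewrite E; exact: T_integrable.
Qed.

End zonal.
End sphere_integral.

(** * Constancy of the mean of the Poisson kernel *)

Section poisson_profile.
Context {R : realType}.
Implicit Types (r t w h : R).

(** First-order Taylor remainder of a power, by the recursion
[D_(k+1) = w' D_k + k w^(k-1) (w' - w)^2]. *)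
Lemma expr_quadratic_remainder (W : R) k : 0 <= W ->
  exists2 C : R, 0 <= C & forall w w', 0 <= w <= W -> 0 <= w' <= W ->
    `|w' ^+ k - w ^+ k - k%:R * w ^+ k.-1 * (w' - w)| <= C * (w' - w) ^+ 2.
Proof.
move=> W0; elim: k => [|k [C C0 IH]].
  by exists 0 => // w w' _ _; rewrite !expr0 subrr !mul0r subr0 normr0.
exists (W * C + k%:R * W ^+ k.-1).
  by rewrite addr_ge0 ?mulr_ge0 ?exprn_ge0.
move=> w w' wW w'W; have /andP[w0 w1] := wW; have /andP[w'0 w'1] := w'W.
have E : w' ^+ k.+1 - w ^+ k.+1 - k.+1%:R * w ^+ k * (w' - w) =
    w' * (w' ^+ k - w ^+ k - k%:R * w ^+ k.-1 * (w' - w)) +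
    k%:R * w ^+ k.-1 * (w' - w) ^+ 2.
  have P : k%:R * w ^+ k.-1 * w = k%:R * w ^+ k.
    case: k {IH} => [|k] /=; first by rewrite !mul0r.
    by rewrite exprSr mulrA.
  have : k%:R * w ^+ k.-1 * w * (w' - w) = k%:R * w ^+ k * (w' - w) by rewrite P.
  rewrite !exprS -natr1; move: (k%:R) (w ^+ k.-1) (w ^+ k) (w' ^+ k) => a b c d H.
  by nra.
rewrite /= E; apply: le_trans (ler_normD _ _) _; rewrite mulrDl; apply: lerD.
  rewrite normrM (ger0_norm w'0) -[leRHS]mulrA; apply: ler_pM => //; exact: IH.
have p0 : 0 <= k%:R * w ^+ k.-1 by rewrite mulr_ge0 ?exprn_ge0.
rewrite ger0_norm; last by apply: mulr_ge0; rewrite ?sqr_ge0.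
apply: ler_wpM2r; first exact: sqr_ge0.
apply: ler_wpM2l => //.
by apply: lerXn2r; rewrite ?nnegrE.
Qed.

(** For [x = r e] and [t = e . xi] with unit vectors [e] and [xi], [poisson_den] is
[|xi - x|^2] and the Poisson kernel is [poisson_ratio ^+ (n - 1)]. *)
Definition poisson_den r t : R := 1 - 2 * r * t + r ^+ 2.
Definition poisson_ratio r t : R := (1 - r ^+ 2) / poisson_den r t.
Definition poisson_ratio_dr r t : R :=
  2 * (t * (1 + r ^+ 2) - 2 * r) / poisson_den r t ^+ 2.

Lemma poisson_den_ge r0 r t : 0 <= r <= r0 -> r0 < 1 -> `|t| <= 1 ->
  (1 - r0) ^+ 2 <= poisson_den r t.
Proof.
move=> /andP[r_ge0 rr0] r01; rewrite ler_norml => /andP[t0 t1].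
by rewrite /poisson_den; nra.
Qed.

Lemma poisson_den_gt0 r t : 0 <= r < 1 -> `|t| <= 1 -> 0 < poisson_den r t.
Proof.
move=> /andP[r_ge0 r1] t1.
apply: lt_le_trans (poisson_den_ge (r0 := r) _ r1 t1); last by rewrite r_ge0 lexx.
by rewrite exprn_gt0// subr_gt0.
Qed.

Lemma poisson_ratioB r r' t : poisson_den r t != 0 -> poisson_den r' t != 0 ->
  poisson_ratio r' t - poisson_ratio r t =
  2 * (r' - r) * (t * (1 + r * r') - (r + r')) /
    (poisson_den r t * poisson_den r' t).
Proof.
rewrite /poisson_ratio /poisson_den => d d'.
by field; rewrite d d'.
Qed.

Lemma poisson_ratio_remainder r r' t :
  poisson_den r t != 0 -> poisson_den r' t != 0 ->
  poisson_ratio r' t - poisson_ratio r t - (r' - r) * poisson_ratio_dr r t =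
  2 * (r' - r) ^+ 2 * ((t * r - 1) * poisson_den r t -
     (t * (1 + r ^+ 2) - 2 * r) * (r + r' - 2 * t)) /
    (poisson_den r t ^+ 2 * poisson_den r' t).
Proof.
rewrite /poisson_ratio_dr /poisson_ratio /poisson_den => d d'.
by field; rewrite d d'.
Qed.

Lemma poisson_numerators_le r r' t : 0 <= r <= 1 -> 0 <= r' <= 1 ->
  `|t| <= 1 ->
  `|t * (1 + r * r') - (r + r')| <= 4 /\
  `|(t * r - 1) * poisson_den r t -
    (t * (1 + r ^+ 2) - 2 * r) * (r + r' - 2 * t)| <= 24.
Proof.
move=> /andP[r0 r1] /andP[r'0 r'1] t1.
have tp_le p : 0 <= p <= 1 -> `|t * (1 + p)| <= 2.
  move=> /andP[p0 p1]; rewrite normrM (ger0_norm (_ : 0 <= 1 + p)) ?addr_ge0//.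
  by rewrite -[leRHS]mul1r; apply: ler_pM; rewrite ?addr_ge0//; lra.
have /tp_le h1 : 0 <= r * r' <= 1 by rewrite mulr_ge0// mulr_ile1.
have /tp_le h2 : 0 <= r ^+ 2 <= 1 by rewrite sqr_ge0 expr_le1.
have tr : `|t * r| <= 1.
  by rewrite normrM -[leRHS]mulr1; apply: ler_pM => //; rewrite ger0_norm.
split.
  apply: le_trans (ler_normB _ _) _.
  by rewrite (ger0_norm (_ : 0 <= r + r')) ?addr_ge0//; lra.
apply: le_trans (ler_normB _ _) _; rewrite !normrM.
have den4 : `|poisson_den r t| <= 4.
  rewrite /poisson_den -mulrA (mulrC r).
  apply: le_trans (ler_normD _ _) _; rewrite (ger0_norm (sqr_ge0 r)).
  have := ler_normB 1 (2 * (t * r)); rewrite normr1 normrM ger0_norm//.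
  have : r ^+ 2 <= 1 by rewrite expr_le1.
  by lra.
have : `|t * r - 1| * `|poisson_den r t| <= 2 * 4.
  apply: ler_pM => //; apply: le_trans (ler_normB _ _) _; rewrite normr1; lra.
have : `|t * (1 + r ^+ 2) - 2 * r| * `|r + r' - 2 * t| <= 4 * 4.
  apply: ler_pM => //.
    apply: le_trans (ler_normB _ _) _.
    by rewrite (ger0_norm (_ : 0 <= 2 * r)) ?mulr_ge0//; lra.
  by move: t1; rewrite !ler_norml => /andP[? ?]; apply/andP; split; lra.
by lra.
Qed.

(** A quadratic error, uniform in [t], is what allows differentiation in [r] to be
replaced by a direct estimate of the increments of the mean. On [[0, r0]] the
denominator is at least [(1 - r0)^2], and the remainder of the ratio has an explicit
form, [poisson_ratio_remainder]. *)
Lemma poisson_profile_remainder r0 k : 0 <= r0 < 1 ->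
  exists2 C : R, 0 <= C & forall r r' t, 0 <= r <= r0 -> 0 <= r' <= r0 ->
    `|t| <= 1 ->
    `|poisson_ratio r' t ^+ k - poisson_ratio r t ^+ k -
      (r' - r) * (k%:R * poisson_ratio r t ^+ k.-1 * poisson_ratio_dr r t)| <=
    C * (r' - r) ^+ 2.
Proof.
move=> /andP[r00 r01].
have [eta eta0 etaP] : exists2 eta : R, 0 < eta & forall r t, 0 <= r <= r0 ->
    `|t| <= 1 -> eta <= poisson_den r t.
  exists ((1 - r0) ^+ 2); first by rewrite exprn_gt0// subr_gt0.
  by move=> r t rr t1; exact: poisson_den_ge rr r01 t1.
have W0 : 0 <= eta^-1 by rewrite invr_ge0 ltW.
have [C C0 HC] := expr_quadratic_remainder k W0.
exists (C * (8 * eta^-1 ^+ 2) ^+ 2 + k%:R * eta^-1 ^+ k.-1 * (48 * eta^-1 ^+ 3)).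
  by rewrite addr_ge0 ?mulr_ge0 ?exprn_ge0.
move=> r r' t rr rr' t1.
have D1 := etaP _ _ rr t1; have D2 := etaP _ _ rr' t1.
have d1 : 0 < poisson_den r t by exact: lt_le_trans D1.
have d2 : 0 < poisson_den r' t by exact: lt_le_trans D2.
have i1 : (poisson_den r t)^-1 <= eta^-1 by rewrite lef_pV2 ?posrE.
have i2 : (poisson_den r' t)^-1 <= eta^-1 by rewrite lef_pV2 ?posrE.
have ratio_bnd s : 0 <= s <= r0 -> 0 <= poisson_ratio s t <= eta^-1.
  move=> sr; have sd := lt_le_trans eta0 (etaP _ _ sr t1).
  have si : (poisson_den s t)^-1 <= eta^-1.
    by rewrite lef_pV2 ?posrE// etaP.
  move: sr => /andP[s0 s1].
  have s2 : 0 <= s ^+ 2 <= 1 by rewrite sqr_ge0/= expr_le1// (le_trans s1)// ltW.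
  apply/andP; split.
    by rewrite divr_ge0 ?(ltW sd)// subr_ge0; case/andP: s2.
  rewrite -[leRHS]mul1r; apply: ler_pM => //; rewrite ?invr_ge0 ?(ltW sd)//.
    by rewrite subr_ge0; case/andP: s2.
  by rewrite lerBlDr lerDl; case/andP: s2.
have wW := ratio_bnd _ rr; have w'W := ratio_bnd _ rr'.
have H1 := HC _ _ wW w'W.
have n1 : poisson_den r t != 0 by rewrite gt_eqF.
have n2 : poisson_den r' t != 0 by rewrite gt_eqF.
move: (rr) (rr') => /andP[a0 a1] /andP[b0 b1].
have r1 : 0 <= r <= 1 by rewrite a0 (le_trans a1) ?ltW.
have r'1 : 0 <= r' <= 1 by rewrite b0 (le_trans b1) ?ltW.
have [num1 num2] := poisson_numerators_le r1 r'1 t1.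
have dw : `|poisson_ratio r' t - poisson_ratio r t| <=
    8 * eta^-1 ^+ 2 * `|r' - r|.
  rewrite poisson_ratioB// normrM (normrM _ (_ - _)) (normrM 2) (ger0_norm (_ : 0 <= 2))//.
  rewrite invfM (normrM (_ ^-1) (_ ^-1)).
  rewrite (gtr0_norm (_ : 0 < (poisson_den r t)^-1)) ?invr_gt0//.
  rewrite (gtr0_norm (_ : 0 < (poisson_den r' t)^-1)) ?invr_gt0//.
  have h2 : (poisson_den r t)^-1 * (poisson_den r' t)^-1 <= eta^-1 ^+ 2.
    by rewrite expr2; apply: ler_pM; rewrite ?invr_ge0 ?(ltW d1) ?(ltW d2).
  rewrite [leRHS](_ : _ = 2 * `|r' - r| * 4 * eta^-1 ^+ 2); last by ring.
  apply: ler_pM; rewrite ?mulr_ge0 ?invr_ge0 ?(ltW d1) ?(ltW d2)//.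
  by rewrite ler_wpM2l// mulr_ge0.
have rem : `|poisson_ratio r' t - poisson_ratio r t -
    (r' - r) * poisson_ratio_dr r t| <= 48 * eta^-1 ^+ 3 * (r' - r) ^+ 2.
  rewrite poisson_ratio_remainder// normrM (normrM (2 * _)) (normrM 2).
  rewrite (ger0_norm (_ : 0 <= 2))// (ger0_norm (sqr_ge0 (r' - r))).
  rewrite invfM (normrM (_ ^-1) (_ ^-1)) (gtr0_norm (_ : 0 < (poisson_den r' t)^-1)) ?invr_gt0//.
  rewrite (gtr0_norm (_ : 0 < (poisson_den r t ^+ 2)^-1)) ?invr_gt0 ?exprn_gt0//.
  have h2 : (poisson_den r t ^+ 2)^-1 * (poisson_den r' t)^-1 <= eta^-1 ^+ 3.
    rewrite (exprSr _ 2) -exprVn; apply: ler_pM => //.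
    + by rewrite exprn_ge0 ?invr_ge0 ?(ltW d1).
    + by rewrite invr_ge0 ?(ltW d2).
    + by apply: lerXn2r; rewrite ?nnegrE ?invr_ge0 ?(ltW d1) ?(ltW eta0).
  rewrite [leRHS](_ : _ = 2 * (r' - r) ^+ 2 * 24 * eta^-1 ^+ 3); last by ring.
  have s0 : 0 <= 2 * (r' - r) ^+ 2 by rewrite mulr_ge0// sqr_ge0.
  apply: ler_pM => //.
  + by rewrite mulr_ge0.
  + by rewrite mulr_ge0// invr_ge0 ?sqr_ge0// ltW.
  + by rewrite ler_wpM2l.
move: wW => /andP[w0 wW].
set w := poisson_ratio r t in H1 dw rem w0 wW *.
set w' := poisson_ratio r' t in H1 dw rem *.
set d := poisson_ratio_dr r t in rem *.
have -> : w' ^+ k - w ^+ k - (r' - r) * (k%:R * w ^+ k.-1 * d) =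
  (w' ^+ k - w ^+ k - k%:R * w ^+ k.-1 * (w' - w)) +
  k%:R * w ^+ k.-1 * (w' - w - (r' - r) * d) by ring.
apply: le_trans (ler_normD _ _) _; rewrite [leRHS]mulrDl; apply: lerD.
  apply: le_trans H1 _; rewrite -[leRHS]mulrA ler_wpM2l//.
  rewrite -real_normK ?num_real// -(real_normK (num_real (r' - r))) -exprMn.
  by apply: lerXn2r; rewrite ?nnegrE ?mulr_ge0 ?exprn_ge0.
rewrite normrM (ger0_norm (_ : 0 <= k%:R * w ^+ k.-1)) ?mulr_ge0 ?exprn_ge0//.
rewrite -[leRHS]mulrA; apply: ler_pM; rewrite ?mulr_ge0 ?exprn_ge0//.
by apply: ler_wpM2l => //; apply: lerXn2r; rewrite ?nnegrE ?invr_ge0 ?(ltW eta0).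
Qed.

End poisson_profile.

Section poisson_mean.
Context {R : realType} {n : nat}.
Hypothesis n_gt0 : (0 < n)%N.
Local Notation sigma := (@sphere_measure R n).

Lemma integral_esphere_cst (C : R) :
  (\int[sigma]_(xi in esphere) C%:E = C%:E)%E.
Proof.
rewrite integral_cst; last exact: measurable_esphere.
by rewrite [X in (_ * X)%E](sphere_measure_esphere n_gt0) mule1.
Qed.

Lemma integrable_esphere (f : 'rV[R]_n -> R) C :
  measurable_fun esphere f -> (forall xi, esphere xi -> `|f xi| <= C) ->
  sigma.-integrable esphere (EFin \o f).
Proof.
move=> mf fC; apply: (integrable_dominated (g := fun=> C) (c := C)) => //.
  exact: measurable_esphere.
by rewrite integral_esphere_cst.
Qed.

Lemma Rintegral_esphere_le (f : 'rV[R]_n -> R) C :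
  measurable_fun esphere f -> (forall xi, esphere xi -> `|f xi| <= C) ->
  `|\int[sigma]_(xi in esphere) f xi| <= C.
Proof.
move=> mf fC; apply: (Rintegral_norm_le (g := fun=> C)) => //.
  exact: measurable_esphere.
by rewrite integral_esphere_cst.
Qed.

Variable e : 'rV[R]_n.
Hypothesis e1 : enorm e = 1.

Let edot_le1 xi : esphere xi -> `|edot e xi| <= 1.
Proof.
by move=> xS; apply: le_trans (edot_norm_le _ _) _; rewrite e1 xS mulr1.
Qed.

Let measurable_edot_S (f : R -> R) : measurable_fun setT f ->
  measurable_fun esphere (fun xi : 'rV[R]_n => f (edot e xi)).
Proof.
move=> mf; apply: (measurable_funS measurableT) => //.
by apply: measurableT_comp => //; exact: measurable_edot.
Qed.

Let p r t := @poisson_ratio R r t ^+ (n - 1).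
Let pr r t : R :=
  (n - 1)%:R * poisson_ratio r t ^+ (n - 1).-1 * poisson_ratio_dr r t.
Let pt r t : R :=
  (n - 1)%:R * poisson_ratio r t ^+ (n - 1).-1 *
    (2 * r * (1 - r ^+ 2) / poisson_den r t ^+ 2).

Let measurable_den r : measurable_fun setT (@poisson_den R r).
Proof.
by apply: measurable_funD => //; apply: measurable_funB => //; apply: measurable_funM.
Qed.

Let measurable_ratio r k : measurable_fun setT (fun t => @poisson_ratio R r t ^+ k).
Proof.
apply: measurable_funX; apply: measurable_funM => //.
by apply: measurable_funVr; exact: measurable_den.
Qed.

Let measurable_pr r : measurable_fun setT (pr r).
Proof.
apply: measurable_funM.
  by apply: measurable_funM => //; exact: measurable_ratio.
apply: measurable_funM.
  by apply: measurable_funM => //; apply: measurable_funB => //; exact: measurable_funM.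
by apply: measurable_funVr; apply: measurable_funX; exact: measurable_den.
Qed.

Let measurable_pt r : measurable_fun setT (pt r).
Proof.
apply: measurable_funM.
  by apply: measurable_funM => //; exact: measurable_ratio.
apply: measurable_funM => //.
by apply: measurable_funVr; apply: measurable_funX; exact: measurable_den.
Qed.

Section fixed_radius.
Variable r : R.
Hypothesis r01 : 0 <= r < 1.

Let den_gt0 t : `|t| <= 1 -> 0 < poisson_den r t.
Proof. exact: poisson_den_gt0. Qed.

Let dden (t : R) : is_derive t 1 (@poisson_den R r) (- (2 * r)).
Proof.
by apply: is_derive_eq; rewrite /GRing.scale/=; ring.
Qed.

Let dratio (t : R) : `|t| <= 1 ->
  is_derive t 1 (@poisson_ratio R r) (2 * r * (1 - r ^+ 2) / poisson_den r t ^+ 2).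
Proof.
move=> t1; have d0 : poisson_den r t != 0 by rewrite gt_eqF// den_gt0.
have dd := dden t.
have dv : is_derive t 1 (fun t => (poisson_den r t)^-1)
   (- (poisson_den r t) ^- 2 * (- (2 * r))) by exact: is_deriveV.
have dm : is_derive t 1 (@poisson_ratio R r)
    ((1 - r ^+ 2) * (- (poisson_den r t) ^- 2 * (- (2 * r)))).
  exact: (is_deriveZ (1 - r ^+ 2) dv).
apply: (is_derive_eq dm).
by field.
Qed.

Let dp (t : R) : `|t| <= 1 -> is_derive t 1 (p r) (pt r t).
Proof. by move=> t1; apply: is_derive1_exprn; exact: dratio. Qed.

Let cpt (t : R) : `|t| <= 1 -> {for t, continuous (pt r)}.
Proof.
move=> t1; have d0 : poisson_den r t != 0 by rewrite gt_eqF// den_gt0.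
apply: cvgM.
  apply: cvgM; first exact: cvg_cst.
  apply: (@continuous_comp _ _ _ (poisson_ratio r) (fun u : R => u ^+ (n - 1).-1)).
    exact: is_derive1_continuous (dratio t1).
  exact: exprn_continuous.
apply: cvgM; first exact: cvg_cst.
apply: cvgV; first by rewrite expf_neq0.
apply: (@continuous_comp _ _ _ (poisson_den r) (fun u : R => u ^+ 2)).
  exact: is_derive1_continuous (dden t).
exact: exprn_continuous.
Qed.

Let bounds : exists Q, forall t, `|t| <= 1 ->
  [/\ `|p r t| <= Q, `|pt r t| <= Q & `|pr r t| <= Q].
Proof.
have bnd (f : R -> R) : (forall t, `|t| <= 1 -> {for t, continuous f}) ->
    exists Q, forall t, `|t| <= 1 -> `|f t| <= Q.
  move=> cf.
  have cf' : {within `[(-1 : R), 1], continuous f}.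
    apply: continuous_in_subspaceT => t; rewrite inE/= in_itv/= -ler_norml.
    exact: cf.
  have N11 : (-1 : R) <= 1 by lra.
  have [a _ Ha] := EVT_max N11 cf'.
  have [b _ Hb] := EVT_min N11 cf'.
  exists (`|f a| + `|f b|) => t; rewrite ler_norml => t1.
  have tI : t \in `[(-1 : R), 1] by rewrite in_itv.
  rewrite ler_norml; apply/andP; split.
    have := Hb _ tI; have := ler_norm (- f b); rewrite normrN.
    have := normr_ge0 (f a); lra.
  have := Ha _ tI; have := ler_norm (f a).
  have := normr_ge0 (f b); lra.
have [Q1 H1] : exists Q, forall t, `|t| <= 1 -> `|p r t| <= Q.
  by apply: bnd => t t1; exact: is_derive1_continuous (dp t1).
have [Q2 H2] := bnd _ cpt.
have [Q3 H3] : exists Q, forall t, `|t| <= 1 -> `|pr r t| <= Q.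
  apply: bnd => t t1; have d0 : poisson_den r t != 0 by rewrite gt_eqF// den_gt0.
  apply: cvgM.
    apply: cvgM; first exact: cvg_cst.
    apply: (@continuous_comp _ _ _ (poisson_ratio r) (fun u : R => u ^+ (n - 1).-1)).
      exact: is_derive1_continuous (dratio t1).
    exact: exprn_continuous.
  apply: cvgM.
    apply: cvgM; first exact: cvg_cst.
    apply: cvgB; last exact: cvg_cst.
    by apply: cvgM; [exact: cvg_id|exact: cvg_cst].
  apply: cvgV; first by rewrite expf_neq0.
  apply: (@continuous_comp _ _ _ (poisson_den r) (fun u : R => u ^+ 2)).
    exact: is_derive1_continuous (dden t).
  exact: exprn_continuous.
exists (`|Q1| + `|Q2| + `|Q3|) => t t1.
have := H1 _ t1; have := H2 _ t1; have := H3 _ t1.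
have := ler_norm Q1; have := ler_norm Q2; have := ler_norm Q3.
have := normr_ge0 Q1; have := normr_ge0 Q2; have := normr_ge0 Q3.
by split; lra.
Qed.

(** The radial derivative of the kernel is a spherical divergence. Geometrically,
moving [x = r e] outwards is the flow of hyperbolic translations along [e], whose
boundary field is the gradient of [e . xi] and whose Jacobian is the kernel. *)
Let zonal_div_pr t : `|t| <= 1 ->
  pr r t = - 2 / (1 - r ^+ 2) * @zonal_div R n (p r) (pt r) t.
Proof.
move=> t1; have d0 : poisson_den r t != 0 by rewrite gt_eqF// den_gt0.
have r2 : 1 - r ^+ 2 != 0.
  by rewrite gt_eqF// subr_gt0; move: r01 => /andP[r0 r1]; rewrite expr_lt1.
rewrite /pr /zonal_div /pt /p /poisson_ratio_dr.
case: (n - 1)%N => [|k]; first by rewrite !mul0r subr0 mulr0.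
rewrite [in RHS](exprS _ k) /= {3}/poisson_ratio.
move: (poisson_ratio r t ^+ k) d0; rewrite /poisson_den => u d0.
by field; rewrite r2 d0.
Qed.

Lemma integrable_poisson_profile :
  sigma.-integrable esphere (EFin \o (fun xi => p r (edot e xi))) /\
  sigma.-integrable esphere (EFin \o (fun xi => pr r (edot e xi))).
Proof.
have [Q HQ] := bounds.
split; apply: (integrable_esphere (C := Q)).
- exact: measurable_edot_S (measurable_ratio r (n - 1)).
- by move=> xi xS; have [] := HQ _ (edot_le1 xS).
- exact: measurable_edot_S (measurable_pr r).
- by move=> xi xS; have [] := HQ _ (edot_le1 xS).
Qed.

(** This is the derivative of the mean in [r]; it vanishes by the divergence theorem. *)
Lemma integral_poisson_dr :
  \int[sigma]_(xi in esphere) pr r (edot e xi) = 0.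
Proof.
have [Q HQ] := bounds.
have T0 := integral_sphere_zonal_div dp cpt (measurable_ratio r (n - 1))
  (measurable_pt r) (fun t t1 => let: And3 h _ _ := HQ t t1 in h)
  (fun t t1 => let: And3 _ h _ := HQ t t1 in h) n_gt0 e1.
rewrite (@eq_Rintegral _ _ _ _ _ (fun xi => - 2 / (1 - r ^+ 2) *
    @zonal_div R n (p r) (pt r) (edot e xi))); last first.
  by move=> xi; rewrite inE => xS; apply: zonal_div_pr; exact: edot_le1.
rewrite RintegralZl.
- by rewrite /Rintegral T0 /= mulr0.
- exact: measurable_esphere.
- apply: (integrable_esphere (C := Q * n%:R)).
    apply: measurable_edot_S; apply: measurable_zonal_div.
      exact: measurable_ratio.
    exact: measurable_pt.
  move=> xi xS; apply: (zonal_div_le (Q := Q)) => //; last exact: edot_le1.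
    by move=> t t1; have [] := HQ _ t1.
  by move=> t t1; have [] := HQ _ t1.
Qed.

End fixed_radius.

Let F r := \int[sigma]_(xi in esphere) p r (edot e xi).

Lemma poisson_profile_mean_quadratic r0 : 0 <= r0 < 1 ->
  exists2 C : R, 0 <= C & forall r r', 0 <= r <= r0 -> 0 <= r' <= r0 ->
    `|F r' - F r| <= C * (r' - r) ^+ 2.
Proof.
move=> r0b; have [C C0 HC] := poisson_profile_remainder (n - 1) r0b.
exists C => // r r' rr rr'.
have lt1 s : 0 <= s <= r0 -> 0 <= s < 1.
  by move: r0b => /andP[_ ?] /andP[-> ?]; lra.
have mS := @measurable_esphere R n.
have [pi pri] := integrable_poisson_profile (lt1 _ rr).
have [pi' _] := integrable_poisson_profile (lt1 _ rr').
have hi : sigma.-integrable esphere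
    (EFin \o (fun xi => (r' - r) * pr r (edot e xi))).
  have := integrableZl mS (r' - r) pri; apply: eq_integrable => //.
have Bi : sigma.-integrable esphere
    (EFin \o (fun xi => p r' (edot e xi) - p r (edot e xi))).
  by have := integrableB mS pi' pi; apply: eq_integrable.
have -> : F r' - F r = \int[sigma]_(xi in esphere)
    (p r' (edot e xi) - p r (edot e xi) - (r' - r) * pr r (edot e xi)).
  rewrite RintegralB// RintegralB// RintegralZl//.
  by rewrite (integral_poisson_dr (lt1 _ rr)) mulr0 subr0.
apply: Rintegral_esphere_le.
  apply: measurable_funB.
    by apply: measurable_funB; apply: measurable_edot_S; exact: measurable_ratio.
  by apply: measurable_funM => //; apply: measurable_edot_S; exact: measurable_pr.
by move=> xi xS; apply: HC => //; exact: edot_le1.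
Qed.

(** The increments of the mean are quadratic, so it is Lipschitz on [[0, r0]] with
every positive constant. *)
Lemma poisson_profile_mean_const r0 : 0 <= r0 < 1 -> F r0 = F 0.
Proof.
move=> r0b; have [C C0 HC] := poisson_profile_mean_quadratic r0b.
have /andP[r00 r01] := r0b.
have sr s : 0 <= s <= 1 -> 0 <= s * r0 <= r0.
  by move=> /andP[s0 s1]; rewrite mulr_ge0// ler_piMl.
have loc eps : 0 < eps -> forall s, 0 <= s <= 1 -> exists2 d, 0 < d &
    forall t, 0 <= t <= 1 -> `|t - s| <= d ->
    `|F (t * r0) - F (s * r0)| <= eps * `|t - s|.
  move=> eps0 s s1; exists (eps / (C + 1)).
    by rewrite divr_gt0// ltr_wpDl.
  move=> t t1 ts; apply: le_trans (HC _ _ (sr _ s1) (sr _ t1)) _.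
  rewrite -mulrBl exprMn -(real_normK (num_real (t - s))).
  have C1 : 0 < C + 1 by rewrite ltr_wpDl.
  rewrite ler_pdivlMr// in ts.
  have r2 : r0 ^+ 2 <= 1 by rewrite expr_le1// ltW.
  apply: (@le_trans _ _ (C * `|t - s| ^+ 2)).
    by rewrite ler_wpM2l// ler_piMr// sqr_ge0.
  rewrite expr2 mulrA ler_wpM2r//; apply: le_trans ts.
  by rewrite mulrC ler_wpM2l// lerDl.
apply/eqP; rewrite eq_le; apply/andP; split; apply/ler_addgt0Pr => eps eps0.
  have := local_to_global_lipschitz (loc _ eps0).
  by rewrite mul1r mul0r lerBlDl addrC.
have := @local_to_global_lipschitz _ (fun s => - F (s * r0)) eps.
rewrite mul1r mul0r opprK => H.
suff : - F r0 + F 0 <= eps by rewrite addrC lerBlDl addrC.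
apply: H => s s1; have [d d0 Hd] := loc _ eps0 s s1.
exists d => // t t1 ts; rewrite opprK addrC distrC; exact: Hd.
Qed.

End poisson_mean.

Lemma poisson_kernel_profile (R : realType) n (e xi : 'rV[R]_n) r :
  enorm e = 1 -> esphere xi ->
  poisson_kernel (r *: e) xi = poisson_ratio r (edot e xi) ^+ (n - 1).
Proof.
move=> e1 xS; rewrite /poisson_kernel /poisson_ratio /poisson_den.
rewrite enormB_sqr enormZ e1 mulr1 real_normK ?num_real//.
rewrite [enorm xi]xS expr1n edotZr edotC.
by congr ((_ / (_ - _ + _)) ^+ _); ring.
Qed.

Lemma poisson_kernel_mean (R : realType) n (x : 'rV[R]_n) : (0 < n)%N ->
  eball x ->
  \int[@sphere_measure R n]_(xi in esphere) poisson_kernel x xi =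
  \int[@sphere_measure R n]_(xi in esphere) poisson_kernel 0 xi.
Proof.
move=> n0 xB; have [->//|x0] := eqVneq x 0.
pose e := radial_proj x; have e1 : enorm e = 1 by exact: enorm_radial_proj.
have xE : x = enorm x *: e.
  by rewrite /e /radial_proj scalerA divff ?enorm_eq0// scale1r.
have E r : \int[@sphere_measure R n]_(xi in esphere) poisson_kernel (r *: e) xi =
    \int[@sphere_measure R n]_(xi in esphere)
      poisson_ratio r (edot e xi) ^+ (n - 1).
  by apply: eq_Rintegral => xi; rewrite inE => xS; exact: poisson_kernel_profile.
rewrite {1}xE E -(scale0r e) E; apply: poisson_profile_mean_const => //.
by rewrite enorm_ge0.
Qed.

(** * Displacement of the Poisson integral *)

Lemma poisson_exponents n : (3 <= n)%N ->
  [/\ (n - 1 = (n - 2).+1)%N, ((n - 1).+1 = n)%N,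
    (2 * (n - 1) = (2 * n - 3).+1)%N, (2 * n - 3 - (n - 1) = n - 2)%N &
    (n - 1 < 2 * n - 3)%N].
Proof. by move=> n3; split; lia. Qed.

Lemma expr_dist_le (R : realType) (W w w' : R) k :
  0 <= w <= W -> 0 <= w' <= W ->
  `|w ^+ k.+1 - w' ^+ k.+1| <= k.+1%:R * W ^+ k * `|w - w'|.
Proof.
move=> /andP[w0 wW] /andP[w'0 w'W]; have W0 := le_trans w0 wW.
elim: k => [|k IH]; first by rewrite !expr1 expr0 !mul1r.
have -> : w ^+ k.+2 - w' ^+ k.+2 =
    w * (w ^+ k.+1 - w' ^+ k.+1) + w' ^+ k.+1 * (w - w').
  by rewrite (exprS w k.+1) (exprS w' k.+1); ring.
apply: le_trans (ler_normD _ _) _.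
have -> : k.+2%:R * W ^+ k.+1 * `|w - w'| =
    W * (k.+1%:R * W ^+ k * `|w - w'|) + W ^+ k.+1 * `|w - w'|.
  by rewrite exprS -(natr1 k.+1); ring.
apply: lerD; rewrite normrM.
  by apply: ler_pM => //; rewrite ger0_norm.
rewrite ler_wpM2r// ger0_norm ?exprn_ge0//.
by apply: lerXn2r; rewrite ?nnegrE.
Qed.

(** Here [s = |xi - x|] and [s' = |xi - z|] are at least about [d = 1 - |x|], so a
displacement [h <= d / 2] changes them by a bounded factor, and [D <= 2 d <= 2 s]. *)
Lemma poisson_ratio_dist_le (R : realType) (D D' s s' d h : R) :
  0 < d -> 0 <= h -> 2 * h <= d -> d <= s -> 0 < D -> 0 < D' -> d <= D ->
  D <= 2 * d -> `|D - D'| <= 2 * h -> `|s - s'| <= h ->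
  `|D / s ^+ 2 - D' / s' ^+ 2| <= 28 * h / s ^+ 2 /\
  D' / s' ^+ 2 <= 8 * (D / s ^+ 2).
Proof.
move=> d0 h0 hd ds D0 D'0 dD D2d.
rewrite ler_norml => /andP[D1 D2]; rewrite ler_norml => /andP[s1 s2].
have s0 : 0 < s by exact: lt_le_trans ds.
have s'0 : 0 < s' by lra.
have s's : s <= 2 * s' by lra.
have ss : s ^+ 2 <= 4 * s' ^+ 2 by nra.
have e0 : 0 < s ^+ 2 by rewrite exprn_gt0.
have e'0 : 0 < s' ^+ 2 by rewrite exprn_gt0.
split; last first.
  rewrite ler_pdivrMr// mulrAC mulrA ler_pdivlMr//.
  apply: (@le_trans _ _ (2 * D * (4 * s' ^+ 2))); last by rewrite le_eqVlt; apply/orP; left; apply/eqP; ring.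
  by apply: ler_pM; rewrite ?(ltW D'0) ?(ltW e0)//; lra.
have -> : D / s ^+ 2 - D' / s' ^+ 2 =
    (D * (s' - s) * (s' + s) + (D - D') * s ^+ 2) / (s ^+ 2 * s' ^+ 2).
  by field; rewrite !gt_eqF.
rewrite normrM normfV (gtr0_norm (_ : 0 < s ^+ 2 * s' ^+ 2)) ?mulr_gt0//.
rewrite ler_pdivrMr ?mulr_gt0//.
rewrite [leRHS](_ : _ = 7 * h * (4 * s' ^+ 2)); last by field; rewrite gt_eqF.
apply: (@le_trans _ _ (7 * h * s ^+ 2)); last by rewrite ler_wpM2l ?mulr_ge0.
apply: le_trans (ler_normD _ _) _.
have A1 : `|D * (s' - s) * (s' + s)| <= 2 * s * h * (5 / 2 * s).
  rewrite normrM (normrM D) (gtr0_norm D0) (gtr0_norm (_ : 0 < s' + s)) ?addr_gt0//.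
  apply: ler_pM; rewrite ?mulr_ge0 ?(ltW D0) ?addr_ge0 ?(ltW s0) ?(ltW s'0)//; last by lra.
  apply: ler_pM; rewrite ?(ltW D0)//; first by lra.
  by rewrite ler_norml; apply/andP; split; lra.
have A2 : `|(D - D') * s ^+ 2| <= 2 * h * s ^+ 2.
  rewrite normrM (gtr0_norm e0) ler_wpM2r ?(ltW e0)//.
  by rewrite ler_norml; apply/andP; split.
by nra.
Qed.

Section poisson_lipschitz.
Context {R : realType} {n : nat}.
Hypothesis n_ge3 : (3 <= n)%N.
Implicit Types (x z xi : 'rV[R]_n).
Local Notation sigma := (@sphere_measure R n).

Lemma poisson_kernel_dist_le x z xi : eball x -> eball z -> esphere xi ->
  2 * enorm (x - z) <= 1 - enorm x ->
  `|poisson_kernel x xi - poisson_kernel z xi| <=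
    28 * 8 ^+ (n - 2) * (n - 1)%:R * enorm (x - z) *
    ((1 - enorm x ^+ 2) ^+ (n - 2) / enorm (xi - x) ^+ (2 * (n - 1))).
Proof.
move=> xB zB xS hx.
have x0 := enorm_ge0 x; have z0 := enorm_ge0 z; have h0 := enorm_ge0 (x - z).
have D0 := one_sub_sqr_gt0 xB; have D'0 := one_sub_sqr_gt0 zB.
have x1 : enorm x < 1 by []; have z1 : enorm z < 1 by [].
have d0 : 0 < 1 - enorm x by rewrite subr_gt0.
have ds : 1 - enorm x <= enorm (xi - x).
  by rewrite -[X in X - _]xS; exact: enormB_ge.
have s0 := lt_le_trans d0 ds.
have dD : 1 - enorm x <= 1 - enorm x ^+ 2 by nra.
have Dd : 1 - enorm x ^+ 2 <= 2 * (1 - enorm x) by nra.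
have DD : `|(1 - enorm x ^+ 2) - (1 - enorm z ^+ 2)| <= 2 * enorm (x - z).
  have := enorm_dist_norm x z; rewrite !ler_norml => /andP[a1 a2].
  by apply/andP; split; nra.
have ss : `|enorm (xi - x) - enorm (xi - z)| <= enorm (x - z).
  apply: le_trans (enorm_dist_norm _ _) _.
  by rewrite opprB addrC subrKA enorm_distC.
have [w1 w2] := poisson_ratio_dist_le d0 h0 hx ds D0 D'0 dD Dd DD ss.
rewrite /poisson_kernel.
set w := _ / enorm (xi - x) ^+ 2 in w1 w2 *.
set w' := _ / enorm (xi - z) ^+ 2 in w1 w2 *.
have w0 : 0 <= w by rewrite divr_ge0 ?sqr_ge0 ?ltW.
have w'0 : 0 <= w' by rewrite divr_ge0 ?sqr_ge0 ?ltW.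
have wW : 0 <= w <= 8 * w by rewrite w0/=; lra.
have w'W : 0 <= w' <= 8 * w by rewrite w'0.
have [En _ _ _ _] := poisson_exponents n_ge3.
rewrite {1 2}En; apply: le_trans (expr_dist_le _ wW w'W) _.
rewrite -En; apply: (@le_trans _ _ ((n - 1)%:R * (8 * w) ^+ (n - 2) *
   (28 * enorm (x - z) / enorm (xi - x) ^+ 2))).
  by rewrite ler_wpM2l// mulr_ge0// exprn_ge0// mulr_ge0.
rewrite le_eqVlt; apply/orP; left; apply/eqP.
rewrite exprMn /w expr_div_n exprM {3}En (exprS _ (n - 2)).
have u0 : enorm (xi - x) ^+ 2 != 0 by rewrite expf_neq0// gt_eqF.
have v0 : (enorm (xi - x) ^+ 2) ^+ (n - 2) != 0 by rewrite expf_neq0.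
move: ((enorm (xi - x) ^+ 2) ^+ (n - 2)) (enorm (xi - x) ^+ 2) u0 v0 => v u u0 v0.
by field; rewrite u0 v0.
Qed.

Lemma exists_nearest_esphere x : exists2 xh, esphere xh &
  eball x -> enorm (x - xh) = 1 - enorm x.
Proof.
have [->|x0] := eqVneq x 0.
  have n0 : (0 < n)%N by exact: leq_trans n_ge3.
  exists (delta_mx 0 (Ordinal n0)).
    rewrite /esphere/= /enorm (bigD1 (Ordinal n0))//= mxE !eqxx/= expr1n big1 ?addr0 ?sqrtr1//.
    by move=> j /negbTE j0; rewrite mxE j0 andbF expr0n.
  move=> _; rewrite enorm0 subr0 sub0r enormN.
  rewrite /enorm (bigD1 (Ordinal n0))//= mxE !eqxx/= expr1n big1 ?addr0 ?sqrtr1//.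
  by move=> j /negbTE j0; rewrite mxE j0 andbF expr0n.
exists (radial_proj x); first exact: enorm_radial_proj.
move=> xB; have xn : 0 < enorm x by rewrite enorm_gt0.
have -> : x - radial_proj x = (1 - (enorm x)^-1) *: x.
  by rewrite scalerBl scale1r.
rewrite enormZ distrC ger0_norm ?subr_ge0 ?invf_ge1// ?(ltW xB)//.
by rewrite mulrBl mulVf ?gt_eqF// mul1r.
Qed.

Variables (L : R) (phi : 'rV[R]_n -> 'rV[R]_n) (i : 'I_n).
Hypothesis L_ge0 : 0 <= L.
Hypothesis phi_lip : forall xi eta, esphere xi -> esphere eta ->
  enorm (phi xi - phi eta) <= L * enorm (xi - eta).

Let phi_lipi xi eta : esphere xi -> esphere eta ->
  `|phi xi ord0 i - phi eta ord0 i| <= L * enorm (xi - eta).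
Proof.
move=> xS eS; apply: le_trans (phi_lip xS eS).
by have := enorm_coord (phi xi - phi eta) i; rewrite !mxE.
Qed.

Let measurable_phi : measurable_fun esphere (fun xi => phi xi ord0 i).
Proof.
apply: within_continuous_measurable_rV; first exact: measurable_esphere.
apply/subspace_continuousP => xi xS; apply/cvgrPdist_lt => eps eps0.
have c := @continuous_enorm_dist R n xi xi.
have L1 : 0 < L + 1 by rewrite ltr_wpDl.
have : \forall y \near xi, enorm (y - xi) < eps / (L + 1).
  have e0 : 0 < eps / (L + 1) by rewrite divr_gt0.
  move/cvgrPdist_lt : c => /(_ _ e0); apply: filterS => y.
  by rewrite subrr enorm0 sub0r normrN ger0_norm ?enorm_ge0.
rewrite near_withinE; apply: filterS => y yx yS.
rewrite ltr_pdivlMr// in yx.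
apply: le_lt_trans (phi_lipi xS yS) _; rewrite enorm_distC.
apply: le_lt_trans yx; rewrite mulrC ler_wpM2l ?enorm_ge0// lerDl.
exact: ler01.
Qed.

Let measurable_poisson x : measurable_fun esphere (poisson_kernel x).
Proof.
apply: measurable_funX; apply: measurable_funM => //.
apply: measurable_funVr; apply: measurable_funX; apply: measurable_enorm_dist.
exact: measurable_esphere.
Qed.

Let n_gt0 : (0 < n)%N.
Proof. exact: leq_trans n_ge3. Qed.

Let poisson_kernel_bound x xi : eball x -> esphere xi ->
  `|poisson_kernel x xi| <= ((1 - enorm x) ^+ 2)^-1 ^+ (n - 1).
Proof.
move=> xB xS; have D0 := one_sub_sqr_gt0 xB.
have d0 : 0 < 1 - enorm x by rewrite subr_gt0.
have ds : 1 - enorm x <= enorm (xi - x).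
  by rewrite -[X in X - _]xS; exact: enormB_ge.
have s0 := lt_le_trans d0 ds.
rewrite ger0_norm; last by rewrite exprn_ge0// divr_ge0 ?sqr_ge0 ?ltW.
apply: lerXn2r; rewrite ?nnegrE ?invr_ge0 ?sqr_ge0//.
  by rewrite divr_ge0 ?sqr_ge0 ?ltW.
rewrite -[leRHS]mul1r; apply: ler_pM; rewrite ?invr_ge0 ?sqr_ge0 ?(ltW D0)//.
  by rewrite lerBlDr lerDl sqr_ge0.
rewrite lef_pV2 ?posrE ?exprn_gt0//.
by apply: lerXn2r; rewrite ?nnegrE ?(ltW d0) ?(ltW s0).
Qed.

Let integrable_poisson x : eball x ->
  sigma.-integrable esphere (EFin \o poisson_kernel x).
Proof.
move=> xB; apply: (integrable_esphere n_gt0 (C := ((1 - enorm x) ^+ 2)^-1 ^+ (n - 1))).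
  exact: measurable_poisson.
by move=> xi; exact: poisson_kernel_bound.
Qed.

Let enorm_esphere_dist xi eta : esphere xi -> esphere eta ->
  enorm (xi - eta) <= 2.
Proof.
move=> xS eS; apply: le_trans (enormD_le _ _) _.
by rewrite enormN [enorm xi]xS [enorm eta]eS; lra.
Qed.

Let integrable_poisson_phi x : eball x ->
  sigma.-integrable esphere
    (EFin \o (fun xi => poisson_kernel x xi * phi xi ord0 i)).
Proof.
move=> xB; have [xh xhS _] := exists_nearest_esphere 0.
apply: (integrable_esphere n_gt0 (C := ((1 - enorm x) ^+ 2)^-1 ^+ (n - 1) *
   (`|phi xh ord0 i| + L * 2))).
  by apply: measurable_funM => //; exact: measurable_poisson.
move=> xi xS; rewrite normrM; apply: ler_pM => //.
  exact: poisson_kernel_bound.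
rewrite -(subrK (phi xh ord0 i) (phi xi ord0 i)) addrC.
apply: le_trans (ler_normD _ _) _; rewrite lerD2l.
apply: le_trans (phi_lipi xS xhS) _.
by rewrite ler_wpM2l// enorm_esphere_dist.
Qed.

(** Because the kernels at [x] and [z] have the same mean, [phi] may be replaced by its
difference with the value at [xh], the boundary point nearest to [x]. By the Lipschitz
condition this gains a factor [2 |xi - x|], which turns the exponent [2 n - 2] of
the kernel estimate into [2 n - 3]; the integral over the sphere is then of order
[d^(2 - n)] and balances the factor [d^(n - 2)]. *)
Lemma poisson_integral_dist_le (A : R) x z : 0 <= A ->
  (forall x s, 0 < s -> (sphere_measure (esphere `&`
     [set xi | (enorm (xi - x) <= s)%R]) <= (A * s ^+ (n - 1))%:E)%E) ->
  eball x -> eball z -> 2 * enorm (x - z) <= 1 - enorm x ->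
  `|poisson_integral phi x ord0 i - poisson_integral phi z ord0 i| <=
    56 * 8 ^+ (n - 2) * (n - 1)%:R * 2 ^+ (n - 2) * (A * 2 ^+ n) * L *
    enorm (x - z).
Proof.
move=> A0 cap xB zB hx.
have [_ En1 E2n Egap ltn] := poisson_exponents n_ge3.
have mS := @measurable_esphere R n.
have [xh xhS /(_ xB) xxh] := exists_nearest_esphere x.
pose c := phi xh ord0 i; pose d := 1 - enorm x; pose h := enorm (x - z).
have d0 : 0 < d by rewrite subr_gt0.
have e0 := one_sub_sqr_gt0 xB.
have ed : 1 - enorm x ^+ 2 <= 2 * d.
  by rewrite /d; move: xB (enorm_ge0 x); rewrite /eball/=; nra.
have h0 : 0 <= h by exact: enorm_ge0.
pose K := 28 * 8 ^+ (n - 2) * (n - 1)%:R * h * ((2 * d) ^+ (n - 2) * (2 * L)).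
have K0 : 0 <= K by rewrite /K !mulr_ge0 ?exprn_ge0 ?mulr_ge0 ?(ltW d0).
have Px := integrable_poisson xB; have Pz := integrable_poisson zB.
have Fx := integrable_poisson_phi xB; have Fz := integrable_poisson_phi zB.
have Fxz : sigma.-integrable esphere (EFin \o (fun xi =>
    poisson_kernel x xi * phi xi ord0 i - poisson_kernel z xi * phi xi ord0 i)).
  by have := integrableB mS Fx Fz; apply: eq_integrable.
have Pxz : sigma.-integrable esphere (EFin \o (fun xi =>
    poisson_kernel x xi - poisson_kernel z xi)).
  by have := integrableB mS Px Pz; apply: eq_integrable.
have cPxz : sigma.-integrable esphere (EFin \o (fun xi =>
    c * (poisson_kernel x xi - poisson_kernel z xi))).
  by have := integrableZl mS c Pxz; apply: eq_integrable.
have -> : poisson_integral phi x ord0 i - poisson_integral phi z ord0 i =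
  \int[sigma]_(xi in esphere)
   ((poisson_kernel x xi * phi xi ord0 i - poisson_kernel z xi * phi xi ord0 i) -
     c * (poisson_kernel x xi - poisson_kernel z xi)).
  rewrite RintegralB// RintegralB// RintegralZl// RintegralB//.
  rewrite (poisson_kernel_mean n_gt0 xB) (poisson_kernel_mean n_gt0 zB).
  rewrite subrr mulr0 subr0 [X in X - _]mxE [X in _ - X]mxE.
  reflexivity.
have mD : measurable_fun esphere (fun xi : 'rV[R]_n => enorm (xi - x)).
  exact: measurable_enorm_dist.
have ds xi : esphere xi -> d <= enorm (xi - x).
  by move=> xS; rewrite /d -[X in X - _]xS; exact: enormB_ge.
apply: (Rintegral_norm_le (g := fun xi => K * enorm (xi - x) ^- (2 * n - 3))) => //.
- apply: measurable_funB.
    by apply: measurable_funB; apply: measurable_funM => //; exact: measurable_poisson.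
  by apply: measurable_funM => //; apply: measurable_funB; exact: measurable_poisson.
- move=> xi xS.
  have -> : poisson_kernel x xi * phi xi ord0 i - poisson_kernel z xi * phi xi ord0 i
      - c * (poisson_kernel x xi - poisson_kernel z xi) =
     (poisson_kernel x xi - poisson_kernel z xi) * (phi xi ord0 i - c).
    by ring.
  have s0 := lt_le_trans d0 (ds _ xS).
  rewrite normrM.
  apply: (@le_trans _ _ (28 * 8 ^+ (n - 2) * (n - 1)%:R * h *
      ((2 * d) ^+ (n - 2) / enorm (xi - x) ^+ (2 * (n - 1))) *
      (2 * L * enorm (xi - x)))).
    apply: ler_pM => //.
      apply: le_trans (poisson_kernel_dist_le xB zB xS hx) _.
      apply: ler_wpM2l; first by rewrite !mulr_ge0 ?exprn_ge0.
      apply: ler_wpM2r; first by rewrite invr_ge0 exprn_ge0 ?(ltW s0).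
      by apply: lerXn2r; rewrite ?nnegrE ?mulr_ge0 ?(ltW d0) ?(ltW e0).
    apply: le_trans (phi_lipi xS xhS) _.
    rewrite (mulrC 2 L) -mulrA ler_wpM2l//.
    apply: le_trans (enorm_dist_triangle x _ _) _.
    by rewrite xxh; have := ds _ xS; rewrite /d; lra.
  rewrite E2n.
  rewrite le_eqVlt; apply/orP; left; apply/eqP; rewrite exprS /K.
  have u0 : enorm (xi - x) != 0 by rewrite gt_eqF.
  have v0 : enorm (xi - x) ^+ (2 * n - 3) != 0 by rewrite expf_neq0.
  move: (enorm (xi - x) ^+ (2 * n - 3)) (enorm (xi - x)) u0 v0 => v u u0 v0.
  by field; rewrite u0 v0.
- apply: measurable_funM => //; apply: measurable_funVr.
  exact: measurable_funX.
under eq_integral do rewrite EFinM.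
rewrite ge0_integralZl//; last 2 first.
- by apply/measurable_EFinP; apply: measurable_funVr; exact: measurable_funX.
- by move=> xi _; rewrite lee_fin invr_ge0 exprn_ge0 ?enorm_ge0.
have F : (\int[sigma]_(xi in esphere) ((enorm (xi - x) ^- (2 * n - 3))%:E) <=
    (A * 2 ^+ (n - 1).+1 / d ^+ (2 * n - 3 - (n - 1)))%:E)%E.
  apply: integral_far_decay => //.
  by move=> s ds'; apply: cap; exact: lt_le_trans ds'.
apply: le_trans (lee_wpmul2l _ F) _; first by rewrite lee_fin.
rewrite -EFinM lee_fin.
rewrite Egap En1.
rewrite /K exprMn le_eqVlt; apply/orP; left; apply/eqP.
rewrite -/h; have v0 : d ^+ (n - 2) != 0 by rewrite expf_neq0// gt_eqF.
by move: (d ^+ (n - 2)) v0 => v v0; field.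
Qed.

End poisson_lipschitz.

(** * Lipschitz continuity of the solution *)

Unset Implicit Arguments.
Set Strict Implicit.

Theorem theorem1p2 (R : realType) (n : nat) (L M : R)
    (n_ge3 : (3 <= n)%N) (L_ge0 : 0 <= L) (M_ge0 : 0 <= M) :
  exists N : R,
    forall u phi psi : 'rV[R]_n -> 'rV[R]_n,
      Ck_on 2 eball u ->
      {within closure eball, continuous u} ->
      {within eball, continuous psi} ->
      green_integrable psi ->
      (forall x, eball x -> u x = poisson_integral phi x - green_integral psi x) ->
      (forall xi eta, esphere xi -> esphere eta ->
         enorm (phi xi - phi eta) <= L * enorm (xi - eta)) ->
      (forall x, eball x -> enorm (psi x) <= M * (1 - enorm x ^+ 2)) ->
      forall x y, eball x -> eball y ->
        enorm (u x - u y) <= N * enorm (x - y).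
Proof.
have n_gt0 : (0 < n)%N by exact: leq_trans n_ge3.
have [A A0 cap] := @sphere_cap_le R n n_gt0.
have [C C0 KC] := @integral_green_majorant_le R n n_ge3.
pose N1 := 56 * 8 ^+ (n - 2) * (n - 1)%:R * 2 ^+ (n - 2) * (A * 2 ^+ n) * L +
  12 * C * M.
(* [n] accounts for the passage from coordinates to the Euclidean norm *)
exists (n%:R * N1) => u phi psi _ _ cpsi _ uE phi_lip psi_le x y xB yB.
have loc a b : eball a -> eball b -> 2 * enorm (a - b) <= 1 - enorm a ->
    enorm (u a - u b) <= n%:R * N1 * enorm (a - b).
  move=> aB bB hab.
  have hb : enorm (a - b) <= 1 - enorm b.
    by have := enormB_ge b a; rewrite enorm_distC; have := enorm_ge0 (a - b); lra.
  have ha : enorm (a - b) <= 1 - enorm a by have := enorm_ge0 (a - b); lra.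
  apply: le_trans (enorm_le_sum _) _.
  have -> : n%:R * N1 * enorm (a - b) = \sum_(i < n) N1 * enorm (a - b).
    by rewrite sumr_const card_ord -mulrA mulr_natl.
  apply: ler_sum => i _; rewrite (uE _ aB) (uE _ bB).
  have H1 := poisson_integral_dist_le n_ge3 i L_ge0 phi_lip A0 cap aB bB hab.
  have H2 := green_integral_dist_le n_ge3 i M_ge0 cpsi psi_le aB bB KC ha hb.
  have E (p q p' q' : 'rV[R]_n) : (p - q - (p' - q')) ord0 i =
      (p ord0 i - p' ord0 i) - (q ord0 i - q' ord0 i) by rewrite !mxE; ring.
  rewrite [X in `|X|]E; apply: le_trans (ler_normB _ _) _.
  by rewrite mulrDl; apply: lerD.
pose g s := enorm (u (y + s *: (x - y)) - u y).
have := @local_to_global_lipschitz R g (n%:R * N1 * enorm (x - y)).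
rewrite /g scale0r addr0 subrr enorm0 subr0.
have -> : y + 1 *: (x - y) = x by rewrite scale1r addrC subrK.
apply.
move=> s s01; pose a := y + s *: (x - y).
have segB t : 0 <= t <= 1 -> eball (y + t *: (x - y)).
  move=> /andP[t0 t1]; rewrite /eball/=.
  have -> : y + t *: (x - y) = (1 - t) *: y + t *: x.
    by apply/rowP => j; rewrite !mxE; ring.
  apply: le_lt_trans (enormD_le _ _) _; rewrite !enormZ !ger0_norm ?subr_ge0//.
  move: xB yB; rewrite /eball/=; move: (enorm x) (enorm y) => p q p1 q1.
  have [t00|tn0] := eqVneq t 0; first by rewrite t00; lra.
  have tp : 0 < t by rewrite lt_neqAle eq_sym tn0.
  have : t * p < t * 1 by rewrite ltr_pM2l.
  have : (1 - t) * q <= (1 - t) * 1 by rewrite ler_wpM2l ?subr_ge0// ltW.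
  by lra.
have aB : eball a := segB s s01.
have xy1 : 0 < 2 * (enorm (x - y) + 1) by rewrite mulr_gt0// ltr_wpDl ?enorm_ge0.
exists ((1 - enorm a) / (2 * (enorm (x - y) + 1))).
  by rewrite divr_gt0// subr_gt0.
move=> t t01; rewrite ler_pdivlMr// => ts.
apply: le_trans (enorm_dist_norm _ _) _; rewrite opprB addrA subrK.
have E : a - (y + t *: (x - y)) = (s - t) *: (x - y).
  by apply/rowP => j; rewrite !mxE; ring.
rewrite (enorm_distC (u _)); have := loc a _ aB (segB t t01).
rewrite E enormZ distrC => H; rewrite -mulrA (mulrC (enorm _)).
apply: H; have := enorm_ge0 (x - y); have := normr_ge0 (t - s); nra.
Qed.
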